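(* Let $V$ be a complex vector space of dimension $n\geq 3$ and let $K\subseteq\bigwedge^2V$ be an arbitrary subspace. Then $$\mathcal R(V,K)=\{0\}\iff W_{n-3}(V,K)=0.$$
   Context: Let $S=\mathrm{Sym}(V)$ and let $K^\perp=(\bigwedge^2V/K)^\vee\subseteq\bigwedge^2V^\vee$ be the annihilator of $K$. The Koszul module $W(V,K)$ is the graded $S$-module $$W(V,K)=\mathrm{Coker}\Bigl\{\bigwedge^3V\otimes S\to\bigl(\bigwedge^2V/K\bigr)\otimes S\Bigr\},$$ where the map is the Koszul differential $\delta_3:\bigwedge^3V\otimes S\to\bigwedge^2V\otimes S$, $\delta_3(v_1\wedge v_2\wedge v_3\otimes f)=\sum_{j=1}^3(-1)^{j-1}v_1\wedge\cdots\wedge\widehat{v_j}\wedge\cdots\wedge v_3\otimes v_jf$, followed by the projection. Its degree $q$ component is $W_q(V,K)=\mathrm{Coker}\{\bigwedge^3V\otimes\mathrm{Sym}^{q-1}V\to(\bigwedge^2V/K)\otimes\mathrm{Sym}^qV\}$ (with $\mathrm{Sym}^{-1}V=0$). The resonance variety is $$\mathcal R(V,K)=\{a\in V^\vee:\text{ there exists } b\in V^\vee\text{ with } a\wedge b\in K^\perp\setminus\{0\}\}\cup\{0\}.$$ *)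

(* Defs.v *)
From HB Require Import structures.
From mathcomp Require Import all_boot all_order all_algebra all_fingroup.
From mathcomp Require Import classical_sets reals complex.
From mathcomp Require Import mpoly.

Set Implicit Arguments.
Unset Strict Implicit.
Unset Printing Implicit Defensive.

Import GRing.Theory.
Local Open Scope ring_scope.

Section Quotient.
Variables (F : fieldType) (V : vectType F).
Implicit Type U : {vspace V}.

(* The quotient V / U is carried by the complement U^C; quot_pi is the linear
   projection along U (surjective, with kernel U: limg_quot_pi, lker_quot_pi). *)
Definition quotv U : vectType F := subvs_of (U^C)%VS.

Definition quot_pi U : 'Hom(V, quotv U) :=
  linfun (fun v => vsproj (U^C)%VS (daddv_pi (U^C)%VS U v)).

Lemma quot_piE U v :
  quot_pi U v = vsproj (U^C)%VS (daddv_pi (U^C)%VS U v).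
Proof. exact: (lfunE (vsproj (U^C)%VS \o daddv_pi (U^C)%VS U)). Qed.

Lemma lker_quot_pi U : lker (quot_pi U) = U.
Proof.
apply/vspaceP => v; rewrite memv_ker quot_piE.
have dC : (U^C :&: U = 0)%VS by rewrite capvC capv_compl.
have vE : daddv_pi (U^C)%VS U v + daddv_pi U (U^C)%VS v = v.
  by apply: daddv_pi_add; rewrite // addvC addv_complf memvf.
apply/eqP/idP => [p0 | vU].
  rewrite -vE -(vsprojK (memv_pi (U^C)%VS U v)) p0 linear0 add0r.
  exact: memv_pi.
have : daddv_pi (U^C)%VS U v \in (U^C :&: U)%VS.
  rewrite memv_cap memv_pi /=.
  rewrite -(addrK (daddv_pi U (U^C)%VS v) (daddv_pi (U^C)%VS U v)) vE.
  by rewrite memvB // memv_pi.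
by rewrite dC memv0 => /eqP ->; rewrite linear0.
Qed.

Lemma limg_quot_pi U : limg (quot_pi U) = fullv.
Proof.
apply/vspaceP => w; rewrite memvf; apply/memv_imgP.
exists (vsval w); rewrite ?memvf // quot_piE daddv_pi_id ?vsvalK ?subvsP //.
by rewrite capvC capv_compl.
Qed.

End Quotient.

Section Tensor.
Variables (F : fieldType).
Implicit Types U V W : vectType F.

(* U (x) V in coordinates on the bases vbasis {:U} and vbasis {:V}; tens_lift is
   the linear map out of it induced by a bilinear one (tens_lift_tens). *)
Definition tensor U V : vectType F := 'M[F]_(\dim {:U}, \dim {:V}).

Definition tens U V (u : U) (v : V) : tensor U V :=
  \matrix_(i, j) (coord (vbasis {:U}) i u * coord (vbasis {:V}) j v).

Definition tens_lift U V W (B : U -> V -> W) (m : tensor U V) : W :=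
  \sum_i \sum_j
    (m : 'M_(_, _)) i j *: B (tnth (vbasis {:U}) i) (tnth (vbasis {:V}) j).

Lemma tens_lift_is_linear U V W (B : U -> V -> W) : linear (tens_lift B).
Proof.
move=> a x y; rewrite /tens_lift scaler_sumr -big_split /=.
apply: eq_bigr => i _; rewrite scaler_sumr -big_split /=.
by apply: eq_bigr => j _; rewrite !mxE scalerDl scalerA.
Qed.
HB.instance Definition _ U V W (B : U -> V -> W) :=
  GRing.isLinear.Build F (tensor U V) W _ (tens_lift B) (tens_lift_is_linear B).

Definition tens_map U U' V V' (f : 'Hom(U, U')) (g : 'Hom(V, V')) :
    'Hom(tensor U V, tensor U' V') :=
  linfun (tens_lift (fun u v => tens (f u) (g v))).

Lemma vbasis_sum U (u : U) :
  u = \sum_i coord (vbasis {:U}) i u *: tnth (vbasis {:U}) i.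
Proof.
rewrite {1}(coord_vbasis (memvf u)); apply: eq_bigr => i _.
by rewrite (tnth_nth 0).
Qed.

Lemma tens_lift_tens U V W (B : U -> V -> W) :
    (forall v, linear (B^~ v)) -> (forall u, linear (B u)) ->
  forall u v, tens_lift B (tens u v) = B u v.
Proof.
move=> Bl Br u v.
pose Bl' v := GRing.isLinear.Build F U W _ (B^~ v) (Bl v).
pose BL v : {linear U -> W} := HB.pack (B^~ v) (Bl' v).
pose Br' u := GRing.isLinear.Build F V W _ (B u) (Br u).
pose BR u : {linear V -> W} := HB.pack (B u) (Br' u).
rewrite -[B u v]/(BL v u) {2}(vbasis_sum u) linear_sum.
apply: eq_bigr => i _; rewrite linearZ /= -[B _ v]/(BR _ v) {2}(vbasis_sum v).
rewrite linear_sum scaler_sumr; apply: eq_bigr => j _.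
by rewrite linearZ /= scalerA mxE.
Qed.

Lemma tens_linearl U V (v : V) : linear (fun u : U => tens u v).
Proof.
by move=> a x y; apply/matrixP => i j; rewrite !mxE linearP mulrDl mulrA.
Qed.

Lemma tens_linearr U V (u : U) : linear (@tens U V u).
Proof.
by move=> a x y; apply/matrixP => i j; rewrite !mxE linearP mulrDr mulrCA.
Qed.

Lemma tens_mapE U U' V V' (f : 'Hom(U, U')) (g : 'Hom(V, V')) u v :
  tens_map f g (tens u v) = tens (f u) (g v).
Proof.
rewrite lfunE /= tens_lift_tens // => [w|w] a x y; rewrite linearP.
  exact: tens_linearl.
exact: tens_linearr.
Qed.

End Tensor.

Section ExteriorPower.
Variables (F : fieldType).
Implicit Types V W : vectType F.

(* The basis e_(f 0) /\ ... /\ e_(f (k - 1)) of the k-th exterior power of F^n is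
   indexed by the strictly increasing maps f. *)
Definition increasing k n (f : {ffun 'I_k -> 'I_n}) : bool :=
  [forall i : 'I_k, forall j : 'I_k, (i < j)%N ==> (f i < f j)%N].

Definition incr k n := {f : {ffun 'I_k -> 'I_n} | increasing f}.

Definition ext k V : vectType F := {ffun incr k (\dim {:V}) -> F^o}.

(* The coordinates of v_0 /\ ... /\ v_(k - 1) are the maximal minors of the
   coordinate matrix of (v_0, ..., v_(k - 1)). *)
Definition wedge k V (t : k.-tuple V) : ext k V :=
  [ffun f : incr k (\dim {:V}) =>
     \det (\matrix_(i < k, j < k)
             coord (vbasis {:V}) (val f j) (tnth t i)) : F^o].

(* The linear map induced by an alternating multilinear one (ext_lift_wedge). *)
Definition ext_lift k V W (phi : k.-tuple V -> W) (x : ext k V) : W :=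
  \sum_(f : incr k (\dim {:V}))
    ((x : {ffun _ -> _}) f : F) *:
      phi [tuple tnth (vbasis {:V}) (val f i) | i < k].

Lemma ext_lift_is_linear k V W (phi : k.-tuple V -> W) : linear (ext_lift phi).
Proof.
move=> a x y; rewrite /ext_lift scaler_sumr -big_split /=.
by apply: eq_bigr => i _; rewrite !ffunE scalerDl scalerA.
Qed.
HB.instance Definition _ k V W (phi : k.-tuple V -> W) :=
  GRing.isLinear.Build F (ext k V) W _ (ext_lift phi) (ext_lift_is_linear phi).

Definition set_tnth T k (t : k.-tuple T) (j : 'I_k) (x : T) : k.-tuple T :=
  [tuple if i == j then x else tnth t i | i < k].

Definition multilinear k V W (phi : k.-tuple V -> W) :=
  forall t j, linear (fun x => phi (set_tnth t j x)).

Definition alternating k V W (phi : k.-tuple V -> W) :=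
  forall t i j, i != j -> tnth t i = tnth t j -> phi t = 0.

Lemma set_tnthE T k (t : k.-tuple T) j x i :
  tnth (set_tnth t j x) i = if i == j then x else tnth t i.
Proof. exact: tnth_mktuple. Qed.

Section Lift.
Variables (V W : vectType F).
Let n : nat := \dim {:V}.
Let e (a : 'I_n) : V := tnth (vbasis {:V}) a.
Let c (v : V) (a : 'I_n) : F := coord (vbasis {:V}) a v.

Lemma multilinear_expand k (phi : k.-tuple V -> W) : multilinear phi ->
  forall t, phi t = \sum_(f : k.-tuple 'I_n)
    (\prod_(i < k) c (tnth t i) (tnth f i)) *: phi (map_tuple e f).
Proof.
elim: k phi => [|k IHk] phi phiL t.
  rewrite (big_pred1 [tuple]) => [|f]; last by rewrite [f]tuple0.
  by rewrite big_ord0 scale1r; congr phi; apply: val_inj; rewrite [t]tuple0.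
have phiL' x : multilinear (fun t' : k.-tuple V => phi (cons_tuple x t')).
  move=> t' j a u v.
  have E y : cons_tuple x (set_tnth t' j y)
             = set_tnth (cons_tuple x t') (lift ord0 j) y.
    apply: eq_from_tnth => i; rewrite set_tnthE.
    case: (unliftP ord0 i) => [i' ->|->]; last by rewrite !tnth0.
    by rewrite !tnthS set_tnthE (inj_eq lift_inj).
  by rewrite !E phiL.
have phi0 t' : linear (fun x => phi (cons_tuple x t')).
  move=> a u v.
  have E y : cons_tuple y t' = set_tnth (cons_tuple 0 t') ord0 y.
    apply: eq_from_tnth => i; rewrite set_tnthE.
    by case: (unliftP ord0 i) => [i' ->|->]; rewrite ?tnthS ?tnth0.
  by rewrite (E (a *: u + v)) (E u) (E v) phiL.
rewrite (reindex (fun p : 'I_n * k.-tuple 'I_n => cons_tuple p.1 p.2)) /=; last first.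
  exists (fun f : k.+1.-tuple 'I_n => (thead f, [tuple of behead f])) => [[a f] _|f _].
    by congr (_, _); apply: val_inj.
  by rewrite [RHS]tuple_eta; apply: val_inj.
rewrite -(pair_bigA _ (fun a (f : k.-tuple 'I_n) =>
  (\prod_(i < k.+1) c (tnth t i) (tnth (cons_tuple a f) i))
    *: phi (map_tuple e (cons_tuple a f)))) /=.
have tE : t = cons_tuple (thead t) [tuple of behead t].
  by rewrite [LHS]tuple_eta; apply: val_inj.
set x := thead t in tE; set t' := [tuple of behead t] in tE.
pose L' := GRing.isLinear.Build F V W _ _ (phi0 t').
pose L : {linear V -> W} := HB.pack (fun x => phi (cons_tuple x t')) L'.
rewrite {1}tE -[LHS]/(L x) {1}(vbasis_sum x) linear_sum.
apply: eq_bigr => a _; rewrite linearZ /= (IHk _ (phiL' _)) scaler_sumr.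
apply: eq_bigr => f _; rewrite scalerA big_ord_recl tE !tnth0; congr (_ *: _).
  by congr (_ * _); apply: eq_bigr => i _; rewrite !tnthS.
by congr phi; apply: val_inj.
Qed.

Variables (k : nat) (phi : k.-tuple V -> W).
Hypotheses (phiL : multilinear phi) (phiA : alternating phi).

Let set_tnth_tnth (t : k.-tuple V) i : set_tnth t i (tnth t i) = t.
Proof.
by apply: eq_from_tnth => m; rewrite set_tnthE; case: eqP => // ->.
Qed.

Let phiD t j x y :
  phi (set_tnth t j (x + y)) = phi (set_tnth t j x) + phi (set_tnth t j y).
Proof. by have := phiL t j 1 x y; rewrite !scale1r. Qed.

Lemma alternating_tperm t i j : i != j ->
  phi [tuple tnth t (tperm i j m) | m < k] = - phi t.
Proof.
move=> ij; pose g x y := phi (set_tnth (set_tnth t i x) j y).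
have ji : j != i by rewrite eq_sym.
have gxx x : g x x = 0.
  by apply: (phiA ij); rewrite !set_tnthE eqxx (negbTE ij) eqxx.
have gDr x y z : g x (y + z) = g x y + g x z by exact: phiD.
have gDl x y z : g (x + y) z = g x z + g y z.
  have E w : set_tnth (set_tnth t i w) j z = set_tnth (set_tnth t j z) i w.
    apply: eq_from_tnth => m; rewrite !set_tnthE.
    by case: (m =P j) => [->|//]; rewrite (negbTE ji).
  by rewrite /g !E phiD.
have := gxx (tnth t i + tnth t j); rewrite gDl !gDr !gxx add0r addr0.
have -> : g (tnth t i) (tnth t j) = phi t.
  rewrite /g set_tnth_tnth; congr phi; apply: eq_from_tnth => m.
  by rewrite set_tnthE; case: eqP => // ->.
move/eqP; rewrite addrC addr_eq0 => /eqP <-; congr phi.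
apply: eq_from_tnth => m; rewrite !set_tnthE tnth_mktuple.
case: tpermP => [->|->|/eqP/negbTE -> /eqP/negbTE -> //].
  by rewrite (negbTE ij) eqxx.
by rewrite eqxx.
Qed.

Lemma alternating_perm t (s : 'S_k) :
  phi [tuple tnth t (s m) | m < k] = (-1) ^+ s *: phi t.
Proof.
have [ts -> tsd] := prod_tpermP s.
elim: ts t tsd {s} => [|[i j] ts IH] t /=.
  move=> _; rewrite big_nil odd_perm1 scale1r; congr phi.
  by apply: eq_from_tnth => m; rewrite tnth_mktuple perm1.
case/andP=> ij tsd; rewrite big_cons odd_mul_tperm ij signr_addb expr1 /=.
set s := (\prod_(_ <- _) _)%g.
have -> : [tuple tnth t ((tperm i j * s)%g m) | m < k]
   = [tuple tnth [tuple tnth t (s m) | m < k] (tperm i j m) | m < k].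
  by apply: eq_from_tnth => m; rewrite !tnth_mktuple permM.
by rewrite alternating_tperm // (IH t tsd) mulN1r scaleNr.
Qed.

Let fam (p : incr k n * 'S_k) : k.-tuple 'I_n :=
  [tuple val p.1 (p.2 i) | i < k].

Let incr_mono (g : incr k n) (i j : 'I_k) : (i < j)%N -> (val g i < val g j)%N.
Proof. by have /forallP/(_ i)/forallP/(_ j)/implyP := valP g. Qed.

Let incr_inj (g : incr k n) : injective (val g).
Proof.
move=> i j gij; apply: val_inj; case: (ltngtP i j) => // /incr_mono -/(_ g).
  by rewrite gij ltnn.
by rewrite gij ltnn.
Qed.

Let ltI : rel 'I_n := fun a b => (a < b)%N.
Let leI : rel 'I_n := fun a b => (a <= b)%N.

Let incr_sorted (g : incr k n) : sorted leI [seq val g i | i <- enum 'I_k].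
Proof.
have : sorted (fun i j : 'I_k => (i < j)%N) (enum 'I_k).
  by have := iota_ltn_sorted 0 k; rewrite -val_enum_ord sorted_map.
rewrite sorted_map; apply: sub_sorted => i j ij.
by apply: ltnW; apply: incr_mono.
Qed.

Let fam_inj : injective fam.
Proof.
move=> [g s] [g' s'] E.
have Ei i : val g (s i) = val g' (s' i).
  by have := congr1 (fun f => tnth f i) E; rewrite !tnth_mktuple.
have gg' : [seq val g i | i <- enum 'I_k] = [seq val g' i | i <- enum 'I_k].
  apply: (@sorted_eq _ leI); rewrite ?incr_sorted //.
  - by move=> a b d; apply: leq_trans.
  - by move=> a b /anti_leq /val_inj.
  apply: uniq_perm; try by rewrite (map_inj_uniq (@incr_inj _)) enum_uniq.
  move=> a; apply/mapP/mapP => -[i _ ->].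
    by exists (s' (s^-1%g i)); rewrite ?mem_enum // -Ei permKV.
  by exists (s (s'^-1%g i)); rewrite ?mem_enum // Ei permKV.
have {gg'}gg : g = g'.
  apply/val_inj/ffunP => i; have := mem_enum 'I_k i; rewrite inE.
  by move=> ie; apply: (eq_in_map _ _ _).2 ie.
rewrite gg; congr (_, _); apply/permP => i.
by apply: (@incr_inj g'); rewrite -Ei gg.
Qed.

Let fam_surj (f : k.-tuple 'I_n) : uniq f -> exists p, f = fam p.
Proof.
move=> fu; pose h := sort_tuple leI f.
have hS : sorted ltI h.
  have hle : sorted leI h by apply: sort_sorted => a b; apply: leq_total.
  have := ltn_sorted_uniq_leq [seq val a | a <- h].
  by rewrite !sorted_map (map_inj_uniq val_inj) sort_uniq fu => ->.
have hI : increasing [ffun i => tnth h i].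
  apply/forallP => i; apply/forallP => j; apply/implyP => ij; rewrite !ffunE.
  rewrite (tnth_nth (tnth h i)) (tnth_nth (tnth h i) h j).
  have tr : transitive ltI by move=> a b d; apply: ltn_trans.
  by apply: (sorted_ltn_nth tr _ hS) => //; rewrite inE size_tuple.
have /tuple_permP [s fE] : perm_eq f h by rewrite perm_sym perm_sort.
exists (Sub [ffun i => tnth h i] hI, s).
have -> : f = [tuple tnth h (s i) | i < k] by apply: val_inj.
apply: eq_from_tnth => i; rewrite !tnth_mktuple SubK ffunE //.
Qed.

Lemma ext_lift_wedge t : ext_lift phi (wedge t) = phi t.
Proof.
rewrite (multilinear_expand phiL t) (bigID (fun f : k.-tuple 'I_n => uniq f)) /=.
rewrite [X in _ = _ + X]big1 ?addr0; last first.
  move=> f fu.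
  have /existsP[i /existsP[j /andP[ij /eqP fij]]] :
      [exists i, exists j, (i != j) && (tnth f i == tnth f j)].
    apply: contraNT fu => /existsPn fI; apply/tuple_uniqP => i j fij.
    apply/eqP; have := fI i; rewrite negb_exists => /forallP/(_ j).
    by rewrite fij eqxx andbT negbK.
  by rewrite (phiA ij) ?scaler0 // !tnth_map fij.
transitivity (\sum_p (\prod_(i < k) c (tnth t i) (tnth (fam p) i))
   *: phi (map_tuple e (fam p))); last first.
  rewrite -(big_imset (fun f : k.-tuple 'I_n =>
    (\prod_(i < k) c (tnth t i) (tnth f i)) *: phi (map_tuple e f))
    (in2W fam_inj)).
  apply: eq_bigl => f; apply/imsetP/idP => [[[g s] _ ->]|/fam_surj[p ->]].
    apply/tuple_uniqP => i j; rewrite !tnth_mktuple => /incr_inj.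
    exact: perm_inj.
  by exists p.
rewrite -(pair_bigA _ (fun g s => (\prod_(i < k) c (tnth t i) (tnth (fam (g, s)) i))
   *: phi (map_tuple e (fam (g, s))))) /ext_lift /=.
apply: eq_bigr => g _; rewrite ffunE /determinant scaler_suml.
apply: eq_bigr => s _.
have -> : map_tuple e (fam (g, s)) =
   [tuple tnth [tuple e (val g i) | i < k] (s m) | m < k].
  by apply: eq_from_tnth => i; rewrite tnth_map !tnth_mktuple.
rewrite alternating_perm scalerA mulrC; congr (_ * _ *: _).
by apply: eq_bigr => i _; rewrite mxE tnth_mktuple.
Qed.

End Lift.

Section MinorTuple.
Variables (V : vectType F) (k : nat) (l : 'I_k -> {linear V -> F^o}).

Lemma multilinear_det :
  multilinear (fun t : k.-tuple V =>
    (\det (\matrix_(i < k, j < k) (l j (tnth t i) : F)) : F^o)).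
Proof.
move=> t j a x y; rewrite -[X in _ = _ + X]mul1r.
apply: (@determinant_multilinear _ _ _ _ _ j).
- apply/rowP => m; rewrite !mxE !set_tnthE eqxx linearP; by rewrite mul1r.
- by apply/matrixP => i m; rewrite !mxE !set_tnthE eq_sym (negbTE (neq_lift j i)).
by apply/matrixP => i m; rewrite !mxE !set_tnthE eq_sym (negbTE (neq_lift j i)).
Qed.

Lemma alternating_det :
  alternating (fun t : k.-tuple V =>
    (\det (\matrix_(i < k, j < k) (l j (tnth t i) : F)) : F^o)).
Proof.
move=> t i j ij tij; apply: (determinant_alternate ij) => m.
by rewrite !mxE tij.
Qed.
End MinorTuple.

Lemma wedge_multilinear k V : multilinear (@wedge k V).
Proof.
move=> t j a x y; apply/ffunP => f; rewrite !ffunE.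
exact: (multilinear_det (fun i => coord (vbasis {:V}) (val f i)) t j a x y).
Qed.

Lemma wedge_alternating k V : alternating (@wedge k V).
Proof.
move=> t i j ij tij; apply/ffunP => f; rewrite !ffunE.
exact: (alternating_det (fun i => coord (vbasis {:V}) (val f i)) ij tij).
Qed.

End ExteriorPower.

Section Dual.
Variables (F : fieldType) (V : vectType F).

Definition dual : vectType F := 'Hom(V, F^o).

(* The duality between the k-th exterior powers of V^* and V:
   <a_0 /\ ... /\ a_(k-1), v_0 /\ ... /\ v_(k-1)> = det (a_i (v_j)). *)
Definition ext_pairing k (w : ext k dual) (x : ext k V) : F^o :=
  ext_lift (fun a : k.-tuple dual =>
    ext_lift (fun v : k.-tuple V =>
      \det (\matrix_(i < k, j < k) (tnth a i (tnth v j) : F)) : F^o) x) w.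

Lemma ext_pairing_wedge k (a : k.-tuple dual) (v : k.-tuple V) :
  ext_pairing (wedge a) (wedge v) =
  \det (\matrix_(i < k, j < k) (tnth a i (tnth v j) : F)).
Proof.
have evL u : linear (fun b : dual => b u : F^o).
  by move=> x b b'; rewrite add_lfunE scale_lfunE.
pose ev u : {linear dual -> F^o} :=
  HB.pack (fun b : dual => b u : F^o) (GRing.isLinear.Build F dual F^o _ _ (evL u)).
pose D (b : k.-tuple dual) (w : k.-tuple V) : F^o :=
  \det (\matrix_(i < k, j < k) (tnth b i (tnth w j) : F)).
have DT b w : D b w = \det (\matrix_(i < k, j < k) (tnth b j (tnth w i) : F)).
  by rewrite -det_tr; congr (\det _); apply/matrixP => i j; rewrite !mxE.
have inner b : ext_lift (D b) (wedge v) = D b v.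
  apply: ext_lift_wedge => [t j x y z|t i j ij tij]; rewrite !DT.
    exact: (multilinear_det (fun j => tnth b j)).
  exact: (alternating_det (fun j => tnth b j) ij tij).
rewrite /ext_pairing ext_lift_wedge ?inner // => [t j x y z|t i j ij tij].
  rewrite !inner; exact: (multilinear_det (fun j => ev (tnth v j))).
rewrite inner; exact: (alternating_det (fun j => ev (tnth v j)) ij tij).
Qed.

End Dual.

Section SymmetricPower.
Variables (F : fieldType).

(* Sym^q V: homogeneous polynomials of degree q in the basis vectors of V. *)
Definition sym_type q (V : vectType F) := dhomog (\dim {:V}) F q.
HB.instance Definition _ q V := GRing.Lmodule.on (sym_type q V).

Lemma dhomog0_vect_axiom (q : nat) : Vector.axiom (q == 0) (dhomog 0 F q).
Proof.
have m0 (m : 'X_{1..0}) : m = 0%MM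
  by apply/mnmP => -[[]].
pose f (p : dhomog 0 F q) : 'rV[F]_(q == 0) := \row_i p@_0%MM.
exists f => [c x y|]; first by apply/matrixP => i j; rewrite !mxE mcoeffD mcoeffZ.
have gP (r : 'rV[F]_(q == 0)) : (\sum_i r 0 i)%:MP_[0] \is q.-homog.
  case: eqP r => [-> r|_ r]; first by rewrite -alg_mpolyC rpredZ ?dhomog1.
  by rewrite big_ord0 mpolyC0 dhomog0.
exists (fun r => DHomog (gP r)) => [p|r].
  apply/val_inj/mpolyP => m /=; rewrite mcoeffC (m0 m) eqxx mulr1.
  under eq_bigr do rewrite mxE.
  rewrite sumr_const card_ord.
  case: eqP => [//|q0]; rewrite mulr0n.
  apply/esym/(dhomog_nemf_coeff (dhomog_is_dhomog p)).
  by rewrite /= mdeg0 eq_sym; apply/eqP.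
apply/matrixP => i j; rewrite !mxE /= mcoeffC eqxx mulr1 ord1.
case: eqP i j r {gP} => [_|_] i j r; last by case: j.
by rewrite big_ord1; congr (r _ _); apply: val_inj; case: j => -[].
Qed.

Definition dhomog_dim (n q : nat) : nat := if n is n'.+1 then 'C(q + n', q) else q == 0.

Lemma dhomog_vect_axiom n q : Vector.axiom (dhomog_dim n q) (dhomog n F q).
Proof. by case: n => [|n]; [apply: dhomog0_vect_axiom | apply: dhomog_vecaxiom]. Qed.

HB.instance Definition _ q V :=
  Lmodule_hasFinDim.Build F (sym_type q V) (dhomog_vect_axiom (\dim {:V}) q).

Definition sym q (V : vectType F) : vectType F := sym_type q V.

Variable V : vectType F.

Definition sym_inj (v : V) : {mpoly F[\dim {:V}]} :=
  \sum_i coord (vbasis {:V}) i v *: 'X_i.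

Lemma sym_inj_homog v : sym_inj v \is 1.-homog.
Proof. by apply: rpred_sum => i _; rewrite rpredZ // dhomogX /= mdeg1. Qed.

Definition sym_mul q (v : V) (s : sym q V) : sym q.+1 V :=
  DHomog (dhomogM (sym_inj_homog v) (dhomog_is_dhomog s)).

Lemma sym_mul_linearl q (s : sym q V) : linear (fun v => sym_mul v s).
Proof.
move=> a x y; apply/val_inj; rewrite [RHS]linearP /= scalerAl -mulrDl; congr (_ * _).
rewrite /sym_inj scaler_sumr -big_split /=.
by apply: eq_bigr => i _; rewrite linearP scalerDl scalerA.
Qed.

Lemma sym_mul_linearr q v : linear (@sym_mul q v).
Proof.
by move=> a x y; apply/val_inj; rewrite [RHS]linearP /= mulrDr scalerAr.
Qed.

End SymmetricPower.

Section Koszul.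
Variables (F : fieldType) (V : vectType F).

Definition koszul_d3 q : 'Hom(tensor (ext 3 V) (sym q V),
                              tensor (ext 2 V) (sym q.+1 V)) :=
  linfun (tens_lift (fun (x : ext 3 V) (s : sym q V) =>
    ext_lift (fun v : 3.-tuple V =>
      \sum_(j < 3) (-1) ^+ j *:
        tens (wedge [tuple tnth v (lift j i) | i < 2]) (sym_mul (tnth v j) s))
    x)).

Lemma wedge_swap (a b : V) : wedge [tuple a; b] = - wedge [tuple b; a].
Proof.
rewrite -(alternating_tperm (@wedge_multilinear _ 2 V) (@wedge_alternating _ 2 V)
  _ (isT : (0 : 'I_2) != 1)).
congr wedge; apply: eq_from_tnth => i; rewrite tnth_mktuple.
case: tpermP => [->|->|/eqP i0 /eqP i1] //.
by case: i i0 i1 => -[|[|]].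
Qed.

Lemma koszul_d3E q (v : 3.-tuple V) (s : sym q V) :
  koszul_d3 q (tens (wedge v) s) =
  \sum_(j < 3) (-1) ^+ j *:
    tens (wedge [tuple tnth v (lift j i) | i < 2]) (sym_mul (tnth v j) s).
Proof.
pose om (t : 3.-tuple V) (j : 'I_3) := wedge [tuple tnth t (lift j i) | i < 2].
pose phi (z : sym q V) (t : 3.-tuple V) :=
  \sum_(j < 3) (-1) ^+ j *: tens (om t j) (sym_mul (tnth t j) z).
have phiL z : multilinear (phi z).
  move=> t i a x y; rewrite /phi scaler_sumr -big_split /=.
  apply: eq_bigr => j _; rewrite scalerA mulrC -scalerA -scalerDr.
  congr (_ *: _); rewrite /om !set_tnthE.
  case: (unliftP j i) => [i' ->|->].
    rewrite !(negbTE (neq_lift j i')).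
    have E u : [tuple tnth (set_tnth t (lift j i') u) (lift j m) | m < 2]
             = set_tnth [tuple tnth t (lift j m) | m < 2] i' u.
      apply: eq_from_tnth => m; rewrite tnth_mktuple !set_tnthE tnth_mktuple.
      by rewrite (inj_eq lift_inj).
    by rewrite !E wedge_multilinear tens_linearl.
  rewrite eqxx.
  have E u : [tuple tnth (set_tnth t j u) (lift j m) | m < 2]
           = [tuple tnth t (lift j m) | m < 2].
    apply: eq_from_tnth => m; rewrite !tnth_mktuple.
    by rewrite eq_sym (negbTE (neq_lift j m)).
  by rewrite !E sym_mul_linearl tens_linearr.
have tensNl (u : ext 2 V) (w : sym q.+1 V) : tens (- u) w = - tens u w.
  by apply/matrixP => i j; rewrite !mxE linearN mulNr.
have tens0l (w : sym q.+1 V) : tens (0 : ext 2 V) w = 0.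
  by apply/matrixP => i j; rewrite !mxE linear0 mul0r.
have waa (a : V) : wedge [tuple a; a] = 0.
  exact: (wedge_alternating (isT : (0 : 'I_2) != 1)).
pose o0 : 'I_3 := Ordinal (isT : (0 < 3)%N).
pose o1 : 'I_3 := Ordinal (isT : (1 < 3)%N).
pose o2 : 'I_3 := Ordinal (isT : (2 < 3)%N).
have o3P (m : 'I_3) : [\/ m = o0, m = o1 | m = o2].
  case: m => -[|[|[|//]]] ltm; [apply: Or31 | apply: Or32 | apply: Or33];
    exact: val_inj.
pose T (z : sym q V) (t : 3.-tuple V) a b c :=
  tens (wedge [tuple tnth t a; tnth t b]) (sym_mul (tnth t c) z).
have omE t (j a b : 'I_3) :
    lift j (ord0 : 'I_2) = a -> lift j (ord_max : 'I_2) = b ->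
    om t j = wedge [tuple tnth t a; tnth t b].
  move=> <- <-; congr wedge; apply: eq_from_tnth => m; rewrite tnth_mktuple.
  have [->|->] // : m = ord0 \/ m = ord_max.
  by case: m => -[|[|//]] ltm; [left | right]; exact: val_inj.
have phiE z t : phi z t = T z t o1 o2 o0 - T z t o0 o2 o1 + T z t o0 o1 o2.
  rewrite /phi !big_ord_recl big_ord0 addr0 addrA.
  rewrite (_ : lift ord0 (lift ord0 ord0) = o2); last exact: val_inj.
  rewrite (_ : lift ord0 ord0 = o1); last exact: val_inj.
  rewrite (_ : ord0 = o0); last exact: val_inj.
  rewrite /= expr0 scale1r expr1 scaleN1r expr2 mulN1r opprK scale1r.
  rewrite (omE t o0 o1 o2) ?(omE t o1 o0 o2) ?(omE t o2 o0 o1) //;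
    exact: val_inj.
have phiA z : alternating (phi z).
  move=> t i j ij; rewrite phiE /T.
  case: (o3P i) (o3P j) ij => -> [] -> // _ => [e|e|e|e|e|e];
    rewrite e ?waa ?tens0l ?subr0 ?addr0 ?add0r ?subrr // 1?wedge_swap ?tensNl
      ?addNr ?addrN //.
have inner z : ext_lift (phi z) (wedge v) = phi z v by exact: ext_lift_wedge.
rewrite lfunE /= (tens_lift_tens (B := fun x s => ext_lift (phi s) x)) //.
  by move=> z a x y; rewrite linearP.
move=> x a z z'; rewrite /ext_lift scaler_sumr -big_split /=.
apply: eq_bigr => f _; rewrite scalerA mulrC -scalerA -scalerDr; congr (_ *: _).
rewrite /phi scaler_sumr -big_split /=; apply: eq_bigr => j _.
rewrite scalerA mulrC -scalerA -scalerDr; congr (_ *: _).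
by rewrite sym_mul_linearr tens_linearr.
Qed.

(* The image of the degree q presentation map; it is 0 for q = 0, as
   Sym^(-1) V = 0. *)
Definition koszul_image (K : {vspace ext 2 V}) q :
    {vspace tensor (quotv K) (sym q V)} :=
  if q is q'.+1 then limg (tens_map (quot_pi K) \1 \o koszul_d3 q')%VF else 0%VS.

(* The degree q component of the Koszul module W(V, K). *)
Definition koszul_module (K : {vspace ext 2 V}) q : vectType F :=
  quotv (koszul_image K q).

Local Open Scope classical_set_scope.

Definition annihilator (K : {vspace ext 2 V}) : set (ext 2 (dual V)) :=
  [set w | forall x, x \in K -> ext_pairing w x = 0].

Definition resonance (K : {vspace ext 2 V}) : set (dual V) :=
  [set a | exists b : dual V, (annihilator K `\ 0) (wedge [tuple a; b])]
    `|` [set 0].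

End Koszul.

(* Main.v *)
(** The dual of W_q(V, K) consists of the skew families (l_ij) of functionals on
    Sym^q V that vanish on the image of the Koszul differential and on K.  If a /\ b
    is a nonzero element of the annihilator of K, then evaluation at a, multiplied by
    the coordinates of a /\ b, is a nonzero such family for every q.

    Conversely, assume that the resonance is trivial.  If nonzero families existed in
    every degree, then, on a suitable subspace where one coordinate acts bijectively in
    large degrees, the quotients of the others by it would have a common eigenvector,
    whose values would give a nonzero decomposable element of the annihilator of K; so
    the families vanish in some degree T.  By duality, after multiplication by a power
    of any x_j, the map from K (x) S to M = ker (V (x) S -> S) is split surjective.  A
    complex of Buchsbaum-Rim type built on K (x) S -> M is therefore exact after
    inverting any x_j, and chasing it modulo (x_1), (x_1, x_2), ... along its last n - 1
    terms shows that every element of M with coefficients of degree n - 2 comes from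
    K (x) Sym^(n-3) V.  For s of degree n - 3, this applies to x_i s e_j - x_j s e_i;
    evaluating a family on the resulting skew cycle and using Euler's identity gives
    2 (n - 1) l_ij(s) = 0. *)

From HB Require Import structures.
Require Import Defs.
From mathcomp Require Import all_boot all_order all_algebra.
From mathcomp Require Import boolp classical_sets reals complex.
From mathcomp Require Import spectral mpoly ring.

Set Implicit Arguments.
Unset Strict Implicit.
Unset Printing Implicit Defensive.

Import Order.TTheory GRing.Theory Num.Theory.
Local Open Scope ring_scope.

(** * The exterior algebra over a commutative ring *)

(** Inverting [x_j] splits the complex, but this yields boundaries only up to a power of [x_j].
    Cancelling one factor [x_j] turns a relation at one place of the complex into a cycle at the
    preceding place modulo one more variable, so exactness is needed there beforehand. The regress
    stops when all variables have been set to 0, because an element of positive degree then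
    vanishes. The map joining the two parts of the complex is a product of n - 1 vectors of linear
    forms divided by one variable, so it has degree n - 2; its argument has to be of positive degree
    after one multiplication by a variable. Hence degree n - 2 suffices in M, and n - 3 in K (x) S.
    Characteristic 0 enters because the homotopy operator has positive integers as eigenvalues,
    which have to be inverted. *)

Section ExteriorSign.
Variables (P : comNzRingType) (m : nat).

(* An element w of the exterior algebra of P^m is stored as the function sending
   J to the coefficient of the product of the basis vectors of J, taken in
   increasing order. *)
Definition ext_sign (s : 'I_m) (J : {set 'I_m}) : P :=
  \prod_(t : 'I_m | (t < s)%N) (-1) ^+ (t \in J).

Lemma ext_signD1 s t J :
  ext_sign s (J :\ t) = (-1) ^+ ((t < s)%N && (t \in J)) * ext_sign s J.
Proof.
rewrite /ext_sign; case: (ltnP t s) => ts /=; last first.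
  rewrite mul1r; apply: eq_bigr => r rs; rewrite !inE.
  by case: eqP => [E|//]; move: rs; rewrite E ltnNge ts.
rewrite (bigD1 t) //= (bigD1 t ts) /= !inE eqxx /= mul1r mulrA -signr_addb addbb.
by rewrite mul1r; apply: eq_bigr => r /andP[_ rt]; rewrite !inE rt.
Qed.

Lemma ext_signU1 s t J :
  ext_sign s (t |: J) = (-1) ^+ ((t < s)%N && (t \notin J)) * ext_sign s J.
Proof.
rewrite /ext_sign; case: (ltnP t s) => ts /=; last first.
  rewrite mul1r; apply: eq_bigr => r rs; rewrite !inE.
  by case: eqP => [E|//]; move: rs; rewrite E ltnNge ts.
rewrite (bigD1 t) //= (bigD1 t ts) /= !inE eqxx /= mulrA -signr_addb.
rewrite addNb addbb.
by congr (_ * _); apply: eq_bigr => r /andP[_ rt]; rewrite !inE (negbTE rt).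
Qed.

Lemma ext_sign2 s J : ext_sign s J * ext_sign s J = 1.
Proof. by rewrite -big_split big1 //= => i _; rewrite -signr_addb addbb. Qed.

End ExteriorSign.

(** Exterior multiplication by the s-th basis vector; [contract1] is contraction by the dual basis
    vector. In both, the sign counts the members of [J] below [s]. *)
HB.lock Definition wedge1 (P : comNzRingType) m (s : 'I_m)
    (w : {ffun {set 'I_m} -> P^o}) : {ffun {set 'I_m} -> P^o} :=
  [ffun J : {set 'I_m} => if s \in J then ext_sign P s J * w (J :\ s) else 0 : P^o].

HB.lock Definition contract1 (P : comNzRingType) m (s : 'I_m)
    (w : {ffun {set 'I_m} -> P^o}) : {ffun {set 'I_m} -> P^o} :=
  [ffun J : {set 'I_m} => if s \in J then 0 else ext_sign P s J * w (s |: J) : P^o].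

Arguments wedge1 {P m} s w.
Arguments contract1 {P m} s w.

Section Elementary.
Variables (P : comNzRingType) (m : nat).
Local Notation wedge1 := (@wedge1 P m).
Local Notation contract1 := (@contract1 P m).
Local Notation exterior := {ffun {set 'I_m} -> P^o}.
Implicit Types (s t : 'I_m) (w : exterior) (J : {set 'I_m}).

Lemma wedge1E s w J :
  wedge1 s w J = if s \in J then ext_sign P s J * w (J :\ s) else 0.
Proof. by rewrite wedge1.unlock ffunE. Qed.

Lemma contract1E s w J :
  contract1 s w J = if s \in J then 0 else ext_sign P s J * w (s |: J).
Proof. by rewrite contract1.unlock ffunE. Qed.

Lemma wedge1_is_linear s : linear (wedge1 s).
Proof.
move=> a u v; apply/ffunP => J; rewrite !(wedge1E, contract1E, ffunE); case: ifP => _.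
  by rewrite mulrDr /GRing.scale /= mulrCA.
by rewrite scaler0 addr0.
Qed.
HB.instance Definition _ s :=
  GRing.isLinear.Build P exterior exterior _ (wedge1 s) (wedge1_is_linear s).

Lemma contract1_is_linear s : linear (contract1 s).
Proof.
move=> a u v; apply/ffunP => J; rewrite !(wedge1E, contract1E, ffunE); case: ifP => _.
  by rewrite scaler0 addr0.
by rewrite mulrDr /GRing.scale /= mulrCA.
Qed.
HB.instance Definition _ s :=
  GRing.isLinear.Build P exterior exterior _ (contract1 s) (contract1_is_linear s).

Lemma wedge1_anti s t w : wedge1 s (wedge1 t w) + wedge1 t (wedge1 s w) = 0.
Proof.
have [<-|st] := eqVneq s t.
  by apply/ffunP => J; rewrite !(wedge1E, contract1E, ffunE) !inE eqxx /= mulr0 if_same addr0.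
apply/ffunP => J; rewrite !(wedge1E, contract1E, ffunE) !inE (eq_sym t s) st /=.
case: (boolP (s \in J)) => sJ; case: (boolP (t \in J)) => tJ /=;
  rewrite ?mulr0 ?addr0 //.
rewrite finset.setDDl finset.setUC -finset.setDDl !ext_signD1 sJ tJ !andbT.
case: (ltngtP s t) => [lt|lt|/val_inj e]; last by rewrite e eqxx in st.
  by rewrite expr0 expr1; ring.
by rewrite expr0 expr1; ring.
Qed.

Lemma contract1_anti s t w :
  contract1 s (contract1 t w) + contract1 t (contract1 s w) = 0.
Proof.
have [<-|st] := eqVneq s t.
  by apply/ffunP => J; rewrite !(wedge1E, contract1E, ffunE) !inE eqxx /= mulr0 if_same addr0.
apply/ffunP => J; rewrite !(wedge1E, contract1E, ffunE) !inE (eq_sym t s) (negbTE st) /=.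
case: (boolP (s \in J)) => sJ; case: (boolP (t \in J)) => tJ /=;
  rewrite ?mulr0 ?addr0 //.
rewrite finset.setUCA !ext_signU1 sJ tJ !andbT.
case: (ltngtP s t) => [lt|lt|/val_inj e]; last by rewrite e eqxx in st.
  by rewrite expr0 expr1; ring.
by rewrite expr0 expr1; ring.
Qed.

(** The Clifford relation. For [s != t], removing or adding the smaller index changes the sign
    attached to the larger one, so the two terms cancel. *)
Lemma wedge1_contract1 s t w :
  wedge1 s (contract1 t w) + contract1 t (wedge1 s w) = (s == t)%:R *: w.
Proof.
have [<-|st] := eqVneq s t.
  apply/ffunP => J; rewrite !(wedge1E, contract1E, ffunE) !inE eqxx /= scale1r.
  case: (boolP (s \in J)) => sJ.
    by rewrite ext_signD1 ltnn mul1r mulrA ext_sign2 mul1r addr0 finset.setD1K.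
  by rewrite ext_signU1 ltnn mul1r mulrA ext_sign2 mul1r add0r finset.setU1K.
apply/ffunP => J; rewrite !(wedge1E, contract1E, ffunE) !inE (eq_sym t s) (negbTE st) /= scale0r.
case: (boolP (s \in J)) => sJ; case: (boolP (t \in J)) => tJ /=;
  rewrite ?mulr0 ?addr0 //.
rewrite ext_signU1 ext_signD1 sJ tJ !andbT.
have -> : (t |: J) :\ s = t |: J :\ s.
  apply/finset.setP => r; rewrite !inE; case: (r =P t) => [->|//].
  by rewrite eq_sym st.
case: (ltngtP s t) => [lt|lt|/val_inj e]; last by rewrite e eqxx in st.
  by rewrite expr0 expr1; ring.
by rewrite expr0 expr1; ring.
Qed.

End Elementary.

HB.lock Definition wedgel (P : comNzRingType) m (a : 'I_m -> P)
    (w : {ffun {set 'I_m} -> P^o}) : {ffun {set 'I_m} -> P^o} :=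
  \sum_s a s *: wedge1 s w.

HB.lock Definition contract (P : comNzRingType) m (f : 'I_m -> P)
    (w : {ffun {set 'I_m} -> P^o}) : {ffun {set 'I_m} -> P^o} :=
  \sum_s f s *: contract1 s w.

Arguments wedgel {P m} a w.
Arguments contract {P m} f w.

Section ExteriorAlgebra.
Variables (P : comNzRingType) (m : nat).
Local Notation wedgel := (@wedgel P m).
Local Notation contract := (@contract P m).
Local Notation exterior := {ffun {set 'I_m} -> P^o}.
Implicit Types (s t : 'I_m) (w : exterior).

Lemma wedgelE a w : wedgel a w = \sum_s a s *: wedge1 s w.
Proof. by rewrite wedgel.unlock. Qed.

Lemma contractE f w : contract f w = \sum_s f s *: contract1 s w.
Proof. by rewrite contract.unlock. Qed.

Lemma wedgel_is_linear a : linear (wedgel a).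
Proof.
move=> c u v; rewrite !wedgelE scaler_sumr -big_split; apply: eq_bigr => s _ /=.
by rewrite linearP scalerDr !scalerA mulrC.
Qed.
HB.instance Definition _ a :=
  GRing.isLinear.Build P exterior exterior _ (wedgel a) (wedgel_is_linear a).

Lemma contract_is_linear f : linear (contract f).
Proof.
move=> c u v; rewrite !contractE scaler_sumr -big_split; apply: eq_bigr => s _ /=.
by rewrite linearP scalerDr !scalerA mulrC.
Qed.
HB.instance Definition _ f :=
  GRing.isLinear.Build P exterior exterior _ (contract f) (contract_is_linear f).

Lemma wedgel_anti a b w : wedgel a (wedgel b w) = - wedgel b (wedgel a w).
Proof.
apply/eqP; rewrite -addr_eq0; apply/eqP; rewrite !wedgelE.
under eq_bigr do rewrite linear_sum scaler_sumr.
rewrite [X in _ + X](eq_bigr (fun s => \sum_t b s *: (wedge1 s (a t *: wedge1 t w))));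
  last by move=> s _; rewrite linear_sum scaler_sumr.
rewrite [X in _ + X]exchange_big -big_split big1 //= => s _.
rewrite -big_split big1 //= => t _; rewrite !linearZ /= !scalerA (mulrC (b t)).
by rewrite -scalerDr wedge1_anti scaler0.
Qed.

Lemma contract_anti a b w : contract a (contract b w) = - contract b (contract a w).
Proof.
apply/eqP; rewrite -addr_eq0; apply/eqP; rewrite !contractE.
under eq_bigr do rewrite linear_sum scaler_sumr.
rewrite [X in _ + X](eq_bigr (fun s => \sum_t b s *: (contract1 s (a t *: contract1 t w))));
  last by move=> s _; rewrite linear_sum scaler_sumr.
rewrite [X in _ + X]exchange_big -big_split big1 //= => s _.
rewrite -big_split big1 //= => t _; rewrite !linearZ /= !scalerA (mulrC (b t)).
by rewrite -scalerDr contract1_anti scaler0.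
Qed.

(** Contraction is an antiderivation; this is the bilinear form of [wedge1_contract1]. *)
Lemma contract_wedgel a f w :
  contract f (wedgel a w) = (\sum_s f s * a s) *: w - wedgel a (contract f w).
Proof.
apply/eqP; rewrite eq_sym subr_eq eq_sym; apply/eqP; rewrite !(wedgelE, contractE).
under eq_bigr do rewrite linear_sum scaler_sumr.
rewrite [X in _ + X](eq_bigr (fun s => \sum_t a s *: (wedge1 s (f t *: contract1 t w))));
  last by move=> s _; rewrite linear_sum scaler_sumr.
rewrite [X in _ + X]exchange_big -big_split scaler_suml; apply: eq_bigr => s _ /=.
rewrite -big_split (bigD1 s) //= [X in _ + X]big1 => [|t ts]; last first.
  rewrite !linearZ /= !scalerA (mulrC (a t)) -scalerDr addrC wedge1_contract1.
  by rewrite (negbTE ts) scale0r scaler0.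
rewrite addr0 !linearZ /= !scalerA (mulrC (a s)) -scalerDr addrC wedge1_contract1 eqxx.
by rewrite scale1r.
Qed.

Lemma wedgel_sum (I : finType) (c : I -> P) (a : I -> 'I_m -> P) w :
  wedgel (fun s => \sum_i c i * a i s) w = \sum_i c i *: wedgel (a i) w.
Proof.
rewrite !wedgelE; under eq_bigr do rewrite scaler_suml.
rewrite exchange_big; apply: eq_bigr => i _; rewrite wedgelE scaler_sumr.
by apply: eq_bigr => s _; rewrite scalerA.
Qed.

Lemma eq_wedgel a b : a =1 b -> wedgel a =1 wedgel b.
Proof. by move=> ab w; rewrite !wedgelE; apply: eq_bigr => s _; rewrite ab. Qed.

End ExteriorAlgebra.

(** * Projections onto spans of monomials *)

Section MonomialProjection.
Variables (F : fieldType) (N : nat).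
Implicit Types (p q c : {mpoly F[N]}) (Q : pred 'X_{1..N}).

(** One operator serves both the substitution of 0 for variables ([cut]) and the projection onto a
    bidegree ([eproj]). *)
Definition mproj Q p : {mpoly F[N]} :=
  \sum_(m <- msupp p | Q m) p@_m *: 'X_[m].

Lemma mproj_coeff Q p m : (mproj Q p)@_m = if Q m then p@_m else 0.
Proof.
rewrite /mproj raddf_sum /= (eq_bigr (fun k => p@_k * (k == m)%:R)); last first.
  by move=> k _; rewrite mcoeffZ mcoeffX.
case: (boolP (m \in msupp p)) => [mp|mp].
  rewrite -big_filter; case: ifP => Qm.
    rewrite (bigD1_seq m) ?filter_uniq ?msupp_uniq ?mem_filter ?Qm //=.
    by rewrite eqxx mulr1 big1 ?addr0 // => k /negbTE ->; rewrite mulr0.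
  rewrite big_filter big1_seq // => k /andP[Qk _]; case: eqP => [e|_].
    by rewrite e Qm in Qk.
  by rewrite mulr0.
rewrite (memN_msupp_eq0 mp) if_same big1_seq // => k /andP[_ kp].
by case: eqP => [e|_]; rewrite ?mulr0 //; rewrite -e kp in mp.
Qed.

Lemma mproj_is_linear Q : linear (mproj Q).
Proof.
move=> a p q; apply/mpolyP => m; rewrite mcoeffD mcoeffZ !mproj_coeff.
by case: ifP; rewrite ?mcoeffD ?mcoeffZ // mulr0 addr0.
Qed.
HB.instance Definition _ Q :=
  GRing.isLinear.Build F {mpoly F[N]} {mpoly F[N]} _ (mproj Q) (mproj_is_linear Q).

(** The hypothesis says that multiplication by a monomial of [c] turns [Q'] into [Q]: a shift of
    degree, or no change when [Q] ignores the variables of [c]. *)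
Lemma mprojM Q Q' c p :
    (forall k1 k2, c@_k1 != 0 -> Q (k1 + k2)%MM = Q' k2) ->
  mproj Q (c * p) = c * mproj Q' p.
Proof.
move=> QQ'; apply/mpolyP => m; rewrite mproj_coeff !mcoeffM.
case: ifP => Qm; [apply: eq_bigr | apply/esym/big1] => k /eqP mk;
  have [->|c0] := eqVneq (c@_k.1) 0; rewrite ?mul0r //;
  by rewrite mproj_coeff -(QQ' _ _ c0) -mk Qm ?mulr0.
Qed.

Lemma mproj_id Q p : (forall m, p@_m != 0 -> Q m) -> mproj Q p = p.
Proof.
move=> Qp; apply/mpolyP => m; rewrite mproj_coeff; case: ifP => // Qm.
by case: eqVneq (Qp m) => [->|_] // /(_ isT); rewrite Qm.
Qed.

Lemma mproj_deriv Q Q' j p : (forall m, Q' (m + U_(j))%MM = Q m) ->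
  mproj Q p^`M(j) = (mproj Q' p)^`M(j).
Proof.
move=> QQ'; apply/mpolyP => m; rewrite mproj_coeff !mcoeff_deriv mproj_coeff QQ'.
by case: ifP => //; rewrite mul0rn.
Qed.

Lemma mproj_divX j p : mproj (fun m => m j == 0%N) p = 0 ->
  exists p', p = 'X_j * p'.
Proof.
move=> p0; exists (\sum_(m <- msupp p) p@_m *: 'X_[m - U_(j)]).
rewrite mulr_sumr {1}[p]mpolyE; apply: eq_big_seq => m mp.
rewrite -scalerAr -mpolyXD; congr (_ *: 'X_[_]).
rewrite addmC submK // lep1mP; apply/negP => m0.
have := congr1 (mcoeff m) p0; rewrite mproj_coeff m0 mcoeff0 => /eqP.
by apply/negP; rewrite -mcoeff_msupp.
Qed.

End MonomialProjection.

(** * Coefficientwise maps on the exterior algebra *)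

HB.lock Definition ext_map (P : comNzRingType) m (f : P -> P)
    (w : {ffun {set 'I_m} -> P^o}) : {ffun {set 'I_m} -> P^o} :=
  [ffun J => f (w J) : P^o].
Arguments ext_map {P m} f w.

Section ExteriorMap.
Variables (P : idomainType) (m : nat).
Local Notation extP := {ffun {set 'I_m} -> P^o}.
Implicit Types (s : 'I_m) (w : extP).

Lemma ext_signP s (J : {set 'I_m}) : ext_sign P s J = 1 \/ ext_sign P s J = -1.
Proof.
have /eqP := ext_sign2 P s J; rewrite -expr2 sqrf_eq1.
by case/orP => /eqP; [left | right].
Qed.

Lemma ext_mapE f w J : @ext_map P m f w J = f (w J).
Proof. by rewrite ext_map.unlock ffunE. Qed.

Section Additive.
Variable f : {additive P -> P}.

Lemma ext_map_is_additive : additive (@ext_map P m f).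
Proof. by move=> u v; apply/ffunP => J; rewrite !(ext_mapE, ffunE) raddfB. Qed.
HB.instance Definition _ :=
  GRing.isAdditive.Build extP extP (@ext_map P m f) ext_map_is_additive.

Lemma ext_map_wedge1 s w : ext_map f (wedge1 s w) = wedge1 s (ext_map f w).
Proof.
apply/ffunP => J; rewrite !(ext_mapE, wedge1E, ffunE); case: ifP => _; last by rewrite raddf0.
by case: (ext_signP s J) => ->; rewrite ?mul1r // !mulN1r raddfN.
Qed.

Lemma ext_map_contract1 s w : ext_map f (contract1 s w) = contract1 s (ext_map f w).
Proof.
apply/ffunP => J; rewrite !(ext_mapE, contract1E, ffunE); case: ifP => _; first by rewrite raddf0.
by case: (ext_signP s J) => ->; rewrite ?mul1r // !mulN1r raddfN.
Qed.

End Additive.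

Lemma ext_mapZ (f g h : {additive P -> P}) a w :
    (forall p, f (a * p) = h a * g p) ->
  ext_map f (a *: w : extP) = h a *: ext_map g w.
Proof. by move=> fg; apply/ffunP => J; rewrite !(ext_mapE, ffunE) fg. Qed.

Lemma ext_map_wedgel (f g : {additive P -> P}) (a b : 'I_m -> P) w :
    (forall s p, f (a s * p) = b s * g p) ->
  ext_map f (wedgel a w) = wedgel b (ext_map g w).
Proof.
move=> fg; rewrite !wedgelE raddf_sum; apply: eq_bigr => s _.
rewrite -ext_map_wedge1; by apply/ffunP => J; rewrite !(ext_mapE, ffunE) fg.
Qed.

Lemma ext_map_contract (f g : {additive P -> P}) (a b : 'I_m -> P) w :
    (forall s p, f (a s * p) = b s * g p) ->
  ext_map f (contract a w) = contract b (ext_map g w).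
Proof.
move=> fg; rewrite !contractE raddf_sum; apply: eq_bigr => s _.
rewrite -ext_map_contract1; by apply/ffunP => J; rewrite !(ext_mapE, ffunE) fg.
Qed.

End ExteriorMap.

(** * The differential and its local homotopy *)

Section KoszulForms.
Variables (F : numFieldType) (n m : nat) (kap : 'I_m -> 'I_n -> 'I_n -> F).
Hypothesis kap_skew : forall s a b, kap s a b = - kap s b a.
Local Notation P := {mpoly F[n + n]}.
Local Notation ext := {ffun {set 'I_m} -> P^o}.

(* P is the ring F[x_1, ..., x_n, y_1, ..., y_n].  With k_s the skew form with
   coefficients kap s, kform b s is k_s(x, e_b). *)
Definition xvar (b : 'I_n) : P := 'X_(lshift n b).
Definition yvar (b : 'I_n) : P := 'X_(rshift n b).
Definition kform (b : 'I_n) (s : 'I_m) : P := \sum_a kap s a b *: xvar a.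
(** M is free only locally. Over [x_j <> 0] the classes of the [y_b] modulo this form generate the
    dual of M, so P modulo [xyform] models the symmetric algebra of that dual. *)
Definition xyform : P := \sum_b xvar b * yvar b.

Lemma xvar_neq0 b : xvar b != 0.
Proof.
apply/eqP => /(congr1 (mcoeff U_(lshift n b)%MM)).
by rewrite mcoeffXU eqxx mcoeff0 => /eqP; rewrite oner_eq0.
Qed.

Lemma mderiv_xvar c b : (xvar b)^`M(rshift n c) = 0.
Proof.
by rewrite mderivX mnm1E eq_lrshift scale0r.
Qed.

Lemma mderiv_yvar c b : (yvar b)^`M(rshift n c) = (b == c)%:R.
Proof.
rewrite mderivX mnm1E (inj_eq (@rshift_inj _ _)).
case: eqP => [->|_]; last by rewrite scale0r.
rewrite scale1r (_ : (_ - _)%MM = 0%MM) ?mpolyX0 //.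
by apply/mnmP => i; rewrite mnmBE subnn mnm0E.
Qed.

Lemma mderiv_kform c b s : (kform b s)^`M(rshift n c) = 0.
Proof.
by rewrite raddf_sum big1 //= => a _; rewrite mderivZ mderiv_xvar scaler0.
Qed.

Lemma mderiv_xy c : xyform^`M(rshift n c) = xvar c.
Proof.
rewrite raddf_sum (bigD1 c) //= big1 => [|b bc].
  by rewrite mderivM mderiv_xvar mderiv_yvar eqxx mul0r add0r mulr1 addr0.
by rewrite mderivM mderiv_xvar mderiv_yvar (negbTE bc) mul0r add0r mulr0.
Qed.

Lemma sum_xvar_kform s : \sum_b xvar b * kform b s = 0.
Proof.
set S := \sum_b _.
have : S = - S.
  rewrite {1}/S; under eq_bigr do rewrite mulr_sumr.
  rewrite exchange_big -sumrN; apply: eq_bigr => a _; rewrite mulr_sumr -sumrN.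
  apply: eq_bigr => b _.
  by rewrite -!scalerAr (kap_skew s a b) scaleNr (mulrC (xvar a)).
move/eqP; rewrite -subr_eq0 opprK -mulr2n -scaler_nat.
by rewrite scaler_eq0 pnatr_eq0 => /eqP.
Qed.

Definition dy (c : 'I_n) : ext -> ext := ext_map (mderiv (rshift n c)).
HB.instance Definition _ c := GRing.Additive.on (dy c).

Lemma dyZ c p w : dy c (p *: w) = p^`M(rshift n c) *: w + p *: dy c w.
Proof. by apply/ffunP => J; rewrite !(ext_mapE, ffunE) mderivM. Qed.

Lemma dyZ0 c p w : p^`M(rshift n c) = 0 -> dy c (p *: w) = p *: dy c w.
Proof. by move=> p0; rewrite dyZ p0 scale0r add0r. Qed.

Lemma dy_comm b c w : dy b (dy c w) = dy c (dy b w).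
Proof. by apply/ffunP => J; rewrite !ext_mapE mderiv_comm. Qed.

Lemma dy_wedgel c a w : (forall s, (a s)^`M(rshift n c) = 0) ->
  dy c (wedgel a w) = wedgel a (dy c w).
Proof.
move=> a0; apply: ext_map_wedgel => s p.
by rewrite /= mderivM a0 mul0r add0r.
Qed.

Lemma dy_contract c a w : (forall s, (a s)^`M(rshift n c) = 0) ->
  dy c (contract a w) = contract a (dy c w).
Proof.
move=> a0; apply: ext_map_contract => s p.
by rewrite /= mderivM a0 mul0r add0r.
Qed.

(* The differential \sum_b k_b /\ d/dy_b of a complex of Buchsbaum-Rim type, where
   k_b = \sum_s k_s(x, e_b) e_s in the exterior algebra of P^m. *)
Definition dK (w : ext) : ext := \sum_b wedgel (kform b) (dy b w).

Lemma dK_is_additive : additive dK.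
Proof.
by move=> u v; rewrite /dK -sumrB; apply: eq_bigr => b _; rewrite !raddfB.
Qed.
HB.instance Definition _ := GRing.isAdditive.Build ext ext dK dK_is_additive.

Lemma dKZ p w : (forall c, p^`M(rshift n c) = 0) -> dK (p *: w) = p *: dK w.
Proof.
move=> p0; rewrite /dK scaler_sumr; apply: eq_bigr => b _.
by rewrite dyZ0 // linearZ.
Qed.

(** The derivative of [xyform] by [y_b] is [x_b], and [\sum_b x_b k_b = 0]; hence [dK] descends to
    the quotient by [xyform]. *)
Lemma dK_xy w : dK (xyform *: w) = xyform *: dK w.
Proof.
rewrite /dK scaler_sumr; under eq_bigr do rewrite dyZ mderiv_xy linearD !linearZ /=.
rewrite big_split /= [X in X + _](_ : _ = 0) ?add0r //.
rewrite -wedgel_sum (eq_wedgel (b := fun=> 0)) => [|s]; last exact: sum_xvar_kform.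
by rewrite wedgelE big1 // => s _; rewrite scale0r.
Qed.

Lemma ext_eqN0 (w : ext) : w = - w -> w = 0.
Proof.
move=> wN; apply/ffunP => J; have /eqP := congr1 (fun f : ext => f J : P) wN.
rewrite !ffunE -subr_eq0 opprK -mulr2n -mulr_natr mulf_eq0 => /orP[/eqP //|].
by rewrite -mpolyC_nat mpolyC_eq0 pnatr_eq0.
Qed.

(** The [k_b] anticommute while the derivatives commute. *)
Lemma dK_dK w : dK (dK w) = 0.
Proof.
set S := dK _.
have E : S = \sum_b \sum_c wedgel (kform b) (wedgel (kform c) (dy b (dy c w))).
  apply: eq_bigr => b _; rewrite (raddf_sum (dy b)) (raddf_sum (wedgel (kform b))).
  apply: eq_bigr => c _.
  by rewrite /= dy_wedgel // => s; rewrite mderiv_kform.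
apply: ext_eqN0; rewrite {1}E exchange_big E -sumrN; apply: eq_bigr => c _; rewrite -sumrN.
by apply: eq_bigr => b _; rewrite wedgel_anti dy_comm.
Qed.

(* The contracting homotopy that a local splitting of K (x) S -> M over the
   open set x_j <> 0 provides. *)
Section LocalHomotopy.
Variables (j : 'I_n) (T : nat) (sg : 'I_n -> 'I_m -> P).
Hypothesis sg_deriv : forall b s c, (sg b s)^`M(rshift n c) = 0.
Hypothesis sg_j : forall s, sg j s = 0.
Hypothesis sgE : forall b c, \sum_s sg b s * kform c s =
  xvar j ^+ T * (xvar j * (b == c)%:R - xvar b * (j == c)%:R).
Let u := xvar j ^+ T.+1.

Let u_neq0 : u != 0. Proof. by rewrite expf_neq0 ?xvar_neq0. Qed.

Lemma splitting_dual b c : c != j ->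
  \sum_s sg b s * kform c s = xvar j ^+ T.+1 *+ (b == c).
Proof.
move=> cj; rewrite sgE (eq_sym j) (negbTE cj) mulr0 subr0 mulrA -exprSr.
by rewrite -[RHS]mulr_natr.
Qed.

(** Formally the adjoint of [dK]: multiplication by [y_b] replaces the derivative, and the lift
    [sg b] of [x_j ^+ T] times [x_j e_b - x_b e_j] replaces [k_b]. *)
Definition hK (w : ext) : ext := \sum_b yvar b *: contract (sg b) w.

Lemma hK_is_additive : additive hK.
Proof.
move=> v w; rewrite /hK -sumrB; apply: eq_bigr => b _.
by rewrite raddfB /= scalerBr.
Qed.
HB.instance Definition _ := GRing.isAdditive.Build ext ext hK hK_is_additive.

Lemma hKZ p w : hK (p *: w) = p *: hK w.
Proof.
rewrite /hK scaler_sumr; apply: eq_bigr => b _.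
by rewrite linearZ /= !scalerA mulrC.
Qed.

(** Up to the factor [u] this is a number operator, counting the factors [k_b] with [b] in [B];
    [shifts_nK] states its eigenvalues. *)
Definition nK (B : seq 'I_n) (w : ext) : ext :=
  \sum_(b <- B) wedgel (kform b) (contract (sg b) w).

Lemma nK_is_linear B : linear (nK B).
Proof.
move=> a v w; rewrite /nK scaler_sumr -big_split; apply: eq_bigr => b _ /=.
by rewrite !linearP.
Qed.
HB.instance Definition _ B :=
  GRing.isLinear.Build P ext ext _ (nK B) (nK_is_linear B).

Lemma contract0 (w : ext) f : f =1 (fun=> 0) -> contract f w = 0.
Proof. by move=> f0; rewrite contractE big1 // => s _; rewrite f0 scale0r. Qed.

Lemma nK_cons b B w :
  nK (b :: B) w = wedgel (kform b) (contract (sg b) w) + nK B w.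
Proof. by rewrite /nK big_cons. Qed.

Lemma nK_comm_wedgel B b w : j \notin B -> b \notin B -> b != j ->
  nK B (wedgel (kform b) w) = wedgel (kform b) (nK B w).
Proof.
move=> jB bB bj; rewrite /nK raddf_sum; apply: eq_big_seq => c cB /=.
have cb : (c == b) = false by apply: contraNF bB => /eqP <-.
rewrite contract_wedgel splitting_dual // cb mulr0n scale0r sub0r.
by rewrite raddfN /= wedgel_anti opprK.
Qed.

Lemma nK_comm_contract B b w : j \notin B -> b \notin B ->
  nK B (contract (sg b) w) = contract (sg b) (nK B w).
Proof.
move=> jB bB; rewrite /nK raddf_sum; apply: eq_big_seq => c cB /=.
have bc : (b == c) = false by apply: contraNF bB => /eqP ->.
have cj : c != j by apply: contraNneq jB => <-.
rewrite contract_wedgel splitting_dual // bc mulr0n scale0r sub0r.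
by rewrite contract_anti raddfN.
Qed.

Definition shifts (O : ext -> ext) (cs : seq nat) (w : ext) : ext :=
  foldl (fun v c => O v - (u *+ c) *: v) w cs.

Lemma shifts_cons O c cs w :
  shifts O (c :: cs) w = shifts O cs (O w - (u *+ c) *: w).
Proof. by []. Qed.

Lemma shifts_cat O cs cs' w :
  shifts O (cs ++ cs') w = shifts O cs' (shifts O cs w).
Proof. exact: foldl_cat. Qed.

Lemma shifts_is_additive (O : {additive ext -> ext}) cs : additive (shifts O cs).
Proof.
elim: cs => [|c cs IH] v w; first by [].
rewrite !shifts_cons -IH; congr (shifts _ _ _); rewrite raddfB scalerBr !opprB.
by rewrite addrACA [RHS]addrACA; congr (_ + _); rewrite addrC.
Qed.
HB.instance Definition _ (O : {additive ext -> ext}) cs :=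
  GRing.isAdditive.Build ext ext (shifts O cs) (shifts_is_additive O cs).

Lemma shiftsZ (O : ext -> ext) p cs w : (forall v, O (p *: v) = p *: O v) ->
  shifts O cs (p *: w) = p *: shifts O cs w.
Proof.
move=> Op; elim: cs w => [|c cs IH] w; first by [].
by rewrite !shifts_cons -IH Op scalerBr !scalerA mulrC.
Qed.

Lemma ext_scale_eq0 (p : P) (w : ext) : p != 0 -> p *: w = 0 -> w = 0.
Proof.
move=> p0 pw; apply/ffunP => J; have /eqP := congr1 (fun f : ext => f J : P) pw.
by rewrite !ffunE mulf_eq0 (negbTE p0) => /eqP.
Qed.

Lemma wedgel_wedgel a (w : ext) : wedgel a (wedgel a w) = 0.
Proof. by apply: ext_eqN0; rewrite {1}wedgel_anti. Qed.

Lemma contract_contract a (w : ext) : contract a (contract a w) = 0.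
Proof. by apply: ext_eqN0; rewrite {1}contract_anti. Qed.

(** Induction on [B]. On multiples of [k_b] the new operator is the old one raised by [u], on
    contractions by [sg b] it is the old one, and [u *: w] is a sum of two such elements; finally
    [u] is cancelled. *)
Lemma shifts_nK B w : uniq B -> j \notin B ->
  shifts (nK B) (iota 0 (size B).+1) w = 0.
Proof.
elim: B w => [|b B IH] w.
  by move=> _ _; rewrite /= /nK big_nil mulr0n scale0r subr0.
rewrite cons_uniq inE negb_or => /andP[bB uB] /andP[jb jB].
rewrite [size (b :: B)]/=.
have bj : b != j by rewrite eq_sym.
set k := wedgel (kform b); set i := contract (sg b).
have nKk v : nK (b :: B) (k v) = k (u *: v + nK B v).
  rewrite nK_cons nK_comm_wedgel // [RHS]linearD; congr (_ + _).
  rewrite contract_wedgel splitting_dual // eqxx mulr1n linearB /= linearZ /=.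
  by rewrite wedgel_wedgel subr0.
have nKi v : nK (b :: B) (i v) = i (nK B v).
  rewrite nK_cons nK_comm_contract //.
  by rewrite contract_contract raddf0 add0r.
have Sk cs v : shifts (nK (b :: B)) (map S cs) (k v) = k (shifts (nK B) cs v).
  elim: cs v => [|c cs IHc] v; first by [].
  rewrite !shifts_cons nKk -IHc; congr (shifts _ _ _).
  rewrite -[_ *: k v]linearZ -linearB mulrS scalerDl opprD addrA; congr (k (_ - _)).
  by rewrite addrC addKr.
have Si cs v : shifts (nK (b :: B)) cs (i v) = i (shifts (nK B) cs v).
  elim: cs v => [|c cs IHc] v; first by [].
  rewrite !shifts_cons nKi -IHc; congr (shifts _ _ _).
  by rewrite -linearZ -linearB.
(* The factor for 0 stays inside the image of [k]; the other factors act there as the old ones with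
   eigenvalues lowered by one. *)
have Sk0 v : shifts (nK (b :: B)) (iota 0 (size B).+2) (k v) = 0.
  have -> : iota 0 (size B).+2 = 0%N :: map S (iota 0 (size B).+1).
    by rewrite /= (iotaDl 1 1).
  rewrite shifts_cons mulr0n scale0r subr0 nKk Sk.
  by rewrite IH // /k raddf0.
have Si0 v : shifts (nK (b :: B)) (iota 0 (size B).+2) (i v) = 0.
  rewrite Si -addn1 iotaD shifts_cat IH // shifts_cons.
  by rewrite (raddf0 (nK B)) scaler0 subr0 /shifts /= /i raddf0.
apply: (ext_scale_eq0 u_neq0); rewrite -shiftsZ; last by move=> v; rewrite linearZ.
have -> : u *: w = k (i w) + i (k w).
  by rewrite /i /k contract_wedgel splitting_dual // eqxx mulr1n addrC subrK.
transitivity (shifts (nK (b :: B)) (iota 0 (size B).+2) (k (i w)) +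
              shifts (nK (b :: B)) (iota 0 (size B).+2) (i (k w))).
  exact: raddfD.
by rewrite Sk0 Si0 addr0.
Qed.

Definition others := [seq b <- index_enum 'I_n | b != j].

(** The cross terms cancel by [contract_wedgel]. What remains is [nK], from d/dy_b hitting [y_b],
    and the pairings of [sg b] with [k_c], which give the Euler operator in y and a multiple of
    [xyform]. *)
Lemma homotopy w : dK (hK w) + hK (dK w) =
  nK others w + u *: (\sum_b yvar b *: dy b w) - xvar j ^+ T *: (xyform *: dy j w).
Proof.
have dh : dK (hK w) = \sum_c wedgel (kform c) (contract (sg c) w) +
    \sum_b \sum_c yvar b *: wedgel (kform c) (contract (sg b) (dy c w)).
  rewrite exchange_big -big_split; apply: eq_bigr => c _ /=.
  rewrite /hK (raddf_sum (dy c)) (raddf_sum (wedgel (kform c))).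
  rewrite [LHS](bigD1 c isT) /= (dyZ c (yvar c) (contract _ _))
    mderiv_yvar eqxx mulr1n.
  rewrite scale1r linearD /=.
  rewrite [in RHS](bigD1 c) //= -addrA; congr (_ + _).
  rewrite dy_contract // linearZ /=; congr (_ + _); apply: eq_bigr => b bc.
  by rewrite dyZ mderiv_yvar (negbTE bc) mulr0n scale0r add0r dy_contract // linearZ.
have hd : hK (dK w) = \sum_b \sum_c (yvar b * (\sum_s sg b s * kform c s)) *: dy c w -
    \sum_b \sum_c yvar b *: wedgel (kform c) (contract (sg b) (dy c w)).
  rewrite -sumrB; apply: eq_bigr => b _; rewrite -sumrB /dK raddf_sum scaler_sumr.
  by apply: eq_bigr => c _; rewrite /= contract_wedgel scalerBr scalerA.
rewrite dh hd addrACA subrr addr0 -addrA; congr (_ + _).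
  rewrite /nK big_filter [RHS]big_mkcond; apply: eq_bigr => b _.
  by case: eqP => // ->; rewrite contract0 ?raddf0.
have E b c : (yvar b * (\sum_s sg b s * kform c s)) *: dy c w =
    (b == c)%:R *: (u *: (yvar b *: dy c w)) -
    (j == c)%:R *: (xvar j ^+ T *: ((xvar b * yvar b) *: dy c w)).
  rewrite sgE !scalerA -scalerBl; congr (_ *: _); rewrite /u exprSr; ring.
under eq_bigr do under eq_bigr do rewrite E.
under eq_bigr do rewrite sumrB.
rewrite sumrB; congr (_ - _).
  rewrite scaler_sumr; apply: eq_bigr => b _; rewrite (bigD1 b) //= eqxx scale1r.
  by rewrite big1 ?addr0 // => c cb; rewrite eq_sym (negbTE cb) scale0r.
rewrite /xyform scaler_suml scaler_sumr; apply: eq_bigr => b _.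
rewrite (bigD1 j) //= eqxx scale1r.
by rewrite big1 ?addr0 // => c cj; rewrite eq_sym (negbTE cj) scale0r.
Qed.

End LocalHomotopy.
End KoszulForms.

(** * The ideals of the first variables *)

Section Ideals.
Variables (F : numFieldType) (n m : nat) (kap : 'I_m -> 'I_n -> 'I_n -> F).
Local Notation P := {mpoly F[n + n]}.
Local Notation ext := {ffun {set 'I_m} -> P^o}.
Local Notation X := (xvar F).
Local Notation Y := (yvar F).
Local Notation xy := (xyform F n).
Local Notation kf := (kform kap).
Local Notation d := (@dK F n m kap).
Implicit Types (w v h r : ext) (p q : P) (l t i : nat) (k : 'X_{1..n + n}).

(* The monomials that none of the first l variables x_a divides; cut l sets these
   variables to 0. *)
Definition low l k := [forall a : 'I_n, (a < l)%N ==> (k (lshift n a) == 0%N)].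

Lemma lowP l k :
  reflect (forall a : 'I_n, (a < l)%N -> k (lshift n a) = 0%N) (low l k).
Proof.
by apply: (iffP forallP) => H a; [move=> al; move/(_ a): H; rewrite al => /eqP
  | apply/implyP => al; rewrite H].
Qed.

Lemma lowD l k1 k2 : low l (k1 + k2)%MM = low l k1 && low l k2.
Proof.
apply/lowP/andP => [H|[/lowP H1 /lowP H2] a al]; last by rewrite mnmDE H1 ?H2.
by split; apply/lowP => a al; have := H a al; rewrite mnmDE => /eqP;
  rewrite addn_eq0 => /andP[/eqP ? /eqP ?].
Qed.

Definition cut l : P -> P := mproj (low l).
HB.instance Definition _ l := GRing.Linear.on (cut l).

Lemma cutM l p q : cut l (p * q) = cut l p * cut l q.
Proof.
apply/mpolyP => k; rewrite mproj_coeff !mcoeffM; case: ifP => lk.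
  apply: eq_bigr => -[k1 k2] /= /eqP E; rewrite !mproj_coeff.
  by move: lk; rewrite (congr1 (low l) E) lowD => /andP[-> ->].
apply/esym/big1 => -[k1 k2] /= /eqP E; rewrite !mproj_coeff.
by move: lk; rewrite (congr1 (low l) E) lowD; do 2 case: low => //=;
  rewrite ?mulr0 ?mul0r.
Qed.

Lemma cutK l p : cut l (cut l p) = cut l p.
Proof. by apply: mproj_id => k; rewrite mproj_coeff; case: ifP; rewrite ?eqxx. Qed.

Lemma cut_xvar l (j : 'I_n) : cut l (X j) = if (j < l)%N then 0 else X j.
Proof.
apply/mpolyP => k; rewrite mproj_coeff [in LHS]mcoeffX.
case: (ltnP j l) => jl; rewrite ?mcoeff0 ?mcoeffX; case: eqP => [<-|_];
  rewrite ?if_same //; case: lowP => //.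
  by move=> /(_ j jl); rewrite mnm1E eqxx.
case=> a al; rewrite mnm1E eq_lshift; apply/eqP; rewrite eqb0.
by apply: contraTneq al => <-; rewrite -leqNgt.
Qed.

(* w has coefficients in the ideal generated by x_0, ..., x_(l - 1). *)
Definition inI l w := ext_map (cut l) w = 0.

Lemma inI0 l : inI l 0. Proof. exact: raddf0. Qed.

Lemma inID l v w : inI l v -> inI l w -> inI l (v + w).
Proof. by rewrite /inI raddfD /= => -> ->; rewrite addr0. Qed.

Lemma inIN l w : inI l w -> inI l (- w).
Proof. by rewrite /inI raddfN /= => ->; rewrite oppr0. Qed.

Lemma inIB l v w : inI l v -> inI l w -> inI l (v - w).
Proof. by move=> vI wI; apply: inID => //; apply: inIN. Qed.

Lemma inI_sum (I : Type) (s : seq I) (Q : pred I) l (f : I -> ext) :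
  (forall a, Q a -> inI l (f a)) -> inI l (\sum_(a <- s | Q a) f a).
Proof. by move=> fI; apply: big_ind => //; [apply: inI0 | apply: inID]. Qed.

Lemma ext_map_cutZ l p w : ext_map (cut l) (p *: w) = cut l p *: ext_map (cut l) w.
Proof. by apply: ext_mapZ => q; apply: cutM. Qed.

Lemma inIZ l p w : inI l w -> inI l (p *: w).
Proof. by rewrite /inI ext_map_cutZ => ->; rewrite scaler0. Qed.

Lemma inI_wedgel l a w : inI l w -> inI l (wedgel a w).
Proof.
move=> wI; rewrite /inI (ext_map_wedgel (g := cut l) (b := cut l \o a)).
  by rewrite wI raddf0.
by move=> s p; apply: cutM.
Qed.

Lemma inI_contract l a w : inI l w -> inI l (contract a w).
Proof.
move=> wI; rewrite /inI (ext_map_contract (g := cut l) (b := cut l \o a)).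
  by rewrite wI raddf0.
by move=> s p; apply: cutM.
Qed.

Lemma inI_dy l c w : inI l w -> inI l (dy c w).
Proof.
rewrite /inI => wI; suff -> : ext_map (cut l) (dy c w) = dy c (ext_map (cut l) w).
  by rewrite wI raddf0.
apply/ffunP => J; rewrite !ext_mapE; apply: mproj_deriv => k.
rewrite lowD [X in _ && X](_ : _ = true) ?andbT //.
by apply/lowP => a _; rewrite mnm1E eq_rlshift.
Qed.

Lemma inI_dK l w : inI l w -> inI l (d w).
Proof. by move=> wI; apply: inI_sum => b _; apply/inI_wedgel/inI_dy. Qed.

Lemma inI_hK l sg w : inI l w -> inI l (hK sg w).
Proof. by move=> wI; apply: inI_sum => b _; apply/inIZ/inI_contract. Qed.

Lemma inI_mulX l (j : 'I_n) w : (j < l)%N -> inI l (X j *: w).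
Proof. by move=> jl; rewrite /inI ext_map_cutZ cut_xvar jl scale0r. Qed.

(** Setting variables to 0 leaves a domain, so any [p] outside the ideal is a nonzerodivisor modulo
    it. *)
Lemma inI_regular l p w : cut l p != 0 -> inI l (p *: w) -> inI l w.
Proof. by rewrite /inI ext_map_cutZ; apply: ext_scale_eq0. Qed.

Lemma inI_divX l (j : 'I_n) w : (l <= j)%N -> inI l (X j *: w) -> inI l w.
Proof.
move=> lj; apply: inI_regular; rewrite cut_xvar ltnNge lj; exact: xvar_neq0.
Qed.

(** [xyform] is nonzero modulo the ideal, since its derivative by [y_l] is [x_l], a variable not yet
    set to 0. *)
Lemma inI_divxy l w : (l < n)%N -> inI l (xy *: w) -> inI l w.
Proof.
move=> ln; apply: inI_regular; pose j := Ordinal ln.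
apply/eqP => /(congr1 (fun p => (mderiv (rshift n j) p))).
rewrite -(mproj_deriv (Q := low l)) => [|k]; last first.
  rewrite lowD [X in _ && X](_ : _ = true) ?andbT //.
  by apply/lowP => a _; rewrite mnm1E eq_rlshift.
rewrite mderiv_xy -/(cut l _) cut_xvar ltnn raddf0 => /eqP.
by rewrite (negbTE (xvar_neq0 _ _)).
Qed.

Lemma inI_leq l l' w : (l <= l')%N -> inI l w -> inI l' w.
Proof.
move=> ll wI; apply/ffunP => J; have := congr1 (fun f : ext => f J : P) wI.
rewrite !ext_mapE !ffunE => E; apply/mpolyP => k; rewrite mproj_coeff mcoeff0.
case: lowP => // H; have := congr1 (mcoeff k) E.
rewrite mproj_coeff mcoeff0; case: lowP => // -[a al].
by apply: H; apply: leq_trans ll.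
Qed.

Lemma inI_split l (j : 'I_n) w : j = l :> nat -> inI l.+1 w ->
  exists w', inI l (w - X j *: w').
Proof.
move=> jl wI.
have H (J : {set 'I_m}) : exists q : P, cut l (w J) = X j * q.
  apply: mproj_divX; apply/mpolyP => k; rewrite !mproj_coeff mcoeff0.
  case: eqP => // kj; case: lowP => // H.
  have := congr1 (fun f : ext => (f J : P)@_k) wI.
  rewrite ext_mapE ffunE mproj_coeff mcoeff0; case: lowP => // -[a].
  rewrite ltnS leq_eqVlt -jl => /orP[/eqP/val_inj -> //|].
  by rewrite jl; apply: H.
have [f fE] := fin_all_exists H.
exists [ffun J => f J : P^o]; apply/ffunP => J.
have := congr1 (cut l) (fE J); rewrite cutK cutM cut_xvar jl ltnn => E.
rewrite ext_mapE !ffunE; transitivity (cut l (w J) - cut l (X j * f J)).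
  exact: raddfB.
by rewrite cutM cut_xvar jl ltnn E addrN.
Qed.

End Ideals.

(** * Local exactness *)

Section LocalExactness.
Variables (F : numFieldType) (n m : nat) (kap : 'I_m -> 'I_n -> 'I_n -> F).
Hypothesis kap_skew : forall s a b, kap s a b = - kap s b a.
Local Notation P := {mpoly F[n + n]}.
Local Notation ext := {ffun {set 'I_m} -> P^o}.
Local Notation X := (xvar F).
Local Notation Y := (yvar F).
Local Notation xy := (xyform F n).
Local Notation kf := (kform kap).
Local Notation d := (@dK F n m kap).
Implicit Types (w v h r : ext) (p q : P) (l t i : nat).

Definition xonly p := forall c : 'I_n, p^`M(rshift n c) = 0.

Lemma xonlyM p q : xonly p -> xonly q -> xonly (p * q).
Proof. by move=> p0 q0 c; rewrite mderivM p0 q0 mul0r mulr0 addr0. Qed.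

Lemma xonlyC a : xonly a%:MP.
Proof. by move=> c; rewrite mderivC. Qed.

Lemma xonlyX (j : 'I_n) : xonly (X j).
Proof. by move=> c; rewrite mderiv_xvar. Qed.

Lemma xonlyXn p e : xonly p -> xonly (p ^+ e).
Proof.
move=> p0; elim: e => [|e IH]; first by rewrite expr0 -mpolyC1; apply: xonlyC.
by rewrite exprS; apply: xonlyM.
Qed.

Lemma xonly_nat e : xonly e%:R.
Proof. by rewrite -mpolyC_nat; apply: xonlyC. Qed.

Lemma dKD v w : d (v + w) = d v + d w. Proof. exact: raddfD. Qed.

Lemma dKB v w : d (v - w) = d v - d w. Proof. exact: raddfB. Qed.

(* The boundaries modulo the ideal generated by \sum_b x_b y_b and by
   x_0, ..., x_(l - 1). *)
Definition imK l w := exists h (p : ext) r, w = d h + xy *: p + r /\ inI l r.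

Lemma imK_d l h : imK l (d h).
Proof. by exists h, 0, 0; rewrite scaler0 !addr0; split=> //; apply: inI0. Qed.

Lemma imK_xy l (p : ext) : imK l (xy *: p).
Proof.
by exists 0, p, 0; rewrite raddf0 add0r addr0; split=> //; apply: inI0.
Qed.

Lemma imK_I l r : inI l r -> imK l r.
Proof. by move=> rI; exists 0, 0, r; rewrite raddf0 scaler0 !add0r. Qed.

Lemma imKD l v w : imK l v -> imK l w -> imK l (v + w).
Proof.
move=> [h [p [r [-> rI]]]] [h' [p' [r' [-> rI']]]].
exists (h + h'), (p + p'), (r + r'); split; last exact: inID.
by rewrite raddfD scalerDr /= addrACA [X in X + _ = _]addrACA.
Qed.

Lemma imKZ l q w : xonly q -> imK l w -> imK l (q *: w).
Proof.
move=> q0 [h [p [r [-> rI]]]]; exists (q *: h), (q *: p), (q *: r).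
split; last exact: inIZ.
by rewrite !scalerDr (dKZ _ _ q0) !scalerA (mulrC q xy).
Qed.

Lemma imKN l w : imK l w -> imK l (- w).
Proof.
move=> wI; rewrite -scaleN1r -mpolyC1 -mpolyCN.
by apply: imKZ wI; apply: xonlyC.
Qed.

Lemma imKB l v w : imK l v -> imK l w -> imK l (v - w).
Proof. by move=> vI wI; apply: imKD => //; apply: imKN. Qed.

Section Local.
Variables (j : 'I_n) (T : nat) (sg : 'I_n -> 'I_m -> P).
Hypothesis sg_deriv : forall b s, xonly (sg b s).
Hypothesis sg_j : forall s, sg j s = 0.
Hypothesis sgE : forall b c, \sum_s sg b s * kf c s =
  X j ^+ T * (X j * (b == c)%:R - X b * (j == c)%:R).
Local Notation hom := (hK sg).
Local Notation u := (X j ^+ T.+1).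

Let u_xonly : xonly u. Proof. exact/xonlyXn/xonlyX. Qed.

Let homD v w : hom (v + w) = hom v + hom w. Proof. exact: raddfD. Qed.

Definition lapl w : ext := d (hom w) + hom (d w).

Lemma lapl_is_additive : additive lapl.
Proof.
move=> v w; rewrite /lapl (raddfB hom) (raddfB d) (raddfB d) (raddfB hom).
by rewrite addrACA -opprD.
Qed.
HB.instance Definition _ := GRing.isAdditive.Build ext ext lapl lapl_is_additive.

Definition eulerY i w := \sum_b Y b *: dy b w = i%:R *: w.

Lemma eulerYD i v w : eulerY i v -> eulerY i w -> eulerY i (v + w).
Proof.
rewrite /eulerY scalerDr => <- <-; rewrite -big_split.
by apply: eq_bigr => b _; rewrite raddfD scalerDr.
Qed.

Lemma eulerYZ i q w : xonly q -> eulerY i w -> eulerY i (q *: w).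
Proof.
rewrite /eulerY => q0 E; rewrite scalerA (mulrC _ q) -scalerA -E scaler_sumr.
by apply: eq_bigr => b _; rewrite (dyZ0 _ (q0 b)) !scalerA mulrC.
Qed.

Lemma eulerY_nK i B w : eulerY i w -> eulerY i (nK kap sg B w).
Proof.
move=> wi; rewrite /nK; apply: (big_ind (eulerY i)) => [||b _].
- by rewrite /eulerY scaler0 big1 // => b _; rewrite raddf0 scaler0.
- exact: eulerYD.
transitivity (wedgel (kf b) (contract (sg b) (\sum_c Y c *: dy c w))); last first.
  by rewrite wi !linearZ.
rewrite !linear_sum; apply: eq_bigr => c _; rewrite !linearZ /=; congr (_ *: _).
rewrite dy_wedgel => [|s]; last exact: mderiv_kform.
by rewrite dy_contract // => s; apply: sg_deriv.
Qed.

(* By homotopy and eulerY, on elements of y-degree i the operator lapl - (i + c) u is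
   congruent to nK - c u modulo xyform, so that shifts_nK makes the product of the
   former over c vanish modulo xyform.  Since all the i + c are nonzero for i > 0,
   this inverts lapl, which is null homotopic, up to a power of u. *)
Lemma lapl_shifts i cs w : eulerY i w -> exists p : ext,
  shifts j T lapl [seq (i + c)%N | c <- cs] w =
  shifts j T (nK kap sg (others j)) cs w + xy *: p.
Proof.
have lapl_xy v : lapl (xy *: v) = xy *: lapl v.
  by rewrite /lapl hKZ !(dK_xy kap_skew) hKZ scalerDr.
elim: cs w => [|c cs IH] w wi; first by exists 0; rewrite scaler0 addr0.
set v := nK kap sg (others j) w - (u *+ c) *: w.
have vi : eulerY i v.
  apply: eulerYD; first exact: eulerY_nK.
  rewrite -scaleNr; apply: eulerYZ => //.
  by move=> b; rewrite mderivN -mulr_natr xonlyM ?oppr0 //; apply: xonly_nat.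
have [p pE] := IH v vi.
exists (p + shifts j T lapl [seq (i + c)%N | c <- cs] (- X j ^+ T *: dy j w)).
rewrite [map _ _]/= !shifts_cons -/v scalerDr addrA -pE.
rewrite -shiftsZ => [|z]; last exact: lapl_xy.
rewrite -(raddfD (shifts j T lapl _)); congr (shifts _ _ _ _ _).
have -> : (u *+ (i + c)) *: w = u *: (i%:R *: w) + (u *+ c) *: w.
  by rewrite mulrnDr scalerDl scalerA mulr_natr.
have -> : xy *: (- X j ^+ T *: dy j w) = - (X j ^+ T *: (xy *: dy j w)).
  by rewrite scaleNr scalerN !scalerA mulrC.
rewrite {1}/lapl (homotopy sg_deriv sg_j sgE) wi /v opprD addrA.
rewrite (addrAC _ (u *: _)) addrK; exact: addrAC.
Qed.

(** On a cycle, [lapl] is a boundary modulo the ideal and [xyform], so [lapl - c u] acts as [- c u]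
    there; it also preserves cycles. Peeling off the factors leaves a power of [u], each positive
    [c] being invertible in [F]. *)
Lemma shifts_imK l cs w : all (ltn 0) cs ->
    (exists (p : ext) r, d w = xy *: p + r /\ inI l r) ->
  imK l (shifts j T lapl cs w) -> imK l (u ^+ size cs *: w).
Proof.
elim: cs w => [|c cs IH] w; first by rewrite expr0 scale1r.
case/andP=> c0 cs0 [p [r [dw rI]]]; rewrite shifts_cons => /IH-/(_ cs0).
set v := _ - _ => H.
have dlapl : d (lapl w) = xy *: d (hom p) + d (hom r).
  rewrite /lapl dKD dK_dK add0r dw homD hKZ.
  by rewrite dKD (dK_xy kap_skew).
have cu0 : xonly (u *+ c) by rewrite -mulr_natr; apply: xonlyM => //; apply: xonly_nat.
have {H} : imK l (u ^+ size cs *: v).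
  apply: H; exists (d (hom p) - (u *+ c) *: p), (d (hom r) - (u *+ c) *: r).
  split; last by apply: inIB; [apply/inI_dK/inI_hK | apply: inIZ].
  rewrite dKB dlapl (dKZ _ _ cu0) dw scalerBr scalerDr opprD addrACA.
  by rewrite !scalerA (mulrC xy).
have lw : imK l (u ^+ size cs *: lapl w).
  apply: imKZ; first exact: xonlyXn.
  apply: imKD; first exact: imK_d.
  rewrite dw homD hKZ; apply: imKD; first exact: imK_xy.
  exact/imK_I/inI_hK.
move=> H; have {lw H} := imKB lw H.
rewrite -scalerBr /v opprB addrC subrK scalerA -mulr_natr mulrA -exprSr.
move/(imKZ (@xonlyC (c%:R^-1))); rewrite scalerA mulrCA -mpolyC_nat -mpolyCM.
by rewrite mulVf ?mulr1 // pnatr_eq0 -lt0n.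
Qed.

Lemma local_exact i l w : (0 < i)%N -> eulerY i w ->
    (exists (p : ext) r, d w = xy *: p + r /\ inI l r) ->
  exists e, imK l (X j ^+ e *: w).
Proof.
move=> i0 wi dw; have [p pE] := lapl_shifts (iota 0 (size (others j)).+1) wi.
rewrite (shifts_nK sgE) ?add0r in pE; last first.
- by rewrite mem_filter eqxx.
- by rewrite filter_uniq ?index_enum_uniq.
exists (T.+1 * (size (others j)).+1)%N; rewrite exprM.
rewrite -[X in _ ^+ X](size_iota 0) -(size_map (addn i)).
apply: shifts_imK => //; last by rewrite pE; apply: imK_xy.
by apply/allP => c /mapP[e _ ->]; apply: ltn_addr.
Qed.

End Local.
End LocalExactness.

(** * The splice map *)

Section WedgeList.
Variables (F : numFieldType) (n m : nat) (kap : 'I_m -> 'I_n -> 'I_n -> F).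
Hypothesis kap_skew : forall s a b, kap s a b = - kap s b a.
Local Notation P := {mpoly F[n + n]}.
Local Notation ext := {ffun {set 'I_m} -> P^o}.
Local Notation X := (xvar F).
Local Notation Y := (yvar F).
Local Notation kf := (kform kap).
Local Notation d := (@dK F n m kap).
Implicit Types (w v h r : ext) (p q : P) (l t i : nat) (b c : 'I_n) (B : seq 'I_n).

Definition wl B w : ext := foldr (fun b => wedgel (kf b)) w B.

Arguments wl : simpl never.

Lemma wl_cons b B w : wl (b :: B) w = wedgel (kf b) (wl B w).
Proof. by []. Qed.

Lemma wl_is_linear B : linear (wl B).
Proof.
by elim: B => [|b B IH] a v w //; rewrite !wl_cons IH linearP.
Qed.
HB.instance Definition _ B :=
  GRing.isLinear.Build P ext ext _ (wl B) (wl_is_linear B).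

Lemma wl_wedgel b B w :
  wl B (wedgel (kf b) w) = (-1) ^+ size B *: wedgel (kf b) (wl B w).
Proof.
elim: B => [|c B IH]; first by rewrite scale1r.
rewrite !wl_cons IH linearZ /= wedgel_anti exprS -scalerA scaleN1r.
by rewrite scalerN.
Qed.

Lemma wedgel_wl0 b B w : b \in B -> wedgel (kf b) (wl B w) = 0.
Proof.
elim: B => [|c B IH] //; rewrite inE wl_cons; case: eqP => [->|_] /=.
  by rewrite wedgel_wedgel.
by move=> bB; rewrite wedgel_anti IH // raddf0 oppr0.
Qed.

Lemma wl_rem b B : b \in B -> exists e : nat, forall w,
  wl B w = (-1) ^+ e *: wedgel (kf b) (wl (rem b B) w).
Proof.
elim: B => [|c B IH] //; rewrite inE (eq_sym b) /=.
case: (c =P b) => [-> _|_ /= /IH[e E]].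
  by exists 0%N => w; rewrite scale1r.
exists e.+1 => w; rewrite !wl_cons E linearZ /= wedgel_anti exprS -scalerA scaleN1r.
by rewrite scalerN.
Qed.

(** Wedge the relation [\sum_b x_b k_b = 0] with the product of all [k_b] for [b] other than [i] and
    [j]: only the terms of [i] and [j] survive. *)
Lemma xvar_wl_others (i j : 'I_n) : i != j -> exists e : nat, forall w,
  X i *: wl (others j) w = (-1) ^+ e *: (X j *: wl (others i) w).
Proof.
move=> ij.
have iO : i \in others j by rewrite mem_filter ij mem_index_enum.
have jO : j \in others i by rewrite mem_filter eq_sym ij mem_index_enum.
have [e eE] := wl_rem iO; have [f fE] := wl_rem jO.
have remE : rem j (others i) = rem i (others j).
  rewrite !rem_filter ?filter_uniq ?index_enum_uniq // -!filter_predI.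
  by apply: eq_filter => b /=; rewrite andbC.
set R := rem i (others j) in eE remE.
have H w : X i *: wedgel (kf i) (wl R w) = - (X j *: wedgel (kf j) (wl R w)).
  apply/eqP; rewrite -addr_eq0; apply/eqP.
  have : \sum_b X b *: wedgel (kf b) (wl R w) = 0.
    rewrite -wedgel_sum (eq_wedgel (b := fun=> 0)) => [|s].
      by rewrite wedgelE big1 // => s _; rewrite scale0r.
    exact: sum_xvar_kform.
  have Z : \sum_(b | (b != i) && (b != j)) X b *: wedgel (kf b) (wl R w) = 0.
    apply: big1 => b /andP[bi bj]; rewrite wedgel_wl0 ?scaler0 //.
    by rewrite /R rem_filter ?filter_uniq ?index_enum_uniq // !mem_filter /= bi bj
      mem_index_enum.
  rewrite (bigD1 i isT) (bigD1 j) /=; last by rewrite eq_sym.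
  by rewrite Z addrA addr0.
exists (e + f).+1 => w; rewrite eE fE remE scalerA mulrC -scalerA H.
rewrite scalerN -scaleN1r !scalerA; congr (_ *: _).
have s2 : (-1) ^+ f * (-1) ^+ f = 1 :> P 
  by rewrite -expr2 sqrr_sign.
rewrite -[LHS]mulr1 -[X in _ * X = _]s2 exprS exprD.
move: ((-1) ^+ e) ((-1) ^+ f) => a b; ring.
Qed.

End WedgeList.

(** * Bidegrees *)

Section Bidegree.
Variables (F : numFieldType) (n m : nat) (kap : 'I_m -> 'I_n -> 'I_n -> F).
Local Notation P := {mpoly F[n + n]}.
Local Notation ext := {ffun {set 'I_m} -> P^o}.
Local Notation X := (xvar F).
Local Notation Y := (yvar F).
Local Notation xy := (xyform F n).
Local Notation kf := (kform kap).
Local Notation d := (@dK F n m kap).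
Implicit Types (w v h r : ext) (p q : P) (l t i : nat) (b c : 'I_n)
  (k : 'X_{1..n + n}).

Definition xdeg k := (\sum_b k (lshift n b))%N.
Definition ydeg k := (\sum_b k (rshift n b))%N.
Definition isdeg t i k := (xdeg k == t) && (ydeg k == i).

Lemma xdegD k1 k2 : xdeg (k1 + k2)%MM = (xdeg k1 + xdeg k2)%N.
Proof. by rewrite /xdeg -big_split; apply: eq_bigr => b _; rewrite mnmDE. Qed.

Lemma ydegD k1 k2 : ydeg (k1 + k2)%MM = (ydeg k1 + ydeg k2)%N.
Proof. by rewrite /ydeg -big_split; apply: eq_bigr => b _; rewrite mnmDE. Qed.

Lemma isdegX b : isdeg 1 0 U_(lshift n b)%MM.
Proof.
apply/andP; split; apply/eqP.
  rewrite /xdeg (bigD1 b) //= mnm1E eqxx big1 // => c cb.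
  by rewrite mnm1E eq_lshift eq_sym (negbTE cb).
by rewrite /ydeg big1 // => c _; rewrite mnm1E eq_lrshift.
Qed.

Lemma isdegY b : isdeg 0 1 U_(rshift n b)%MM.
Proof.
apply/andP; split; apply/eqP.
  by rewrite /xdeg big1 // => c _; rewrite mnm1E eq_rlshift.
rewrite /ydeg (bigD1 b) //= mnm1E eqxx big1 // => c cb.
by rewrite mnm1E eq_rshift eq_sym (negbTE cb).
Qed.

Definition bihom t i p := mproj (isdeg t i) p = p.

Lemma bihomP t i p k : bihom t i p -> p@_k != 0 -> isdeg t i k.
Proof. by move=> <-; rewrite mproj_coeff; case: ifP; rewrite ?eqxx. Qed.

Lemma mproj_bihom t i t' i' p q : bihom t i p ->
  mproj (isdeg (t + t') (i + i')) (p * q) = p * mproj (isdeg t' i') q.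
Proof.
move=> pH; apply: mprojM => k1 k2 /(bihomP pH)/andP[/eqP E1 /eqP E2].
by rewrite /isdeg xdegD ydegD E1 E2 !eqn_add2l.
Qed.

Lemma bihomM t i t' i' p q : bihom t i p -> bihom t' i' q ->
  bihom (t + t') (i + i') (p * q).
Proof. by move=> pH qH; rewrite /bihom mproj_bihom // qH. Qed.

Lemma bihomU t i k : isdeg t i k -> bihom t i 'X_[k].
Proof.
move=> kt; apply: mproj_id => k'; rewrite mcoeffX; case: (_ =P k') => [<- //|_].
by rewrite eqxx.
Qed.

Lemma bihomX b : bihom 1 0 (X b). Proof. exact/bihomU/isdegX. Qed.

Lemma bihomY b : bihom 0 1 (Y b). Proof. exact/bihomU/isdegY. Qed.

Lemma bihom_kform b s : bihom 1 0 (kf b s).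
Proof.
rewrite /bihom /kform raddf_sum; apply: eq_bigr => a _.
by rewrite /= linearZ /= bihomX.
Qed.

Lemma bihom_xy : bihom 1 1 xy.
Proof.
rewrite /bihom /xyform raddf_sum; apply: eq_bigr => b _.
exact: (bihomM (bihomX b) (bihomY b)).
Qed.

Definition eproj t i : ext -> ext := ext_map (mproj (isdeg t i)).
HB.instance Definition _ t i := GRing.Additive.on (eproj t i).

Definition ehom t i w := eproj t i w = w.

Lemma eproj_bihom t i t' i' p w : bihom t i p ->
  eproj (t + t') (i + i') (p *: w) = p *: eproj t' i' w.
Proof.
by move=> pH; apply/ffunP => J; rewrite !(ext_mapE, ffunE); apply: mproj_bihom.
Qed.

Lemma eproj_xvar t i b w : eproj t.+1 i (X b *: w) = X b *: eproj t i w.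
Proof. exact: (eproj_bihom t i w (bihomX b)). Qed.

Lemma eproj_xy t i w : eproj t.+1 i.+1 (xy *: w) = xy *: eproj t i w.
Proof. exact: (eproj_bihom t i w bihom_xy). Qed.

Lemma eproj_xy0 t w : eproj t 0 (xy *: w) = 0.
Proof.
apply/ffunP => J; rewrite ext_mapE !ffunE; apply/mpolyP => k.
rewrite mproj_coeff mcoeff0; case: ifP => // /andP[_ /eqP k0].
rewrite mcoeffM big1 // => -[k1 k2] /= /eqP kE.
have [->|/(bihomP bihom_xy)/andP[_ /eqP E]] := eqVneq (xy@_k1) 0.
  by rewrite mul0r.
by move: k0; rewrite (congr1 ydeg kE) ydegD E.
Qed.

Lemma eproj_wedgel_kform t i b w :
  eproj t.+1 i (wedgel (kf b) w) = wedgel (kf b) (eproj t i w).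
Proof.
apply: ext_map_wedgel => s p.
exact: (mproj_bihom t i p (bihom_kform b s)).
Qed.

Lemma eproj_dy t i b w : eproj t i (dy b w) = dy b (eproj t i.+1 w).
Proof.
apply/ffunP => J; rewrite !ext_mapE; apply: mproj_deriv => k.
rewrite /isdeg xdegD ydegD; have /andP[/eqP-> /eqP->] := isdegY b.
by rewrite addn0 addn1 eqSS.
Qed.

Lemma eproj_dK t i w : eproj t.+1 i (d w) = d (eproj t i.+1 w).
Proof.
rewrite /dK raddf_sum; apply: eq_bigr => b _.
by rewrite [LHS]eproj_wedgel_kform eproj_dy.
Qed.

Lemma eproj_wl t i B w : eproj (size B + t) i (wl kap B w) = wl kap B (eproj t i w).
Proof. by elim: B => [|b B IH] //; rewrite !wl_cons [LHS]eproj_wedgel_kform IH. Qed.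

Lemma eproj_inI l t i w : inI l w -> inI l (eproj t i w).
Proof.
rewrite /inI => wI; apply/ffunP => J; have := congr1 (fun f : ext => f J : P) wI.
rewrite !ext_mapE !ffunE => E; apply/mpolyP => k; rewrite !mproj_coeff mcoeff0.
by have := congr1 (mcoeff k) E; rewrite mproj_coeff mcoeff0 => E';
  case: ifP => // lk; case: ifP => // _; rewrite lk in E'.
Qed.

Lemma eproj_id t i w : ehom t i (eproj t i w).
Proof.
apply/ffunP => J; rewrite !ext_mapE; apply: mproj_id => k.
by rewrite mproj_coeff; case: ifP; rewrite ?eqxx.
Qed.

(** Every monomial of positive x-degree contains some [x_b]. This is what ends the induction over
    the number of variables set to 0. *)
Lemma ehom_inI t i w : (0 < t)%N -> ehom t i w -> inI n w.
Proof.
move=> t0 wH; apply/ffunP => J; rewrite -wH !(ext_mapE, ffunE).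
apply/mpolyP => k; rewrite !mproj_coeff mcoeff0.
case: lowP => // k0; case: ifP => // /andP[/eqP kt _].
by move: t0; rewrite -kt /xdeg big1 // => b _; apply: k0.
Qed.

Lemma euler_bihom t i p : bihom t i p ->
  \sum_b Y b * p^`M(rshift n b) = i%:R * p.
Proof.
move=> pH; rewrite [in RHS](mpolyE p) mulr_sumr.
transitivity (\sum_b \sum_(k <- msupp p) Y b * (p@_k *: 'X_[k])^`M(rshift n b)).
  by apply: eq_bigr => b _; rewrite {1}(mpolyE p) raddf_sum mulr_sumr.
rewrite exchange_big; apply: eq_big_seq => k kp.
have /andP[_ /eqP ki] : isdeg t i k by apply: bihomP pH _; rewrite -mcoeff_msupp.
rewrite -ki /ydeg natr_sum mulr_suml; apply: eq_bigr => b _ /=.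
rewrite mderivZ mderivX -!scalerAr; congr (_ *: _).
have [->|k0] := eqVneq (k (rshift n b)) 0%N; first by rewrite scale0r mul0r.
by rewrite -mpolyXD addmC submK ?lep1mP // -mul_mpolyC mpolyC_nat.
Qed.

Lemma eulerY_ehom t i w : ehom t i w -> eulerY i w.
Proof.
move=> wH; rewrite /eulerY; apply/ffunP => J; rewrite sum_ffunE !ffunE.
have {}wH : bihom t i (w J).
  by have := congr1 (fun f : ext => f J : P) wH; rewrite ext_mapE.
rewrite -[RHS](euler_bihom wH).
by apply: eq_bigr => b _; rewrite ffunE ext_mapE.
Qed.

Lemma dy_ehom0 t w : ehom t 0 w -> forall b, dy b w = 0.
Proof.
move=> wH b; apply/ffunP => J; rewrite -wH !ext_mapE ffunE; apply/mpolyP => k.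
rewrite mcoeff_deriv mproj_coeff mcoeff0.
by rewrite /isdeg ydegD; have /andP[_ /eqP->] := isdegY b; rewrite addn1 andbF mul0rn.
Qed.

End Bidegree.

(** * Construction of the splice map *)

Section Splice.
Variables (F : numFieldType) (n m : nat) (kap : 'I_m -> 'I_n -> 'I_n -> F).
Hypothesis kap_skew : forall s a b, kap s a b = - kap s b a.
Local Notation P := {mpoly F[n + n]}.
Local Notation ext := {ffun {set 'I_m} -> P^o}.
Local Notation X := (xvar F).
Local Notation Y := (yvar F).
Local Notation xy := (xyform F n).
Local Notation kf := (kform kap).
Local Notation d := (@dK F n m kap).
Implicit Types (w v h r : ext) (p q : P) (l t i : nat) (b : 'I_n)
  (k : 'X_{1..n + n}) (J : {set 'I_m}) (B : seq 'I_n).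

Lemma xvar_dvd (i j : 'I_n) p q : i != j -> X i * p = X j * q ->
  exists r : P, p = X j * r.
Proof.
move=> ij E; pose Q k := k (lshift n j) == 0%N.
apply: mproj_divX; apply/eqP; have := congr1 (mproj Q) E.
rewrite (mprojM (Q' := Q)) => [|k1 k2]; last first.
  rewrite mcoeffX; case: (_ =P k1) => [<- _|_ /eqP //].
  by rewrite /Q mnmDE mnm1E eq_lshift (negbTE ij).
rewrite [RHS](_ : _ = 0); first by move/eqP; rewrite mulf_eq0 (negbTE (xvar_neq0 _ _)).
apply/mpolyP => k; rewrite mproj_coeff mcoeff0; case: ifP => // /eqP k0.
rewrite mcoeffM big1 // => -[k1 k2] /= /eqP kE; rewrite mcoeffX.
case: (_ =P (k1 : 'X_{1..n + n})) => [E1|_]; last by rewrite mul0r.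
by have := congr1 (fun k => k (lshift n j)) kE;
  rewrite k0 /= mnmDE -E1 mnm1E eqxx.
Qed.

Lemma size_others (j : 'I_n) : size (others j) = n.-1.
Proof.
by rewrite size_filter -sum1_count sum1_card cardC1 card_ord.
Qed.

(* The product of the n - 1 elements k_b with b <> j0 is divisible by x_j0, since
   \sum_b x_b k_b = 0; c is the quotient. *)
Lemma splice_exists (i0 j0 : 'I_n) : i0 != j0 -> exists c : ext -> ext,
  [/\ linear c, forall w, wl kap (others j0) w = X j0 *: c w
    & forall t i w, eproj (n - 2 + t) i (c w) = c (eproj t i w)].
Proof.
move=> ij; pose delta J : ext := [ffun J' => (J' == J)%:R : P^o].
have deltaE w : w = \sum_J w J *: delta J.
  apply/ffunP => J'; rewrite sum_ffunE.
  have E J : (w J *: delta J) J' = (w J : P) * (J' == J)%:R by rewrite !ffunE.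
  transitivity (\sum_J (w J : P) * (J' == J)%:R); last by apply: eq_bigr => J _; rewrite E.
  rewrite (bigD1 J' isT) eqxx big1 => [|J JJ]; first by rewrite /= mulr1 addr0.
  by rewrite eq_sym (negbTE JJ) mulr0.
have [e eE] := xvar_wl_others kap_skew ij.
(* [x_i0] times this product is, up to sign, [x_j0] times another one, and the two variables are
   coprime. *)
have dvd J : exists v, wl kap (others j0) (delta J) = X j0 *: v.
  have H J' : exists q : P, wl kap (others j0) (delta J) J' = X j0 * q.
    have := congr1 (fun f : ext => f J' : P) (eE (delta J)); rewrite !ffunE.
    rewrite [RHS](_ : _ = X j0 * ((-1) ^+ e * wl kap (others i0) (delta J) J')).
      exact: xvar_dvd.
    exact: mulrCA.
  have [f fE] := fin_all_exists H.
  by exists [ffun J' => f J' : P^o]; apply/ffunP => J'; rewrite !ffunE fE.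
have [f fE] := fin_all_exists dvd.
(* The product has x-degree n - 1, and one variable is divided out. *)
have fH J : ehom (n - 2) 0 (f J).
  have E : eproj n.-1 0 (X j0 *: f J) = X j0 *: f J.
    rewrite -fE -(size_others j0) -[size _]addn0 eproj_wl; congr (wl _ _ _).
    apply/ffunP => J'; rewrite ext_mapE ffunE; apply: mproj_id => k.
    case: (J' =P J) => _; rewrite ?mulr0n ?mulr1n ?mcoeff0 ?mcoeff1 ?eqxx //.
    case: (k =P 0%MM) => [->|_]; last by rewrite eqxx.
    by rewrite /isdeg /xdeg /ydeg !big1 // => b _; rewrite mnm0E.
  have n2 : n.-1 = (n - 2).+1.
    case: (n) i0 j0 ij {eE f fE E dvd deltaE} => [|[|k]] i0 j0; rewrite ?subn2 //.
      by case: i0.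
    by rewrite (ord1 i0) (ord1 j0) eqxx.
  move: E; rewrite n2 eproj_xvar => /eqP; rewrite -subr_eq0 -scalerBr => /eqP E.
  by apply/eqP; rewrite -subr_eq0; apply/eqP; apply: ext_scale_eq0 E; apply: xvar_neq0.
exists (fun w => \sum_J (w J : P) *: f J); split=> [a v w|w|t i w].
- rewrite scaler_sumr -big_split; apply: eq_bigr => J _.
  by rewrite !ffunE scalerDl scalerA.
- rewrite {1}(deltaE w) linear_sum scaler_sumr; apply: eq_bigr => J _.
  by rewrite linearZ /= fE !scalerA mulrC.
rewrite raddf_sum; apply: eq_bigr => J _; apply/ffunP => J'.
rewrite !(ext_mapE, ffunE); rewrite [in LHS]/GRing.scale [in RHS]/GRing.scale /=.
rewrite mulrC [RHS]mulrC -[i in LHS]add0n; apply: mproj_bihom.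
by have := congr1 (fun f : ext => f J' : P) (fH J); rewrite ext_mapE.
Qed.

End Splice.

(** * Syzygies of the variables come from K *)

Section Complex.
Variables (F : numFieldType) (n m : nat) (kap : 'I_m -> 'I_n -> 'I_n -> F).
Hypothesis kap_skew : forall s a b, kap s a b = - kap s b a.
Local Notation P := {mpoly F[n + n]}.
Local Notation ext := {ffun {set 'I_m} -> P^o}.
Local Notation X := (xvar F).
Local Notation Y := (yvar F).
Local Notation xy := (xyform F n).
Local Notation kf := (kform kap).
Local Notation wl := (wl kap).
Local Notation d := (@dK F n m kap).
Implicit Types (w v h r : ext) (l t i e : nat) (b : 'I_n) (B : seq 'I_n).

(* A splitting of K (x) S -> M over x_j <> 0, where M is the kernel of
   (x_1, ..., x_n) : V (x) S -> S. *)
Definition splits (j : 'I_n) T (sg : 'I_n -> 'I_m -> P) :=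
  [/\ forall b s, xonly (sg b s), forall s, sg j s = 0 &
      forall b c, \sum_s sg b s * kf c s =
        X j ^+ T * (X j * (b == c)%:R - X b * (j == c)%:R)].

Lemma mem_others (j b : 'I_n) : (b \in others j) = (b != j).
Proof. by rewrite mem_filter mem_index_enum andbT. Qed.

Lemma scale_comm (p q : P) w : p *: (q *: w) = q *: (p *: w).
Proof. by rewrite !scalerA mulrC. Qed.

Section Splitting.
Variables (j : 'I_n) (T : nat) (sg : 'I_n -> 'I_m -> P).
Hypothesis sgP : splits j T sg.
Local Notation u := (X j ^+ T.+1).

Lemma splits_dual b c : c != j -> \sum_s sg b s * kf c s = u *+ (b == c).
Proof. by have [_ _ sgE] := sgP; apply: splitting_dual. Qed.

Lemma splits_homotopy b w : b != j ->
  u *: w = contract (sg b) (wedgel (kf b) w) + wedgel (kf b) (contract (sg b) w).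
Proof. by move=> bj; rewrite contract_wedgel splits_dual // eqxx mulr1n subrK. Qed.

Lemma contract_wl b B w : b != j -> b \notin B -> j \notin B ->
  contract (sg b) (wl B w) = (-1) ^+ size B *: wl B (contract (sg b) w).
Proof.
move=> bj; elim: B => [|c B IH]; first by rewrite scale1r.
rewrite !inE !negb_or => /andP[bc bB] /andP[jc jB]; rewrite !wl_cons.
rewrite contract_wedgel splits_dual 1?eq_sym // eq_sym (negbTE bc) mulr0n.
rewrite scale0r sub0r IH // linearZ /=.
by rewrite exprS -scalerA scaleN1r.
Qed.

Lemma signK e w : (-1) ^+ e *: ((-1) ^+ e *: w) = w.
Proof. by rewrite scalerA -expr2 sqrr_sign scale1r. Qed.

Lemma wedgel_contract_wl b B w : b != j -> b \notin B -> j \notin B ->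
  wedgel (kf b) (contract (sg b) (wl B w)) = wl B (wedgel (kf b) (contract (sg b) w)).
Proof. by move=> bj bB jB; rewrite contract_wl // linearZ /= wl_wedgel. Qed.

(** Apply [splits_homotopy] once for each [b] in [B]: the term containing [k_b /\ w] lies in the
    ideal, the other one acquires a further factor [k_b]. *)
Lemma local_wl l B w : uniq B -> j \notin B -> (forall b, inI l (wedgel (kf b) w)) ->
  exists g r, u ^+ size B *: w = wl B g + r /\ inI l r.
Proof.
move=> uB jB wI; elim: B uB jB => [_ _|b B IH].
  by exists w, 0; rewrite expr0 scale1r addr0; split=> //; apply: inI0.
rewrite cons_uniq inE negb_or => /andP[bB uB] /andP[jb jB].
have [g [r [E rI]]] := IH uB jB; have bj : b != j by rewrite eq_sym.
exists ((-1) ^+ size B *: contract (sg b) g).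
exists (u ^+ size B *: contract (sg b) (wedgel (kf b) w)
        + wedgel (kf b) (contract (sg b) r)); split; last first.
  by apply: inID; [apply/inIZ/inI_contract|apply/inI_wedgel/inI_contract].
rewrite [size _]/= exprSr -scalerA (splits_homotopy _ bj) scalerDr addrC.
rewrite -[X in X + _ = _]linearZ /= -[X in wedgel _ X + _]linearZ /= E.
rewrite [contract _ (_ + _)]linearD [wedgel _ (_ + _)]linearD /=.
rewrite contract_wl // -[X in wedgel _ X + _ + _]linearZ /= -wl_cons.
rewrite -[LHS]addrA; congr (_ + _); exact: addrC.
Qed.

Lemma dK_yvar b w : (forall c, dy c w = 0) -> d (Y b *: w) = wedgel (kf b) w.
Proof.
move=> w0; rewrite /dK (bigD1 b) //= big1 => [|c cb].
  by rewrite addr0 dyZ mderiv_yvar eqxx mulr1n scale1r w0 scaler0 addr0.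
by rewrite dyZ mderiv_yvar eq_sym (negbTE cb) mulr0n scale0r w0 scaler0 addr0 raddf0.
Qed.

(** In y-degree 0 the boundary of [y_b v] is [k_b /\ v]. With [v] the contraction of [w] by [sg b],
    subtracting this from [u *: w] leaves the contraction of [k_b /\ w], whose product with the
    remaining factors is again in the ideal. *)
Lemma local_dK l B w : uniq B -> j \notin B -> (forall c, dy c w = 0) ->
  inI l (wl B w) -> exists h r, u ^+ size B *: w = d h + r /\ inI l r.
Proof.
elim: B w => [w _ _ _ wI|b B IH w].
  by exists 0, w; rewrite expr0 scale1r raddf0 add0r.
rewrite cons_uniq inE negb_or => /andP[bB uB] /andP[jb jB] w0 wI.
have bj : b != j by rewrite eq_sym.
have [sg0 _ _] := sgP.
set v := contract (sg b) w.
have v0 c : dy c v = 0.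
  by rewrite /v dy_contract ?w0 ?raddf0 // => s; apply: sg0.
have kv0 c : dy c (wedgel (kf b) v) = 0.
  by rewrite dy_wedgel ?v0 ?raddf0 // => s; apply: mderiv_kform.
have uX : xonly u by apply/xonlyXn/xonlyX.
have [] := IH (u *: w - wedgel (kf b) v) uB jB.
- move=> c; transitivity (dy c (u *: w) - dy c (wedgel (kf b) v)); first exact: raddfB.
  by rewrite kv0 subr0 dyZ0 ?w0 ?scaler0 //; apply: uX.
- rewrite linearB linearZ /= -wedgel_contract_wl // (splits_homotopy _ bj) addrK.
  by apply: inI_contract.
move=> h [r [E rI]]; exists (h + u ^+ size B *: (Y b *: v)), r; split=> //.
rewrite dKD dKZ ?dK_yvar //; last by apply: xonlyXn.
rewrite addrAC -E [size _]/= exprSr -scalerA -scalerDr.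
by rewrite subrK.
Qed.

End Splitting.

Section Splice.
Variable c : {linear ext -> ext}.
Variables i0 j0 : 'I_n.
Hypotheses (ij : i0 != j0) (cE : forall w, wl (others j0) w = X j0 *: c w).

Lemma spliceD v w : c (v + w) = c v + c w. Proof. exact: linearD. Qed.

Lemma spliceZ p w : c (p *: w) = p *: c w. Proof. exact: linearZ. Qed.

Lemma wl_others_splice j :
  exists e, forall w, wl (others j) w = (-1) ^+ e *: (X j *: c w).
Proof.
have [<-|jj] := eqVneq j0 j; first by exists 0%N => w; rewrite scale1r -cE.
have [e eE] := xvar_wl_others kap_skew jj; exists e => w.
have H : X j0 *: (wl (others j) w - (-1) ^+ e *: (X j *: c w)) = 0.
  rewrite scalerBr eE cE (scale_comm (X j0) (_ ^+ e)) (scale_comm (X j0) (X j)).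
  exact: subrr.
by apply/eqP; rewrite -subr_eq0; apply/eqP/(ext_scale_eq0 (xvar_neq0 F j0) H).
Qed.

Lemma splice_wl j : exists e, forall w, X j *: c w = (-1) ^+ e *: wl (others j) w.
Proof. by have [e E] := wl_others_splice j; exists e => w; rewrite E signK. Qed.

Lemma exists_other b : exists j : 'I_n, b \in others j.
Proof.
have [bj|bj] := eqVneq b j0; first by exists i0; rewrite mem_others bj eq_sym.
by exists j0; rewrite mem_others.
Qed.

(** For [j != b], [x_j c w] is up to sign a product that already contains the factor [k_b]. *)
Lemma wedgel_splice b w : wedgel (kf b) (c w) = 0.
Proof.
have [j bj] := exists_other b; have [e E] := splice_wl j.
apply: (ext_scale_eq0 (xvar_neq0 F j)); rewrite -[LHS]linearZ /= E linearZ /=.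
by rewrite wedgel_wl0 // scaler0.
Qed.

Lemma splice_wedgel b w : c (wedgel (kf b) w) = 0.
Proof.
have [j bj] := exists_other b; have [e E] := splice_wl j.
apply: (ext_scale_eq0 (xvar_neq0 F j)); rewrite E wl_wedgel.
by rewrite wedgel_wl0 // !scaler0.
Qed.

Lemma splice_dK w : c (d w) = 0.
Proof. by rewrite linear_sum big1 // => b _; apply: splice_wedgel. Qed.

Lemma inI_wl l B w : inI l w -> inI l (wl B w).
Proof. by move=> wI; elim: B => [|b B IH] //; rewrite wl_cons; apply: inI_wedgel. Qed.

(** [x_l c w] is up to sign a wedge product with [w], and [x_l] is regular modulo the ideal of the
    preceding variables. *)
Lemma inI_splice l w : (l < n)%N -> inI l w -> inI l (c w).
Proof.
move=> ln wI; pose j := Ordinal ln; have [e E] := splice_wl j.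
by apply: (@inI_divX _ _ _ _ j); rewrite ?leqnn // E; apply/inIZ/inI_wl.
Qed.

Hypothesis c_proj : forall t i w, eproj (n - 2 + t) i (c w) = c (eproj t i w).
Hypothesis splits_exist : forall j, exists T sg, @splits j T sg.

(* In y-degree 0 the complex is continued by the splice map c instead of dK. *)
Definition cycle i l h :=
  if i is 0%N then inI l (c h) else exists (p : ext) r, d h = xy *: p + r /\ inI l r.

Lemma cycleZ i l q h : xonly q -> cycle i l h -> cycle i l (q *: h).
Proof.
move=> q0; case: i => [|i] /=; first by move=> hI; rewrite linearZ; apply: inIZ.
case=> p [r [E rI]]; exists (q *: p), (q *: r); split; last exact: inIZ.
by rewrite dKZ // E scalerDr !scalerA (mulrC q).
Qed.

(** In y-degree 0 the homotopy operator would have the eigenvalue 0, so the splitting of the splice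
    map in [local_dK] takes its place there. *)
Lemma local_cycle j t i l h : ehom t i h -> cycle i l h ->
  exists e, imK kap l (X j ^+ e *: h).
Proof.
move=> hH; have [T [sg sgP]] := splits_exist j; have [sg0 sgj sgE] := sgP.
case: i hH => [|i] hH hc; last first.
  exact: (local_exact kap_skew sg0 sgj sgE (ltn0Sn i) (eulerY_ehom hH) hc).
have [h' [r [E rI]]] : exists h' r, X j ^+ T.+1 ^+ size (others j) *: h = d h' + r /\ inI l r.
  apply: (local_dK sgP).
  - by rewrite filter_uniq ?index_enum_uniq.
  - by rewrite mem_others eqxx.
  - by apply: dy_ehom0 hH.
  by have [e E] := wl_others_splice j; rewrite E; apply/inIZ/inIZ.
exists (T.+1 * size (others j))%N; rewrite exprM E.
by apply: imKD; [apply: imK_d | apply: imK_I].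
Qed.

Lemma eprojD t i v w : eproj t i (v + w) = eproj t i v + eproj t i w.
Proof. exact: raddfD. Qed.

Lemma eprojB t i v w : eproj t i (v - w) = eproj t i v - eproj t i w.
Proof. exact: raddfB. Qed.

Lemma eproj_xy_inI t i (p : ext) : exists q : ext,
  eproj t.+1 i (xy *: p) = xy *: q /\ ((0 < t)%N -> inI n q).
Proof.
case: i => [|i].
  by exists 0; rewrite scaler0 eproj_xy0; split=> // _; apply: inI0.
exists (eproj t i p); split; first exact: eproj_xy.
by move=> t0; apply: (ehom_inI t0 (eproj_id t i p)).
Qed.

(* If x_j h is a boundary d h2 modulo (x_0, ..., x_(j - 1)), then h2 is a cycle modulo
   one more variable x_j, hence a boundary there, and substituting h2 makes the whole
   relation divisible by x_j. *)
Lemma cycle_divX (j : 'I_n) t i h : (0 < t)%N -> i.+2 = j :> nat -> ehom t i h ->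
    (forall h', ehom t i.+1 h' -> cycle i.+1 i.+3 h' -> imK kap i.+3 h') ->
  imK kap i.+2 (X j *: h) -> imK kap i.+2 h.
Proof.
move=> t0 ji hH exact1 [h2 [p [r [E rI]]]].
have projX : eproj t.+1 i (X j *: h) = X j *: h by rewrite eproj_xvar hH.
have [p' [p'E _]] := eproj_xy_inI t i p.
have {p'E}E2 : X j *: h = d (eproj t i.+1 h2) + xy *: p' + eproj t.+1 i r.
  by rewrite -projX E !eprojD eproj_dK p'E.
have {}rI : inI i.+2 (eproj t.+1 i r) by apply: eproj_inI.
move: (eproj t.+1 i r) rI E2 => {E} r rI E.
have {exact1} [|h3 [p3 [r3 [E3 r3I]]]] := exact1 _ (eproj_id t i.+1 h2).
  exists (- p'), (X j *: h - r); split; last first.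
    by apply: inIB; [apply: inI_mulX; rewrite -ji | apply: inI_leq rI].
  rewrite scalerN E [_ - r]addrK [_ + xy *: p']addrC addKr; reflexivity.
(* Modulo the smaller ideal [r3] is [x_j h4], so its boundary is [x_j] times a boundary. *)
have [h4] := inI_split (esym ji) r3I; set r4 := _ - _ => r4I.
have {E3} E3 : X j *: (h - d h4) = xy *: (d p3 + p') + (d r4 + r).
  rewrite scalerBr E E3 (dKD _ (d h3 + _)) (dKD _ (d h3)) dK_dK // add0r dK_xy //.
  rewrite -(dKZ _ _ (xonlyX F j)).
  rewrite -[d r3](subrK (d (X j *: h4))) -dKB -/r4 scalerDr.
  move: (xy *: d p3) (xy *: p') (d r4) (d (X j *: h4)) => a1 a2 a3 a4.
  rewrite (addrA a1) (addrAC _ a4 a2) (addrAC _ a4 r) addrK (addrAC a1 a3 a2).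
  by rewrite [RHS]addrA.
have [q [qE /(_ t0) qI]] := eproj_xy_inI t i (d p3 + p').
have {}qE : X j *: (h - d (eproj t.-1 i.+1 h4)) = xy *: q + eproj t.+1 i (d r4 + r).
  rewrite -qE -eprojD -E3 eproj_xvar eprojB hH.
  by rewrite -{2}(prednK t0) eproj_dK.
have {}rI : inI i.+2 (eproj t.+1 i (d r4 + r)).
  by apply/eproj_inI/inID => //; apply: inI_dK.
move: (eproj t.+1 i _) rI qE => {E3 r4I} r5 r5I E5.
(* [xyform] can be cancelled as long as a further variable exists; otherwise positive x-degree puts
   [q] in the ideal. *)
have {}qI : inI i.+3 q.
  have [jn|] := ltnP i.+3 n; last by move=> nj; apply: inI_leq qI.
  apply: (inI_divxy jn); rewrite -(addrK r5 (xy *: q)) -E5.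
  by apply: inIB; [apply: inI_mulX; rewrite -ji | apply: inI_leq r5I].
have [q'] := inI_split (esym ji) qI; set r7 := _ - _ => r7I.
set h5 := eproj _ _ _ in E5.
have H : inI i.+2 (h - d h5 - xy *: q').
  apply: (@inI_divX _ _ _ _ j); first by rewrite ji.
  rewrite scalerBr E5 (_ : xy *: q = xy *: r7 + X j *: (xy *: q')).
    by rewrite addrAC addrK; apply: inID => //; apply: inIZ.
  by rewrite /r7 scalerBr !scalerA (mulrC xy) subrK.
rewrite -(subrK (d h5) h) -(subrK (xy *: q') (h - d h5)).
by apply: imKD; [apply: imKD; [apply: imK_I | apply: imK_xy] | apply: imK_d].
Qed.

(** Outer induction on the number of variables not yet set to 0, inner induction on the power of
    [x_j] supplied by [local_cycle]. One step up in y-degree costs one variable, hence the index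
    [i.+2]; with all variables at 0, positive x-degree leaves nothing. *)
Lemma cycle_exact t i h : (0 < t)%N -> ehom t i h -> cycle i i.+2 h -> imK kap i.+2 h.
Proof.
have [k] : exists k, (n <= i.+2 + k)%N by exists n; apply: leq_addl.
elim: k i t h => [|k IH] i t h nk t0 hH hc.
  by rewrite addn0 in nk; apply/imK_I/(inI_leq nk)/(ehom_inI t0 hH).
have [ni|ni] := leqP n i.+2; first by apply/imK_I/(inI_leq ni)/(ehom_inI t0 hH).
pose j := Ordinal ni; have [e] := local_cycle j hH hc.
elim: e t h t0 hH hc => [|e IHe] t h t0 hH hc; first by rewrite expr0 scale1r.
rewrite exprSr -scalerA => H.
apply: (@cycle_divX j t) => // [h' hH' hc'|].
  by apply: (IH i.+1 t) => //; rewrite addSnnS.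
apply: (IHe t.+1) => //; first by rewrite /ehom eproj_xvar hH.
by apply: cycleZ => //; apply: xonlyX.
Qed.

(* The analogue of cycle_divX one step further along the complex. *)
Lemma splice_divX (j : 'I_n) t w : j = 1%N :> nat -> (n - 2 <= t)%N -> ehom t 0 w ->
    (exists g r, X j *: w = c g + r /\ inI 1 r) ->
  exists g r, w = c g + r /\ inI 1 r.
Proof.
move=> j1 nt wH [g [r [E rI]]]; set t' := (t - (n - 2))%N.
have tE : t = (n - 2 + t')%N by rewrite subnKC.
have {}E : X j *: w = c (eproj t'.+1 0 g) + eproj t.+1 0 r.
  by rewrite -c_proj addnS -tE -eprojD -E eproj_xvar wH.
have {}rI : inI 1 (eproj t.+1 0 r) by apply: eproj_inI.
(* [c] raises the x-degree by n - 2, so [n - 2 <= t] gives the argument of [c] the positive degree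
   [t'.+1] that [cycle_exact] requires. This is the source of the degree bound. *)
have [|h [p [r3 [E3 r3I]]]] := cycle_exact (ltn0Sn t') (eproj_id t'.+1 0 g).
  rewrite /= -(addrK (eproj t.+1 0 r) (c _)) -E.
  by apply: inIB; [apply: inI_mulX; rewrite j1 | apply: inI_leq rI].
have {E3} E3 : c (eproj t'.+1 0 g) = c (eproj t'.+1 0 r3).
  rewrite -(eproj_id t'.+1 0 g) E3 !eprojD eproj_xy0 addr0 eproj_dK.
  by rewrite (linearD c) /= splice_dK add0r.
have [r3'] := inI_split j1 (eproj_inI t'.+1 0 r3I); set r4 := _ - _ => r4I.
have n1 : (1 < n)%N by rewrite -j1.
exists r3', (w - c r3'); split; first by rewrite addrC subrK.
apply: (@inI_divX _ _ _ _ j); first by rewrite j1.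
rewrite scalerBr E E3 -[X in c X](subrK (X j *: r3')) -/r4 spliceD spliceZ.
by rewrite addrAC addrK; apply: inID => //; apply: inI_splice.
Qed.

Lemma splice_exact t w : (2 < n)%N -> (n - 2 <= t)%N -> ehom t 0 w ->
    (forall b, inI 1 (wedgel (kf b) w)) ->
  exists g r, w = c g + r /\ inI 1 r.
Proof.
move=> n2 nt wH wI; have n1 : (1 < n)%N by apply: ltnW.
pose j := Ordinal n1; have [T [sg sgP]] := splits_exist j.
have uO : uniq (others j) by rewrite filter_uniq ?index_enum_uniq.
have jO : j \notin others j by rewrite mem_others eqxx.
have [g [r [E rI]]] := local_wl sgP uO jO wI.
have [e eE] := wl_others_splice j.
have {E} : exists g r, X j ^+ (T.+1 * size (others j)) *: w = c g + r /\ inI 1 r.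
  exists ((-1) ^+ e *: (X j *: g)), r; split=> //.
  by rewrite exprM E eE !spliceZ.
elim: (_ * _)%N {g r rI} t nt w wH {wI} => [|f IH] t nt w wH.
  by rewrite expr0 scale1r.
rewrite exprSr -scalerA => H; apply: (@splice_divX j t) => //.
by apply: (IH t.+1) => //; [apply: leqW | rewrite /ehom eproj_xvar wH].
Qed.

Definition in_kform (mu : 'I_n -> P) :=
  exists f : 'I_m -> P, forall b, mu b = \sum_s f s * kf b s.

(** The coefficients [f] are encoded as an element [w] of exterior degree m - 1, which all [k_b]
    annihilate modulo [x_z]. So [w] is [c g0] plus a multiple of [x_z]; as [k_b] kills [c g0], the
    variable cancels. *)
Lemma in_kform_divX (z : 'I_n) t mu : z = 0%N :> nat -> (2 < n)%N -> (n - 2 <= t)%N ->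
  (forall b, bihom t 0 (mu b)) -> in_kform (fun b => X z * mu b) -> in_kform mu.
Proof.
move=> z0 n2 nt muH [f fE].
pose g s := mproj (isdeg t 0) (f s).
have gE b : X z * mu b = \sum_s g s * kf b s.
  rewrite -{1}(muH b) -(mproj_bihom t 0 _ (bihomX F z)) fE raddf_sum /=.
  apply: eq_bigr => s _; rewrite mulrC [RHS]mulrC.
  exact: (mproj_bihom t 0 (f s) (bihom_kform kap b s)).
(* wedging k_b with w computes \sum_s g_s k_s(x, e_b) in top degree. *)
pose w : ext := [ffun J : {set 'I_m} =>
  \sum_s ((J == [set~ s]%SET)%:R * (ext_sign P s [set: 'I_m]%SET * g s)) : P^o].
have wD (t' : 'I_m) (J : {set 'I_m}) : t' \in J ->
    w (J :\ t')%SET = (J == [set: 'I_m]%SET)%:R * (ext_sign P t' [set: 'I_m]%SET * g t').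
  move=> tJ; rewrite ffunE (bigD1 t') //= big1 => [|s st].
    rewrite addr0; congr ((nat_of_bool _)%:R * _); apply/eqP/eqP => [E|->].
      by rewrite -(finset.setD1K tJ) E; apply/setP => s; rewrite !inE orbN.
    by apply/setP => s; rewrite !inE andbT.
  rewrite [_ == _](_ : _ = false) ?mul0r //; apply/eqP => /setP/(_ t').
  by rewrite !inE eqxx eq_sym st.
have wE b J : wedgel (kf b) w J = (J == [set: 'I_m]%SET)%:R * (X z * mu b).
  rewrite wedgelE sum_ffunE gE mulr_sumr; apply: eq_bigr => s _.
  rewrite ffunE wedge1E; case: ifP => sJ; last first.
    rewrite [_ == _](_ : _ = false) ?mul0r ?scaler0 //.
    by apply/eqP => E; rewrite E inE in sJ.
  rewrite wD //; case: (J =P _) => [->|_]; last by rewrite !mul0r mulr0 scaler0.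
  rewrite !mul1r [ext_sign _ _ _ * (_ * _)]mulrA ext_sign2 mul1r.
  exact: mulrC.
have wH : ehom t 0 w.
  apply/ffunP => J; rewrite ext_mapE ffunE raddf_sum; apply: eq_bigr => s _ /=.
  have gH : mproj (isdeg t 0) (g s) = g s.
    by apply: mproj_id => k; rewrite mproj_coeff; case: ifP; rewrite ?eqxx.
  case: (J =P _) => _; last by rewrite !mul0r raddf0.
  by rewrite !mul1r; case: (ext_signP P s [set: 'I_m]%SET) => ->;
    rewrite ?mul1r // !mulN1r raddfN /= gH.
have wX b : wedgel (kf b) w =
    X z *: ([ffun J => (J == [set: 'I_m]%SET)%:R * mu b : P^o] : ext).
  by apply/ffunP => J; rewrite wE !ffunE; apply: mulrCA.
have [|g0 [r [E rI]]] := splice_exact n2 nt wH.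
  by move=> b; rewrite wX; apply: inI_mulX; rewrite z0.
have [r' r'I] := inI_split z0 rI.
(* The ideal of no variables is 0: [cut 0] is the identity. *)
have rE : r = X z *: r'.
  apply/eqP; rewrite -subr_eq0; apply/eqP/ffunP => J.
  have := congr1 (fun f : ext => f J : P) r'I; rewrite ext_mapE.
  by rewrite /cut mproj_id // => k _; apply/lowP => a.
exists (fun s => ext_sign P s [set: 'I_m]%SET * r' ([set: 'I_m] :\ s)%SET) => b.
apply: (mulfI (xvar_neq0 F z)); rewrite -[LHS]mul1r.
transitivity (wedgel (kf b) w [set: 'I_m]%SET : P); first by rewrite wE eqxx.
have -> : wedgel (kf b) w = X z *: wedgel (kf b) r'.
  rewrite E rE; transitivity (wedgel (kf b) (c g0) + wedgel (kf b) (X z *: r')).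
    exact: linearD.
  by rewrite wedgel_splice add0r linearZ.
rewrite ffunE wedgelE sum_ffunE; congr (_ * _); apply: eq_bigr => s _.
by rewrite ffunE wedge1E finset.in_setT; apply: mulrC.
Qed.

End Splice.

Theorem kform_syzygy (mu : 'I_n -> P) : (2 < n)%N ->
    (forall j, exists T sg, @splits j T sg) ->
    (forall b, bihom (n - 2) 0 (mu b)) -> \sum_b X b * mu b = 0 ->
  in_kform mu.
Proof.
move=> n2 sgP muH mu0.
have n0 : (0 < n)%N by apply: leq_trans n2.
have n1 : (1 < n)%N by apply: leq_trans n2.
pose z := Ordinal n0; pose o := Ordinal n1; have zo : z != o by [].
have [c0 [cL cE c_proj]] := splice_exists kap_skew zo.
pose c : {linear ext -> ext} := HB.pack c0 (GRing.isLinear.Build P ext ext _ c0 cL).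
have [T [sg sgz]] := sgP z; have [_ _ sgE] := sgz.
(* The splitting lifts [mu] after multiplication by this power; the terms with [x_a mu_a] add up to
   0 by [mu0]. *)
have H : in_kform (fun b => X z ^+ T.+1 * mu b).
  exists (fun s => \sum_b mu b * sg b s) => b.
  under eq_bigr do rewrite mulr_suml; rewrite exchange_big /=.
  rewrite (eq_bigr (fun a => mu a * (X z ^+ T * (X z * (a == b)%:R - X a * (z == b)%:R)))).
    under eq_bigr do rewrite mulrBr mulrBr; rewrite sumrB.
    rewrite (bigD1 b) //= eqxx big1 => [|a ab]; last by rewrite (negbTE ab) !mulr0.
    rewrite (eq_bigr (fun a => (X z ^+ T * (z == b)%:R) * (X a * mu a))).
      by rewrite -mulr_sumr mu0 mulr0 subr0 addr0 mulr1 -exprSr mulrC.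
    by move=> a _; rewrite !mulrA; ring.
  by move=> a _; rewrite -sgE mulr_sumr; apply: eq_bigr => s _; rewrite mulrA.
suff desc e t : forall nu, (n - 2 <= t)%N -> (forall b, bihom t 0 (nu b)) ->
    in_kform (fun b => X z ^+ e * nu b) -> in_kform nu.
  exact: (desc T.+1 (n - 2)%N).
elim: e t => [|e IH] t nu nt nuH.
  by case=> f fE; exists f => b; rewrite -fE mul1r.
case=> f fE; apply: (in_kform_divX (c := c) (z := z) zo cE c_proj sgP _ n2 nt nuH) => //.
apply: (IH t.+1); first exact: leqW.
  by move=> b; exact: (bihomM (bihomX F z) (nuH b)).
by exists f => b; rewrite -fE exprSr mulrA.
Qed.

End Complex.

(** * Functionals on polynomials *)

Section Evaluation.
Variables (F : fieldType) (n : nat).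
Implicit Types (l : 'X_{1..n} -> F) (p : {mpoly F[n]}) (k : 'X_{1..n}).

(* The functional on polynomials with value l k at the monomial k. *)
Definition ev l p : F^o := \sum_(k <- msupp p) p@_k * l k.

Lemma ev_supp l p (s : seq 'X_{1..n}) : uniq s -> {subset msupp p <= s} ->
  ev l p = \sum_(k <- s) p@_k * l k.
Proof.
move=> us ps; rewrite (bigID (mem (msupp p))) /= [X in _ = _ + X]big1; last first.
  by move=> k /memN_msupp_eq0 ->; rewrite mul0r.
rewrite addr0 -big_filter; apply/perm_big/uniq_perm; rewrite ?filter_uniq //.
by move=> k; rewrite mem_filter; case: (boolP (k \in msupp p)) => // /ps ->.
Qed.

Lemma ev_is_linear l : scalar (ev l).
Proof.
move=> a p q; pose s := undup (msupp p ++ msupp q ++ msupp (a *: p + q)).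
have us : uniq s by apply: undup_uniq.
have sub r : r \in [:: p; q; a *: p + q] -> {subset msupp r <= s}.
  by rewrite !inE => /or3P[] /eqP -> k kr; rewrite mem_undup !mem_cat kr ?orbT.
rewrite !(ev_supp l us (sub _ _)) ?inE ?eqxx ?orbT //.
rewrite mulr_sumr -big_split; apply: eq_bigr => k _ /=.
by rewrite mcoeffD mcoeffZ mulrDl mulrA.
Qed.
HB.instance Definition _ l :=
  GRing.isLinear.Build F {mpoly F[n]} F^o _ (ev l) (ev_is_linear l).

Lemma evB l p q : ev l (p - q) = ev l p - ev l q. Proof. exact: linearB. Qed.

Lemma evZ l c p : ev l (c *: p) = c * ev l p. Proof. exact: linearZ. Qed.

Lemma ev_sum l (I : Type) (s : seq I) (Q : pred I) (f : I -> {mpoly F[n]}) :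
  ev l (\sum_(i <- s | Q i) f i) = \sum_(i <- s | Q i) ev l (f i).
Proof. exact: linear_sum. Qed.

Lemma ev_mono l k : ev l 'X_[k] = l k.
Proof. by rewrite /ev msuppX big_seq1 mcoeffX eqxx mul1r. Qed.

Lemma evXM l a p : ev l ('X_a * p) = ev (fun k => l (k + U_(a))%MM) p.
Proof.
rewrite (mpolyE p) mulr_sumr !linear_sum; apply: eq_bigr => k _ /=.
by rewrite -scalerAr !linearZ /= -mpolyXD !ev_mono addmC.
Qed.

End Evaluation.

(** * Restriction of the syzygy theorem to the variables x *)

Section Embedding.
Variables (F : numFieldType) (n m : nat) (kap : 'I_m -> 'I_n -> 'I_n -> F).
Hypothesis kap_skew : forall s a b, kap s a b = - kap s b a.
Local Notation S := {mpoly F[n]}.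
Local Notation P := {mpoly F[n + n]}.
Local Notation X := (xvar F).

Definition kformS (b : 'I_n) (s : 'I_m) : S := \sum_a kap s a b *: 'X_a.

Definition xembed : S -> P := comp_mpoly [tuple X i | i < n].
Definition xretract : P -> S :=
  comp_mpoly [tuple if fintype.split i is inl j then 'X_j else 0 | i < n + n].
HB.instance Definition _ := GRing.Linear.on xembed.
HB.instance Definition _ := GRing.RMorphism.on xembed.
HB.instance Definition _ := GRing.Linear.on xretract.
HB.instance Definition _ := GRing.RMorphism.on xretract.

Lemma xembedZ a p : xembed (a *: p) = a *: xembed p. Proof. exact: linearZ. Qed.

Lemma xretractZ a p : xretract (a *: p) = a *: xretract p. Proof. exact: linearZ. Qed.

Lemma xembedX i : xembed 'X_i = X i.
Proof. by rewrite /xembed comp_mpolyXU -tnth_nth tnth_mktuple. Qed.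

Lemma xretractX i : xretract (X i) = 'X_i.
Proof.
by rewrite /xretract comp_mpolyXU -tnth_nth tnth_mktuple (unsplitK (inl i)).
Qed.

Lemma xembedK p : xretract (xembed p) = p.
Proof.
rewrite [in RHS](mpolyE p) {1}(mpolyE p) (linear_sum xembed) (linear_sum xretract).
apply: eq_bigr => k _; rewrite /= xembedZ xretractZ; congr (_ *: _).
rewrite mpolyXE_id (rmorph_prod xembed) (rmorph_prod xretract); apply: eq_bigr => i _.
by rewrite (rmorphXn xembed) (rmorphXn xretract) /= xembedX xretractX.
Qed.

Lemma xembed_kform b s : xembed (kformS b s) = kform kap b s.
Proof.
by rewrite linear_sum; apply: eq_bigr => a _; rewrite linearZ /= xembedX.
Qed.

Lemma xembed_mono k : xembed 'X_[k] = \prod_i X i ^+ k i.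
Proof. by rewrite /xembed comp_mpolyX; apply: eq_bigr => i _; rewrite tnth_mktuple. Qed.

Lemma xembedE p : xembed p = \sum_(k <- msupp p) p@_k *: \prod_i X i ^+ k i.
Proof.
rewrite {1}(mpolyE p) (linear_sum xembed); apply: eq_bigr => k _.
by rewrite /= xembedZ xembed_mono.
Qed.

Lemma xonly_xembed p : xonly (xembed p).
Proof.
move=> c; rewrite xembedE raddf_sum big1 // => k _; rewrite /= mderivZ.
suff -> : (\prod_i X i ^+ k i)^`M(rshift n c) = 0 by rewrite scaler0.
apply: (big_ind (fun p : P => p^`M(rshift n c) = 0)) => [|p1 p2 p10 p20|i _].
- by rewrite -mpolyC1 mderivC.
- by rewrite mderivM p10 p20 mul0r mulr0 addr0.
by apply: (xonlyXn (k i) (xonlyX F i)).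
Qed.

Lemma bihom_xembed t p : p \is t.-homog -> bihom t 0 (xembed p).
Proof.
move/dhomogP => pt; rewrite /bihom xembedE raddf_sum; apply: eq_big_seq => k kp.
rewrite /= linearZ /=; congr (_ *: _); have <- : mdeg k = t := pt k kp; rewrite mdegE.
rewrite -/(bihom _ _ _).
apply: (big_rec2 (fun (p : P) d => bihom d 0 p)) => [|i d p' _ H].
  rewrite -mpolyX0; apply: bihomU.
  by rewrite /isdeg /xdeg /ydeg !big1 // => b _; rewrite mnm0E.
apply: (@bihomM _ _ _ 0 _ 0) H.
elim: (k i) => [|e IH].
  rewrite expr0 -mpolyX0; apply: bihomU.
  by rewrite /isdeg /xdeg /ydeg !big1 // => b _; rewrite mnm0E.
by rewrite exprS; apply: (@bihomM _ _ 1 0 _ 0) IH; apply: bihomX.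
Qed.

Definition splitsS (j : 'I_n) T (sg : 'I_n -> 'I_m -> S) :=
  (forall s, sg j s = 0) /\
  forall b c, \sum_s sg b s * kformS c s =
    'X_j ^+ T * ('X_j * (b == c)%:R - 'X_b * (j == c)%:R).

Lemma kform_syzygyS (mu : 'I_n -> S) : (2 < n)%N ->
    (forall j, exists T sg, @splitsS j T sg) ->
    (forall b, mu b \is (n - 2).-homog) -> \sum_b 'X_b * mu b = 0 ->
  exists f : 'I_m -> S, forall b, mu b = \sum_s f s * kformS b s.
Proof.
move=> n2 sgP muH mu0.
have [|||f fE] := @kform_syzygy _ _ _ kap kap_skew (xembed \o mu) n2.
- move=> j; have [T [sg [sg0 sgE]]] := sgP j; exists T, (fun b s => xembed (sg b s)).
  split=> [b s|s|b c]; [exact: xonly_xembed | by rewrite sg0 raddf0 | ].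
  under eq_bigr do rewrite -xembed_kform -rmorphM.
  rewrite -rmorph_sum sgE rmorphM rmorphB !rmorphM rmorphXn !rmorph_nat /=.
  by rewrite !xembedX.
- by move=> b; apply: bihom_xembed.
- by rewrite -[RHS](raddf0 xembed) -mu0 raddf_sum; apply: eq_bigr => b _ /=;
    rewrite rmorphM /= xembedX.
exists (xretract \o f) => b; rewrite -[LHS]xembedK [xembed _]fE rmorph_sum.
by apply: eq_bigr => s _; rewrite rmorphM /= -xembed_kform xembedK.
Qed.

End Embedding.

(** * Cocycles *)

Section Cocycle.
Variables (F : numFieldType) (n m : nat) (kap : 'I_m -> 'I_n -> 'I_n -> F).
Hypothesis kap_skew : forall s a b, kap s a b = - kap s b a.
Local Notation S := {mpoly F[n]}.
Implicit Types (l : 'I_n -> 'I_n -> 'X_{1..n} -> F) (k : 'X_{1..n}) (q T : nat).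

(* The dual of the degree q component of the Koszul module: l i j is a functional on
   Sym^q V, given by its values at monomials, and the third condition is the
   vanishing on the image of the Koszul differential. *)
Definition cocycle q l :=
  [/\ forall a b k, mdeg k != q -> l a b k = 0,
      forall a b k, l a b k = - l b a k,
      forall a b c k,
        l b c (k + U_(a))%MM - l a c (k + U_(b))%MM + l a b (k + U_(c))%MM = 0
    & forall s k, \sum_a \sum_b kap s a b * l a b k = 0].

Lemma cocycle_ev q l a b c p : cocycle q l ->
  ev (l b c) ('X_a * p) - ev (l a c) ('X_b * p) + ev (l a b) ('X_c * p) = 0.
Proof.
case=> _ _ lC _; rewrite !evXM /ev -sumrB -big_split big1 // => k _ /=.
by rewrite -mulrBr -mulrDr lC mulr0.
Qed.

Lemma ev_euler q (l : 'X_{1..n} -> F) (p : S) : (forall k, mdeg k != q -> l k = 0) ->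
  \sum_a ev l ('X_a * p^`M(a)) = q%:R * ev l p.
Proof.
move=> lq; rewrite [in RHS](mpolyE p) linear_sum mulr_sumr.
transitivity (\sum_a \sum_(k <- msupp p) ev l ('X_a * (p@_k *: 'X_[k])^`M(a))).
  by apply: eq_bigr => a _; rewrite {1}(mpolyE p) raddf_sum mulr_sumr linear_sum.
rewrite exchange_big; apply: eq_bigr => k _ /=.
transitivity (\sum_a (k a)%:R * (p@_k * l k)).
  apply: eq_bigr => a _; rewrite mderivZ mderivX -!scalerAr !linearZ /= mulrCA.
  have [->|k0] := eqVneq (k a) 0%N; first by rewrite !mul0r.
  by rewrite -mpolyXD addmC submK ?lep1mP // ev_mono.
rewrite -mulr_suml -natr_sum -mdegE linearZ /= ev_mono.
by have [->|/lq ->] := eqVneq (mdeg k) q; rewrite // !mulr0.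
Qed.

(* Sum the closedness condition at d/dx_a (z b c) over all a, b, c: by Euler's identity
   the three terms contribute q, 1 and 1 times the sum below. *)
Lemma cocycle_skew_cycle q l (z : 'I_n -> 'I_n -> S) : cocycle q l ->
    (forall a b, z a b = - z b a) -> (forall b, \sum_a 'X_a * z a b = 0) ->
  \sum_a \sum_b ev (l a b) (z a b) = 0.
Proof.
move=> lC z_skew z0; set L := \sum_a _; have [lq _ _ _] := lC.
have dz a b : \sum_c 'X_c * (z c b)^`M(a) = - z a b.
  apply/eqP; rewrite -addr_eq0; apply/eqP.
  transitivity ((\sum_c 'X_c * z c b)^`M(a)); last by rewrite z0 raddf0.
  rewrite raddf_sum /= [RHS](eq_bigr (fun c => (c == a)%:R *: z c b + 'X_c * (z c b)^`M(a))).
    have E : \sum_c (c == a)%:R *: z c b = z a b.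
      rewrite (bigD1 a) //= eqxx scale1r big1 ?addr0 // => c ca.
      by rewrite (negbTE ca) scale0r.
    by rewrite big_split /= E addrC.
  move=> c _; rewrite mderivM mderivX mnm1E.
  case: (c =P a) => [->|_]; last by rewrite !scale0r mul0r.
  by rewrite !scale1r (_ : (_ - _)%MM = 0%MM) ?mpolyX0 ?mul1r //; apply/mnmP => i;
    rewrite mnmBE subnn mnm0E.
have dz' a b : \sum_c 'X_c * (z b c)^`M(a) = z a b.
  rewrite -[RHS]opprK -dz -sumrN; apply: eq_bigr => c _.
  by rewrite (z_skew b c) raddfN mulrN.
have T1 : \sum_a \sum_b \sum_c ev (l b c) ('X_a * (z b c)^`M(a)) = q%:R * L.
  rewrite exchange_big mulr_sumr; apply: eq_bigr => b _ /=.
  rewrite exchange_big mulr_sumr; apply: eq_bigr => c _ /=.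
  exact: ev_euler (lq b c).
have T2 : \sum_a \sum_b \sum_c ev (l a c) ('X_b * (z b c)^`M(a)) = - L.
  rewrite -sumrN; apply: eq_bigr => a _; rewrite exchange_big -sumrN.
  by apply: eq_bigr => c _; rewrite -linear_sum dz linearN.
have T3 : \sum_a \sum_b \sum_c ev (l a b) ('X_c * (z b c)^`M(a)) = L.
  apply: eq_bigr => a _; apply: eq_bigr => b _.
  by rewrite -linear_sum dz'.
have : q.+2%:R * L = 0.
  transitivity (q%:R * L + L + L); first by rewrite -!natr1 !mulrDl !mul1r.
  rewrite -{1}T1 -{1}[L]opprK -{1}T2 -{1}T3 -sumrB -big_split big1 // => a _ /=.
  rewrite -sumrB -big_split big1 // => b _ /=.
  rewrite -sumrB -big_split big1 // => c _ /=.
  exact: cocycle_ev lC.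
by move/eqP; rewrite mulf_eq0 pnatr_eq0 /= => /eqP.
Qed.

Lemma cocycle_eq0 l : (2 < n)%N -> (forall j, exists T sg, splitsS kap j T sg) ->
  cocycle (n - 3) l -> forall a b k, l a b k = 0.
Proof.
move=> n2 sgP lC a b k; have [lq lA _ lK] := lC.
have [kn|/lq //] := eqVneq (mdeg k) (n - 3)%N.
pose s : S := 'X_[k].
pose mu c : S := (c == b)%:R *: ('X_a * s) - (c == a)%:R *: ('X_b * s).
have muH c : mu c \is (n - 2).-homog.
  have XH e : 'X_e * s \is (n - 2).-homog.
    by rewrite -mpolyXD dhomogX /= mdegD mdeg1 kn add1n -subSn ?subSS.
  by apply: rpredB; apply: rpredZ.
have mu0 : \sum_c 'X_c * mu c = 0.
  under eq_bigr do rewrite mulrBr -!scalerAr; rewrite sumrB.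
  rewrite (bigD1 b) //= eqxx scale1r big1 => [|c cb]; last by rewrite (negbTE cb) scale0r.
  rewrite (bigD1 a) //= eqxx scale1r big1 => [|c ca]; last by rewrite (negbTE ca) scale0r.
  by rewrite !addr0 mulrCA subrr.
have [f fE] := kform_syzygyS kap_skew n2 sgP muH mu0.
(* The bivector [s e_a /\ e_b] corrected by elements of K: its contraction with x is [mu] minus the
   image of [f], hence 0. *)
pose z d c : S := ((d == a) && (c == b))%:R *: s - ((d == b) && (c == a))%:R *: s
  - \sum_t kap t d c *: f t.
have z_skew d c : z d c = - z c d.
  rewrite /z opprB (andbC (c == a)) (andbC (c == b)) addrC; congr (_ + _); last first.
    by rewrite opprB.
  by rewrite -sumrN; apply: eq_bigr => t _; rewrite kap_skew scaleNr opprK.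
have z0 c : \sum_d 'X_d * z d c = 0.
  rewrite /z; under eq_bigr do rewrite mulrBr mulrBr mulr_sumr.
  rewrite !sumrB; apply/eqP; rewrite subr_eq0; apply/eqP.
  transitivity (mu c).
    congr (_ - _).
      rewrite (bigD1 a) //= eqxx big1 => [|d da]; last by rewrite (negbTE da) scale0r mulr0.
      by rewrite addr0 -scalerAr.
    rewrite (bigD1 b) //= eqxx big1 => [|d db]; last by rewrite (negbTE db) scale0r mulr0.
    by rewrite addr0 -scalerAr.
  rewrite fE exchange_big; apply: eq_bigr => t _; rewrite mulr_sumr.
  by apply: eq_bigr => d _; rewrite -!scalerAr mulrC.
have := cocycle_skew_cycle lC z_skew z0.
have dS d e : \sum_c \sum_f ((c == d) && (f == e))%:R * l c f k = l d e k.
  rewrite (bigD1 d) //= [X in _ + X]big1 => [|c cd].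
    rewrite addr0 (bigD1 e) //= [X in _ + X]big1 => [|f' fe].
      by rewrite !eqxx mul1r !addr0.
    by rewrite (negbTE fe) andbF mul0r.
  by apply: big1 => f' _; rewrite (negbTE cd) mul0r.
have E : \sum_c \sum_d ev (l c d) (z c d) = l a b k *+ 2.
  under eq_bigr do under eq_bigr do rewrite /z !evB !evZ ev_mono.
  under eq_bigr do rewrite !sumrB; rewrite !sumrB.
  rewrite !dS (lA b a) opprK.
  (* The correction contributes nothing, since [lK] holds at every monomial. *)
  rewrite [X in _ - X](_ : _ = 0) ?subr0 //.
  transitivity (\sum_t \sum_c \sum_d kap t c d * ev (l c d) (f t)).
    rewrite [RHS]exchange_big /=; apply: eq_bigr => c _.
    rewrite [RHS]exchange_big /=; apply: eq_bigr => d _.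
    rewrite ev_sum; apply: eq_bigr => t _.
    by rewrite evZ.
  apply: big1 => t _; rewrite /ev.
  under eq_bigr do under eq_bigr do rewrite mulr_sumr.
  under eq_bigr do rewrite exchange_big; rewrite exchange_big big1 // => k' _ /=.
  under eq_bigr do under eq_bigr do rewrite mulrCA.
  by under eq_bigr do rewrite -mulr_sumr; rewrite -mulr_sumr lK mulr0.
by rewrite E -mulr_natr => /eqP; rewrite mulf_eq0 pnatr_eq0 orbF => /eqP.
Qed.

(** Puts the functional on a fixed finite index type, so that it can be compared with a matrix
    column. *)
Lemma ev_bounded w (l : 'X_{1..n} -> F) p : (forall k, (w <= mdeg k)%N -> l k = 0) ->
  ev l p = \sum_(k : 'X_{1..n < w}) p@_k * l k.
Proof.
move=> lw; have lin k : l k = \sum_(k' : 'X_{1..n < w}) (k == k')%:R * l k'.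
  have [wk|kw] := leqP w (mdeg k).
    rewrite lw // big1 // => k' _; case: (k =P k') => [E|_]; last by rewrite mul0r.
    by rewrite -E lw // mulr0.
  rewrite (bigD1 (BMultinom kw)) //= eqxx mul1r big1 ?addr0 // => k' kk.
  rewrite (_ : (k == k') = false) ?mul0r //; apply: contraNF kk => /eqP E.
  by apply/eqP/val_inj.
rewrite /ev; under eq_bigr do rewrite lin mulr_sumr.
rewrite exchange_big; apply: eq_bigr => k' _ /=; rewrite [in RHS](mpolyE p) raddf_sum.
rewrite mulr_suml; apply: eq_bigr => k _ /=.
by rewrite mcoeffZ mcoeffX mulrA.
Qed.

(* A functional theta on V (x) Sym^(T+1) V that vanishes on the image of K but not on
   the vector to be reached yields the nonzero cocycle
   theta_j(x_i p) - theta_i(x_j p). *)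
Lemma cocycle0_splits T : (forall l, cocycle T l -> forall a b k, l a b k = 0) ->
  forall j, exists sg, splitsS kap j T sg.
Proof.
move=> D0 j.
suff H b : exists g : 'I_m -> S, forall c, \sum_s g s * kformS kap c s =
    'X_j ^+ T * ('X_j * (b == c)%:R - 'X_b * (j == c)%:R).
  (* For [b = j] the right-hand side is 0, so [sg j] may be replaced by 0. *)
  have [g gE] := fin_all_exists H; exists (fun b s => if b == j then 0 else g b s).
  split=> [s|b c]; first by rewrite eqxx.
  case: (b =P j) => [->|_]; last exact: gE.
  by rewrite subrr mulr0 big1 // => s _; rewrite mul0r.
have kE k c s : 'X_[k] * kformS kap c s = \sum_a kap s a c *: 'X_[k + U_(a)].
  by rewrite mulr_sumr; apply: eq_bigr => a _; rewrite -scalerAr -mpolyXD.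
pose jT b' := (U_(j) *+ T + U_(b'))%MM.
have jTdeg b' : mdeg (jT b') = T.+1 by rewrite mdegD mdegMn !mdeg1 mul1n addn1.
pose t c : S := (b == c)%:R *: 'X_[jT j] - (j == c)%:R *: 'X_[jT b].
have tE c : 'X_j ^+ T * ('X_j * (b == c)%:R - 'X_b * (j == c)%:R) = t c.
  rewrite mulrBr; congr (_ - _); rewrite mulrA mpolyXn -mpolyXD mulrC;
    by rewrite -mul_mpolyC mpolyC_nat.
pose eI (i : 'I_#|{: 'I_m * 'X_{1..n < T.+1}}|) : 'I_m * 'X_{1..n < T.+1} := enum_val i.
pose eJ (i : 'I_#|{: 'I_n * 'X_{1..n < T.+2}}|) : 'I_n * 'X_{1..n < T.+2} := enum_val i.
(* The map K (x) S -> V (x) S between polynomials of bounded degree; its row space contains [v] when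
   [g] can be found in degree at most [T]. *)
pose A : 'M[F]_(#|{: 'I_m * 'X_{1..n < T.+1}}|, #|{: 'I_n * 'X_{1..n < T.+2}}|) := \matrix_(i, j)
  ('X_[(eI i).2] * kformS kap (eJ j).1 (eI i).1)@_((eJ j).2).
pose v : 'rV[F]_(#|{: 'I_n * 'X_{1..n < T.+2}}|) := \row_j (t (eJ j).1)@_((eJ j).2).
have [/submxP[w vE]|vA] := boolP (v <= A)%MS.
  exists (fun s => \sum_(k : 'X_{1..n < T.+1}) w 0 (enum_rank (s, k)) *: 'X_[k]) => c.
  rewrite tE; apply/mpolyP => k; have [kT|Tk] := ltnP (mdeg k) T.+2; last first.
    have nE k' : mdeg k' != mdeg k -> (k' == k) = false.
      by move=> H; apply: contraNF H => /eqP ->.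
    have jTk b' : (jT b' == k) = false.
      by apply: nE; rewrite jTdeg neq_ltn Tk.
    rewrite mcoeffB !mcoeffZ !mcoeffX !jTk !mulr0 subr0 raddf_sum big1 // => s _ /=.
    rewrite mulr_suml raddf_sum big1 // => k' _ /=.
    rewrite -scalerAl mcoeffZ kE raddf_sum big1 ?mulr0 // => a _ /=.
    rewrite mcoeffZ mcoeffX nE ?mulr0 // mdegD mdeg1 addn1 neq_ltn.
    by rewrite (leq_trans _ Tk) // ltnS bmdeg.
  have := congr1 (fun x : 'rV_ _ => x 0 (enum_rank (c, BMultinom kT))) vE.
  rewrite !mxE /eI /eJ !enum_rankK /= => ->; rewrite (reindex (@enum_rank _)) /=; last first.
    exact/onW_bij/enum_rank_bij.
  transitivity (\sum_s \sum_(k' : 'X_{1..n < T.+1})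
      w 0 (enum_rank (s, k')) * ('X_[k'] * kformS kap c s)@_k).
    rewrite raddf_sum; apply: eq_bigr => s _; rewrite mulr_suml raddf_sum.
    by apply: eq_bigr => k' _; rewrite -scalerAl; apply: mcoeffZ.
  rewrite pair_big /=; apply: eq_bigr => -[s k'] _ /=.
  by rewrite !mxE /eI /eJ !enum_rankK.
exfalso; move: vA; rewrite submxE => /negP; apply; apply/eqP/rowP => i; rewrite [RHS]mxE.
(* A column of the cokernel, read as a family of functionals and extended by 0 to monomials of
   larger degree. *)
pose th c k : F := oapp (fun k' : 'X_{1..n < T.+2} => cokermx A (enum_rank (c, k')) i) 0
  (insub k : option 'X_{1..n < T.+2}).
have th_ev c p : ev (th c) p =
    \sum_(k : 'X_{1..n < T.+2}) p@_k * cokermx A (enum_rank (c, k)) i.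
  rewrite (@ev_bounded T.+2) => [|k kT]; last by rewrite /th insubN // -leqNgt.
  by apply: eq_bigr => k _; rewrite /th valK.
have sumJ (p : 'I_n -> S) :
    \sum_j' (p (eJ j').1)@_((eJ j').2) * cokermx A j' i = \sum_c ev (th c) (p c).
  under [RHS]eq_bigr do rewrite th_ev.
  rewrite pair_big /= (reindex (@enum_rank _)) /=; last first.
    exact/onW_bij/enum_rank_bij.
  by apply: eq_bigr => -[c k] _; rewrite /eJ enum_rankK.
have thK s k : (mdeg k < T.+1)%N -> \sum_c \sum_a kap s a c * th c (k + U_(a))%MM = 0.
  move=> kT; have := congr1 (fun x : 'M_(_, _) =>
    x (enum_rank (s, BMultinom kT)) i) (mulmx_coker A); rewrite !mxE => E.
  rewrite -[RHS]E; under [RHS]eq_bigr do rewrite mxE /eI enum_rankK /=.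
  rewrite (sumJ (fun c => 'X_[k] * kformS kap c s)); apply: eq_bigr => c _.
  by rewrite kE ev_sum; apply: eq_bigr => a _; rewrite evZ ev_mono.
rewrite mxE; under eq_bigr do rewrite mxE; rewrite sumJ.
pose om a c k := if mdeg k == T then th c (k + U_(a))%MM - th a (k + U_(c))%MM else 0.
have omC : cocycle T om.
  split=> [a c k kT|a c k|a b' c k|s k].
  - by rewrite /om (negbTE kT).
  - by rewrite /om; case: ifP; rewrite ?oppr0 // opprB.
  - rewrite /om !mdegD !mdeg1; case: ifP => _; last by rewrite subr0 addr0.
    have sw a1 a2 : (k + U_(a1) + U_(a2) = k + U_(a2) + U_(a1))%MM.
      by rewrite -!addmA (addmC U_(a1)%MM).
    by rewrite (sw b' a) (sw c a) (sw c b'); ring.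
  rewrite /om; case: eqP => [kT|_]; last first.
    by rewrite big1 // => a _; rewrite big1 // => c _; rewrite mulr0.
  under eq_bigr do under eq_bigr do rewrite mulrBr.
  under eq_bigr do rewrite sumrB; rewrite sumrB [X in X - _]exchange_big /= thK ?kT //.
  rewrite sub0r -sumrN -[RHS](thK s k) ?kT //; apply: eq_bigr => a _; rewrite -sumrN.
  by apply: eq_bigr => c _; rewrite kap_skew mulNr opprK.
(* At the pair [j], [b] and the monomial [x_j^T], the vanishing of [om] says that the functional
   kills [v]. *)
have := D0 _ omC j b (U_(j) *+ T)%MM.
rewrite /om mdegMn mdeg1 mul1n eqxx => om0.
under eq_bigr do rewrite evB !evZ !ev_mono.
rewrite sumrB (bigD1 b) //= eqxx mul1r big1 => [|c cb]; last by rewrite eq_sym (negbTE cb) mul0r.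
rewrite (bigD1 j) //= eqxx mul1r big1 => [|c cj]; last by rewrite eq_sym (negbTE cj) mul0r.
by rewrite !addr0.
Qed.

End Cocycle.

(** * Vanishing of cocycles in large degree *)

(** The cocycle conditions range over infinitely many monomials, so the subspace is obtained by
    enlarging one until it is maximal; [d] bounds the codimension left. *)
Lemma vspace_of_pred (F : fieldType) (E : vectType F) (Q : E -> Prop) :
    Q 0 -> (forall a u v, Q u -> Q v -> Q (a *: u + v)) ->
  exists U : {vspace E}, forall u, u \in U <-> Q u.
Proof.
move=> Q0 QP; suff H d (U : {vspace E}) : (\dim {:E} <= \dim U + d)%N ->
    (forall u, u \in U -> Q u) -> exists U : {vspace E}, forall u, u \in U <-> Q u.
  apply: (H (\dim {:E}) 0%VS); first by rewrite leq_addl.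
  by move=> u; rewrite memv0 => /eqP ->.
elim: d U => [|d IH] U dU UQ.
  exists U => u; split=> [/UQ //|_]; suff -> : U = fullv by rewrite memvf.
  by apply/eqP; rewrite eqEdim subvf -(addn0 (\dim U)).
have [[u Qu uU]|nQ] := pselect (exists2 u, Q u & u \notin U); last first.
  exists U => u; split=> [/UQ //|Qu]; apply: contrapT => /negP uU.
  by apply: nQ; exists u.
apply: (IH (U + <[u]>)%VS) => [|w /memv_addP[w1 /UQ Qw1 [w2 /vlineP[a ->] ->]]].
  apply: leq_trans dU _; rewrite addnS -addSn leq_add2r.
  rewrite ltnNge; apply: contra uU => dim_le.
  have /eqP -> : U == (U + <[u]>)%VS by rewrite eqEdim addvSl.
  by rewrite -[X in X \in _]add0r memv_add ?mem0v ?memv_line.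
by rewrite addrC; apply: QP.
Qed.

Lemma nonincreasing_stabilizes (d : nat -> nat) N :
  (forall t, (N <= t)%N -> (d t.+1 <= d t)%N) -> exists2 t, (N <= t)%N & d t.+1 = d t.
Proof.
have [k] := ubnP (d N); elim: k N => // k IH N dk dN.
have [E|dlt] := eqVneq (d N.+1) (d N); first by exists N.
have [||t Nt E] := IH N.+1.
- by apply: (@leq_trans (d N)); rewrite // ltn_neqAle dlt dN.
- by move=> t Nt; apply: dN; apply: ltnW.
by exists t => //; apply: ltnW.
Qed.

Section Nullstellensatz.
Variables (F : numClosedFieldType) (n m : nat) (kap : 'I_m -> 'I_n -> 'I_n -> F).
Hypothesis kap_skew : forall s a b, kap s a b = - kap s b a.
Implicit Types (l : 'I_n -> 'I_n -> 'X_{1..n} -> F) (k : 'X_{1..n}) (r t : nat).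

(** Values at all monomials of degree at most [t] are kept because these form a finite type;
    [cocycle] forces those in degree below [t] to vanish. *)
Definition cochain t : vectType F := {ffun 'I_n * 'I_n * 'X_{1..n < t.+1} -> F^o}.

Definition coef t (e : cochain t) (a b : 'I_n) k : F :=
  if insub k is Some k' then (e : {ffun _ -> _}) (a, b, k') else 0.

Definition cochain_of t l : cochain t := 
  [ffun x : 'I_n * 'I_n * 'X_{1..n < t.+1} => l x.1.1 x.1.2 x.2 : F^o].

(** The transpose of multiplication by [x_c]. *)
Definition sh (c : 'I_n) t (e : cochain t.+1) : cochain t :=
  cochain_of t (fun a b k => coef e a b (k + U_(c))%MM).

Lemma coef_lin t x (e e' : cochain t) a b k :
  coef (x *: e + e') a b k = x * coef e a b k + coef e' a b k.
Proof. by rewrite /coef; case: insub => [k'|]; rewrite ?ffunE ?mulr0 ?addr0. Qed.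

Lemma coef0 t a b k : coef (0 : cochain t) a b k = 0.
Proof. by rewrite /coef; case: insub => // k'; rewrite ffunE. Qed.

Lemma coef_inj t (e e' : cochain t) : (forall a b k, coef e a b k = coef e' a b k) -> e = e'.
Proof.
by move=> ee; apply/ffunP => -[[a b] k]; have := ee a b k; rewrite /coef !valK.
Qed.

Lemma coef_cochain_of t l a b k : (forall a b k, (t < mdeg k)%N -> l a b k = 0) ->
  coef (cochain_of t l) a b k = l a b k.
Proof.
move=> lt; rewrite /coef; case: insubP => [k' _ kk|]; first by rewrite ffunE kk.
by rewrite -leqNgt => /lt ->.
Qed.

Lemma coef_sh c t (e : cochain t.+1) a b k :
  coef (sh c e) a b k = coef e a b (k + U_(c))%MM.
Proof.
rewrite coef_cochain_of // => a' b' k' tk; rewrite /coef insubN //.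
by rewrite -leqNgt mdegD mdeg1 addn1.
Qed.

Lemma sh_lin c t : linear (@sh c t).
Proof. by move=> x e e'; apply: coef_inj => a b k; rewrite !(coef_sh, coef_lin). Qed.
HB.instance Definition _ c t :=
  GRing.isLinear.Build F (cochain t.+1) (cochain t) _ (@sh c t) (@sh_lin c t).

(* The cocycles annihilated by x_r, x_(r+1), ... *)
Definition cocycle_in r t (e : cochain t) := cocycle kap t (coef e) /\
  forall c : 'I_n, (r <= c)%N -> forall a b k, coef e a b (k + U_(c))%MM = 0.

Lemma cocycle_in_sh r c t (e : cochain t.+1) :
  cocycle_in r e -> cocycle_in r (sh c e).
Proof.
case=> -[eS eA eC eK] er; split; last first.
  by move=> c' rc' a b k; rewrite coef_sh -addmA (addmC U_(c')%MM) addmA er.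
split=> [a b k kt|a b k|a b c' k|s k]; rewrite ?coef_sh.
- by apply: eS; rewrite mdegD mdeg1 addn1 eqSS.
- exact: eA.
- have sw x : (k + U_(x) + U_(c) = k + U_(c) + U_(x))%MM.
    by rewrite -!addmA (addmC U_(x)%MM).
  by rewrite !sw.
by rewrite -[RHS](eK s (k + U_(c))%MM); apply: eq_bigr => a _; apply: eq_bigr => b _;
  rewrite coef_sh.
Qed.

Lemma cocycle_space r t : exists U : {vspace cochain t}, forall e, e \in U <-> cocycle_in r e.
Proof.
apply: vspace_of_pred => [|x u v [[uS uA uC uK] ur] [[vS vA vC vK] vr]].
  split; last by move=> *; rewrite coef0.
  split=> [*|*|*|s k]; rewrite ?coef0 ?oppr0 ?subr0 ?addr0 //.
  by rewrite big1 // => a _; rewrite big1 // => b _; rewrite coef0 mulr0.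
split; last by move=> c rc a b k; rewrite coef_lin ur // vr // mulr0 addr0.
split=> [a b k kt|a b k|a b c k|s k]; rewrite ?coef_lin.
- by rewrite uS // vS // mulr0 addr0.
- by rewrite uA vA mulrN opprD.
- transitivity (x * (coef u b c (k + U_(a))%MM - coef u a c (k + U_(b))%MM +
      coef u a b (k + U_(c))%MM) + (coef v b c (k + U_(a))%MM -
      coef v a c (k + U_(b))%MM + coef v a b (k + U_(c))%MM)); first by ring.
  by rewrite uC vC mulr0 addr0.
transitivity (x * (\sum_a \sum_b kap s a b * coef u a b k) +
              \sum_a \sum_b kap s a b * coef v a b k); last first.
  by rewrite uK vK mulr0 addr0.
rewrite mulr_sumr -big_split; apply: eq_bigr => a _ /=.
rewrite mulr_sumr -big_split; apply: eq_bigr => b _ /=.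
by rewrite coef_lin mulrDr mulrCA.
Qed.

Hypothesis nondegenerate : forall y z : 'I_n -> F,
  (forall s, \sum_a \sum_b kap s a b * (y a * z b) = 0) ->
  forall i j, y i * z j = y j * z i.

(* A cocycle with x_a e = y_a w for all a forces w k to be a decomposable y /\ z in the
   annihilator of K, for every monomial k. *)
Lemma eigencochain_eq0 (i : 'I_n) (y : 'I_n -> F) t (e : cochain t.+1) (w : cochain t) :
  cocycle kap t.+1 (coef e) -> cocycle kap t (coef w) -> y i = 1 ->
  (forall a, sh a e = y a *: w) -> w = 0.
Proof.
move=> [_ _ eC _] [_ wA _ wK] yi ew; apply: coef_inj => a b k; rewrite coef0.
have ewE c a' b' : coef e a' b' (k + U_(c))%MM = y c * coef w a' b' k.
  by rewrite -coef_sh ew -[y c *: w]addr0 coef_lin coef0 addr0.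
pose z c := - coef w c i k.
(* Closedness for the triple [a'], [b'], [i], together with [y i = 1]. *)
have wz a' b' : coef w a' b' k = y a' * z b' - y b' * z a'.
  have := eC a' b' i k; rewrite !ewE yi mul1r => /eqP; rewrite addrC addr_eq0 => /eqP ->.
  by rewrite /z; ring.
rewrite wz (nondegenerate (y := y) (z := z)) ?subrr // => s.
have := wK s k; under eq_bigr do under eq_bigr do rewrite wz mulrBr.
under eq_bigr do rewrite sumrB; rewrite sumrB [X in _ - X]exchange_big /=.
have -> : \sum_j \sum_i kap s i j * (y j * z i) = - \sum_a \sum_b kap s a b * (y a * z b).
  rewrite -sumrN; apply: eq_bigr => c _; rewrite -sumrN; apply: eq_bigr => c' _.
  by rewrite kap_skew mulNr.
rewrite opprK -mulr2n => /eqP; rewrite -mulr_natr mulf_eq0 pnatr_eq0 orbF => /eqP.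
by [].
Qed.

Lemma sh_comm a b t (e : cochain t.+2) : sh a (sh b e) = sh b (sh a e).
Proof.
by apply: coef_inj => a' b' k; rewrite !coef_sh -!addmA (addmC U_(a)%MM).
Qed.

(* When x_i is bijective between consecutive degrees, the operators x_a x_i^(-1)
   commute, so that they have a common eigenvector. *)
Lemma cocycle_in_shift_space (i : 'I_n) t (U : {vspace cochain t.+2})
    (U' : {vspace cochain t.+1}) :
    (forall e, e \in U <-> cocycle_in i.+1 e) ->
    (forall e, e \in U' <-> cocycle_in i.+1 e) ->
    (forall e : cochain t.+1, e \in U' -> sh i e = 0 -> e = 0) ->
    (forall u, u \in U' -> exists2 e, e \in U & sh i e = u) ->
  U' = 0%VS.
Proof.
move=> UP UP' inj surj; apply/eqP; rewrite -dimv_eq0 -leqn0 leqNgt; apply/negP => d_gt0.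
set d := \dim U' in d_gt0; pose b (p : 'I_d) := tnth (vbasis U') p.
have b_in p : b p \in U' by apply: vbasis_mem; apply: mem_tnth.
have cE p : exists e, e \in U /\ sh i e = b p.
  by have [e eU eb] := surj _ (b_in p); exists e.
have [c cP] := fin_all_exists cE.
pose bet (v : 'rV[F]_d) := \sum_p v 0 p *: b p.
pose gam (v : 'rV[F]_d) := \sum_p v 0 p *: c p.
(* The matrix of [sh a] composed with the inverse of [sh i], in the basis [b] with preimages [c]. *)
pose M a : 'M[F]_d := \matrix_(p, q) coord (vbasis U') q (sh a (c p)).
have shU a e : e \in U -> sh a e \in U'.
  by move/UP => eC; apply/UP'/cocycle_in_sh.
have gamU v : gam v \in U.
  by apply: memv_suml => p _; apply: memvZ; case: (cP p).
have betU v : bet v \in U'.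
  by apply: memv_suml => p _; apply: memvZ.
have shM a v : sh a (gam v) = bet (v *m M a).
  rewrite linear_sum /bet; under [RHS]eq_bigr do rewrite mxE scaler_suml.
  rewrite exchange_big; apply: eq_bigr => p _ /=; rewrite linearZ /=.
  rewrite {1}(coord_vbasis (shU a (c p) (proj1 (cP p)))) scaler_sumr.
  by apply: eq_bigr => q _; rewrite mxE scalerA /b (tnth_nth 0).
have shi v : sh i (gam v) = bet v.
  rewrite linear_sum; apply: eq_bigr => p _ /=; rewrite linearZ /=.
  by case: (cP p) => _ ->.
have bet_inj v w : bet v = bet w -> v = w.
  move=> vw; apply/rowP => p.
  have fr := basis_free (vbasisP U').
  have E u : coord (vbasis U') p (bet u) = u 0 p.
    rewrite /bet; under eq_bigr do rewrite /b (tnth_nth 0).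
    exact: (coord_sum_free (fun q => u 0 q) p fr).
  by rewrite -!E vw.
(* By injectivity of [sh i] it suffices to compare after one more [sh i], where everything is a
   composite of commuting shifts. *)
have Mcomm a a' : M a *m M a' = M a' *m M a.
  apply/row_matrixP => p; rewrite !rowE !mulmxA; move: (delta_mx 0 p) => v.
  apply: bet_inj; rewrite -!shM; apply/eqP; rewrite -subr_eq0; apply/eqP/inj.
    by rewrite memvB // shU.
  rewrite linearB /= sh_comm shi (sh_comm i a) shi -!shM.
  by rewrite sh_comm subrr.
have [A B|v v0 /allP vM] := common_eigenvector (As := [seq M a | a <- enum 'I_n]) d_gt0.
  by move=> /mapP[a _ ->] /mapP[a' _ ->]; apply: Mcomm.
have vE a : exists x, v *m M a = x *: v.
  by apply/sub_rVP/vM; apply: map_f; rewrite mem_enum.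
have [y yE] := fin_all_exists vE.
have yi : y i = 1.
  have : v *m M i = v by apply: bet_inj; rewrite -shM shi.
  rewrite yE => /eqP; rewrite -subr_eq0 -{2}[v]scale1r -scalerBl scaler_eq0.
  by rewrite (negbTE v0) orbF subr_eq0 => /eqP.
have bet0 : bet v = 0.
  apply: (eigencochain_eq0 (i := i) (y := y) (e := gam v)) yi _.
  - by case: (proj1 (UP _) (gamU v)).
  - by case: (proj1 (UP' _) (betU v)).
  move=> a; rewrite shM yE /bet scaler_sumr; apply: eq_bigr => p _.
  by rewrite mxE scalerA.
move/eqP: v0; apply; apply: bet_inj; rewrite bet0.
by rewrite /bet big1 // => p _; rewrite mxE scale0r.
Qed.

(** A cocycle killed by [x_i] as well falls under the hypothesis, so [x_i] is injective on the
    larger spaces above degree [t0]. Their dimensions decrease until [x_i] becomes bijective, where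
    [cocycle_in_shift_space] applies. *)
Lemma cocycle_in_step (i : 'I_n) t0 :
    (forall t (e : cochain t), (t0 <= t)%N -> cocycle_in i e -> e = 0) ->
  exists t1, forall t (e : cochain t), (t1 <= t)%N -> cocycle_in i.+1 e -> e = 0.
Proof.
move=> H0; pose U t := projT1 (cid (cocycle_space i.+1 t)).
have UP t e : e \in U t <-> cocycle_in i.+1 e by apply: (projT2 (cid (cocycle_space i.+1 t))).
have inj t (e : cochain t.+1) : (t0 <= t)%N -> e \in U t.+1 -> sh i e = 0 -> e = 0.
  move=> t0t /UP[eC er] sh0; apply: H0; first exact: leqW.
  split=> // c ic a b k; have [ci|ci] := eqVneq c i.
    by rewrite ci -coef_sh sh0 coef0.
  by apply: er; rewrite ltn_neqAle eq_sym ic andbT; apply: contra ci => /eqP /val_inj ->.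
pose f t : 'Hom(cochain t.+1, cochain t) := linfun (@sh i t).
have fE t e : f t e = sh i e by rewrite lfunE.
have fU t : (f t @: U t.+1 <= U t)%VS.
  apply/subvP => _ /memv_imgP[e /UP eC ->]; rewrite fE.
  exact/UP/cocycle_in_sh.
have fdim t : (t0 <= t)%N -> \dim (f t @: U t.+1) = \dim (U t.+1).
  move=> t0t; apply: limg_dim_eq; apply/eqP; rewrite -subv0; apply/subvP => e.
  rewrite memv_cap memv_ker fE memv0 => /andP[eU /eqP e0].
  by rewrite (inj t e).
have dU t : (t0 <= t)%N -> (\dim (U t.+1) <= \dim (U t))%N.
  by move=> t0t; rewrite -fdim //; apply: dimvS.
(* Starting at [t0.+1] makes [x_i] injective on the target of the bijection too, as
   [cocycle_in_shift_space] requires. *)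
have [|[//|t] t0t dE] := @nonincreasing_stabilizes (fun t => \dim (U t)) t0.+1.
  by move=> t t0t; apply: dU; apply: ltnW.
have U0 : U t.+1 = 0%VS.
  apply: (cocycle_in_shift_space (UP t.+2) (UP t.+1)) => [e|u uU].
    by apply: inj; rewrite -ltnS.
  have fUE : (f t.+1 @: U t.+2)%VS = U t.+1.
    apply/eqP; rewrite eqEdim fU (fdim _ (ltnW t0t)); rewrite /= in dE.
    by rewrite dE leqnn.
  by move: uU; rewrite -fUE => /memv_imgP[e eU ->]; exists e; rewrite ?fE.
exists t.+1 => s e ts /UP eU.
suff : \dim (U s) = 0%N by move/eqP; rewrite dimv_eq0 => /eqP E; move: eU; rewrite E memv0 => /eqP.
elim: s ts {e eU} => // s IH; rewrite leq_eqVlt => /orP[/eqP <-|ts]; first by rewrite U0 dimv0.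
rewrite ltnS in ts; apply/eqP; rewrite -leqn0 -(IH ts); apply: dU.
exact: leq_trans (ltnW t0t) ts.
Qed.

(** Induction on the number [r] of variables allowed to act nontrivially: for [r = 0] nothing
    survives in positive degree, since every monomial there contains a variable; for [r = n] there
    is no restriction. *)
Theorem cocycle_eventually0 :
  exists T, forall l, cocycle kap T l -> forall a b k, l a b k = 0.
Proof.
have [t0 H0] : exists t0, forall t (e : cochain t), (t0 <= t)%N -> cocycle_in n e -> e = 0.
  suff H r : (r <= n)%N -> exists t0, forall t (e : cochain t),
      (t0 <= t)%N -> cocycle_in r e -> e = 0 by apply: H.
  elim: r => [_|r IH rn].
    exists 1%N => t e t_gt0 [[eS _ _ _] e0]; apply: coef_inj => a b k; rewrite coef0.
    have [kt|/eS //] := eqVneq (mdeg k) t.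
    have [/existsP[c kc]|k0] := boolP [exists c : 'I_n, k c != 0%N].
      by rewrite -(submK (m := U_(c)%MM) (m' := k)) ?lep1mP // e0.
    suff kz : k = 0%MM by rewrite -kt kz mdeg0 in t_gt0.
    by apply/mnmP => c; apply/eqP; rewrite mnm0E; apply: contraR k0 => kc;
      apply/existsP; exists c.
  have [t0 H0] := IH (ltnW rn).
  exact: (@cocycle_in_step (Ordinal rn) t0 H0).
exists t0 => l lC a b k; have [lS lA lCl lK] := lC.
have lt a' b' k' : (t0 < mdeg k')%N -> l a' b' k' = 0.
  by move=> kt; apply: lS; rewrite neq_ltn kt orbT.
rewrite -(coef_cochain_of a b k lt) (H0 t0 (cochain_of t0 l)) ?coef0 //.
split; last by move=> c; rewrite leqNgt ltn_ord.
have E a' b' k' := coef_cochain_of a' b' k' lt.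
split=> [a' b' k' kt|a' b' k'|a' b' c' k'|s k']; rewrite ?E.
- exact: lS.
- exact: lA.
- exact: lCl.
by rewrite -[RHS](lK s k'); apply: eq_bigr => a' _; apply: eq_bigr => b' _; rewrite E.
Qed.

End Nullstellensatz.

(** * Coordinates on exterior powers and tensor products *)

Section Spanning.
Variable F : fieldType.
Implicit Types U V W : vectType F.

Lemma coord_vbasis_tnth V (i j : 'I_(\dim {:V})) :
  coord (vbasis {:V}) i (tnth (vbasis {:V}) j) = (i == j)%:R.
Proof.
have fr := basis_free (vbasisP {:V}).
by rewrite (tnth_nth 0) (coord_free j i fr) eq_sym.
Qed.

Lemma quotv_eq0 V (U : {vspace V}) : {: quotv U}%VS = 0%VS <-> forall v, v \in U.
Proof.
split=> [U0 v|UV]; last first.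
  apply/eqP; rewrite -subv0 -limg_quot_pi; apply/subvP => _ /memv_imgP[v _ ->].
  by rewrite memv0 -memv_ker lker_quot_pi.
by rewrite -(lker_quot_pi U) memv_ker -memv0 -U0 memvf.
Qed.

Lemma tens_suml U V (I : Type) (r : seq I) (c : I -> F) (u : I -> U) (v : V) :
  tens (\sum_(i <- r) c i *: u i) v = \sum_(i <- r) c i *: tens (u i) v.
Proof.
elim: r => [|i r IH]; last by rewrite !big_cons tens_linearl IH.
by rewrite !big_nil; apply/matrixP => i j; rewrite !mxE linear0 mul0r.
Qed.

Lemma tens_sumr U V (I : Type) (r : seq I) (c : I -> F) (u : U) (v : I -> V) :
  tens u (\sum_(i <- r) c i *: v i) = \sum_(i <- r) c i *: tens u (v i).
Proof.
elim: r => [|i r IH]; last by rewrite !big_cons tens_linearr IH.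
by rewrite !big_nil; apply/matrixP => i j; rewrite !mxE linear0 mulr0.
Qed.

Lemma tensNl U V (u : U) (v : V) : tens (- u) v = - tens u v.
Proof. by apply/matrixP => i j; rewrite !mxE linearN mulNr. Qed.

Lemma tens0l U V (v : V) : tens (0 : U) v = 0.
Proof. by apply/matrixP => i j; rewrite !mxE linear0 mul0r. Qed.

Lemma tens0r U V (u : U) : tens u (0 : V) = 0.
Proof. by apply/matrixP => i j; rewrite !mxE linear0 mulr0. Qed.

Lemma tensor_span U V (m : tensor U V) :
  m = \sum_i \sum_j (m : 'M_(_, _)) i j *:
        tens (tnth (vbasis {:U}) i) (tnth (vbasis {:V}) j).
Proof.
apply/matrixP => i j; rewrite summxE (bigD1 i) //= [X in _ + X]big1 => [|i' ii].
  rewrite addr0 summxE (bigD1 j) //= [X in _ + X]big1 => [|j' jj].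
    by rewrite addr0 !mxE !coord_vbasis_tnth !eqxx !mulr1.
  by rewrite !mxE !coord_vbasis_tnth (eq_sym j) (negbTE jj) !mulr0.
rewrite summxE big1 // => j' _.
by rewrite !mxE !coord_vbasis_tnth (eq_sym i) (negbTE ii) mul0r mulr0.
Qed.

Lemma tensor_linear_eq0 U V W (f : {linear tensor U V -> W}) :
  (forall u v, f (tens u v) = 0) -> forall m, f m = 0.
Proof.
move=> f0 m; rewrite (tensor_span m) linear_sum big1 // => i _.
by rewrite linear_sum big1 // => j _; rewrite linearZ /= f0 scaler0.
Qed.

Lemma incr_mono k n (f : incr k n) (i j : 'I_k) : (i < j)%N -> (val f i < val f j)%N.
Proof. by have /forallP/(_ i)/forallP/(_ j)/implyP := valP f. Qed.

Lemma incr_inj k n (f : incr k n) : injective (val f).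
Proof.
move=> i j fij; apply: val_inj.
by case: (ltngtP i j) => // /(incr_mono f); rewrite fij ltnn.
Qed.

(** Both images have [k] elements, so they agree, and the increasing enumeration of a set is
    unique. *)
Lemma incr_eq k n (f g : incr k n) :
  (forall i, exists j, val f i = val g j) -> f = g.
Proof.
move=> fg.
have mapu (h : incr k n) : uniq [seq val h i | i <- enum 'I_k].
  by rewrite map_inj_uniq ?enum_uniq //; apply: incr_inj.
have sorted_h (h : incr k n) : sorted ltn [seq val (val h i) | i <- enum 'I_k].
  have : sorted (fun i j : 'I_k => (i < j)%N) (enum 'I_k).
    by have := iota_ltn_sorted 0 k; rewrite -val_enum_ord sorted_map.
  by rewrite sorted_map; apply: sub_sorted => i j; apply: incr_mono.
have sub : {subset [seq val f i | i <- enum 'I_k] <= [seq val g i | i <- enum 'I_k]}.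
  move=> _ /mapP[i _ ->]; have [j ->] := fg i.
  by apply: map_f; rewrite mem_enum.
have [_ E] := uniq_min_size (mapu f) sub (eq_leq (etrans (size_map _ _) (esym (size_map _ _)))).
have {E} : [seq val (val f i) | i <- enum 'I_k] = [seq val (val g i) | i <- enum 'I_k].
  apply: (irr_sorted_eq ltn_trans ltnn); rewrite ?sorted_h // => a.
  by rewrite !(map_comp val); apply: eq_mem_map.
move=> E; apply/val_inj/ffunP => i; apply: val_inj.
have ie : i \in enum 'I_k by rewrite mem_enum.
exact: (eq_in_map _ _ _).2 E i ie.
Qed.

Lemma ext_span k V (x : ext k V) :
  x = \sum_f ((x : {ffun _ -> _}) f : F) *:
        wedge [tuple tnth (vbasis {:V}) (val f i) | i < k].
Proof.
apply/ffunP => g; rewrite sum_ffunE (bigD1 g) //= [X in _ + X]big1 => [|f fg].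
  rewrite !ffunE addr0 [X in \det X](_ : _ = 1%:M) ?det1; first by rewrite [RHS]mulr1.
  apply/matrixP => i j; rewrite !mxE tnth_mktuple coord_vbasis_tnth.
  by rewrite (inj_eq (@incr_inj _ _ g)) eq_sym.
(* Some value of [f] is missed by [g], so the minor has a zero row. *)
rewrite !ffunE; have [i iP] : exists i, forall j, val f i != val g j.
  apply: contrapT => H; move/eqP: fg; apply; apply: incr_eq => i.
  apply: contrapT => ni; apply: H; exists i => j; apply/eqP => ij.
  by apply: ni; exists j.
rewrite (expand_det_row _ i) big1 ?scaler0 // => j _.
by rewrite !mxE tnth_mktuple coord_vbasis_tnth eq_sym (negbTE (iP j)) mul0r.
Qed.

Lemma ext_linear_eq0 k V W (f : {linear ext k V -> W}) :
  (forall v : k.-tuple V, f (wedge v) = 0) -> forall x, f x = 0.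
Proof.
move=> f0 x; rewrite (ext_span x) linear_sum big1 // => g _.
by rewrite linearZ /= f0 scaler0.
Qed.

End Spanning.

Section Coordinates.
Variables (F : numClosedFieldType) (V : vectType F).
Local Notation n := (\dim {:V}).
Local Notation e := (tnth (vbasis {:V})).
Implicit Types (x : ext 2 V) (a b : dual V) (k : 'X_{1..n}).

Definition first_of (f : incr 2 n) : 'I_n := val f ord0.
Definition second_of (f : incr 2 n) : 'I_n := val f ord_max.

Lemma ord2P (P : 'I_2 -> Prop) : P ord0 -> P ord_max -> forall i, P i.
Proof.
by move=> P0 P1 [[|[|//]] H]; [rewrite (_ : Ordinal H = ord0) | rewrite (_ : Ordinal H = ord_max)];
  rewrite //; apply: val_inj.
Qed.

Lemma ext2_span x : x = \sum_f ((x : {ffun _ -> _}) f : F) *: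
  wedge [tuple e (first_of f); e (second_of f)].
Proof.
rewrite {1}(ext_span x); apply: eq_bigr => f _; congr (_ *: wedge _).
by apply: eq_from_tnth; apply: ord2P; rewrite tnth_mktuple.
Qed.

(* The coefficients of x as a skew form: x is half the sum of the
   skew_coord x i j e_i /\ e_j (skew_coord_wedge). *)
Definition skew_coord x (i j : 'I_n) : F := \sum_f (x : {ffun _ -> _}) f *
  (((first_of f == i) && (second_of f == j))%:R -
   ((first_of f == j) && (second_of f == i))%:R).

Lemma skew_coord_skew x i j : skew_coord x i j = - skew_coord x j i.
Proof. by rewrite -sumrN; apply: eq_bigr => f _; rewrite -mulrN opprB. Qed.

Lemma skew_coord_sum (W : lmodType F) x (g : 'I_n -> 'I_n -> W) :
  \sum_i \sum_j skew_coord x i j *: g i j =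
  \sum_f ((x : {ffun _ -> _}) f : F) *:
    (g (first_of f) (second_of f) - g (second_of f) (first_of f)).
Proof.
have D (u v : 'I_n) : \sum_i \sum_j ((u == i) && (v == j))%:R *: g i j = g u v.
  rewrite (bigD1 u) //= [X in _ + X]big1 => [|i iu].
    rewrite addr0 (bigD1 v) //= [X in _ + X]big1 => [|j jv].
      by rewrite !eqxx scale1r addr0.
    by rewrite (eq_sym v) (negbTE jv) andbF scale0r.
  by apply: big1 => j _; rewrite (eq_sym u) (negbTE iu) scale0r.
transitivity (\sum_f \sum_i \sum_j ((x : {ffun _ -> _}) f : F) *:
  (((first_of f == i) && (second_of f == j))%:R *: g i j -
   ((second_of f == i) && (first_of f == j))%:R *: g i j)).
  under [LHS]eq_bigr do under eq_bigr do rewrite /skew_coord scaler_suml.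
  under [LHS]eq_bigr do rewrite exchange_big /=.
  rewrite exchange_big; apply: eq_bigr => f _; apply: eq_bigr => i _.
  apply: eq_bigr => j _ /=; rewrite -scalerA scalerBl; congr (_ *: (_ - _ *: _)).
  by rewrite andbC.
apply: eq_bigr => f _; under eq_bigr do rewrite -scaler_sumr.
rewrite -scaler_sumr; congr (_ *: _); under eq_bigr do rewrite sumrB.
by rewrite sumrB !D.
Qed.

Lemma skew_coord_wedge x :
  \sum_i \sum_j skew_coord x i j *: wedge [tuple e i; e j] = x *+ 2.
Proof.
rewrite skew_coord_sum mulr2n {2 3}(ext2_span x) -big_split; apply: eq_bigr => f _ /=.
by rewrite -scalerDr [in LHS](wedge_swap (e (second_of f))) opprK.
Qed.

Lemma ext_lift_comb d (U W : vectType F) (f g h : d.-tuple U -> W) c w :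
  (forall t, h t = c *: f t + g t) -> ext_lift h w = c *: ext_lift f w + ext_lift g w.
Proof.
move=> hE; rewrite scaler_sumr -big_split; apply: eq_bigr => i _ /=.
by rewrite hE scalerDr !scalerA mulrC.
Qed.

Lemma ext_pairing_is_linear (w : ext 2 (dual V)) : linear (ext_pairing w).
Proof.
by move=> c u v; apply: ext_lift_comb => t; apply: ext_lift_is_linear.
Qed.
HB.instance Definition _ w :=
  GRing.isLinear.Build F (ext 2 V) F^o _ (ext_pairing w) (ext_pairing_is_linear w).

Lemma ext_pairing2 a b u v :
  ext_pairing (wedge [tuple a; b]) (wedge [tuple u; v]) = a u * b v - a v * b u.
Proof.
rewrite ext_pairing_wedge (expand_det_row _ ord0) !big_ord_recl big_ord0 addr0.
by rewrite /cofactor !det_mx11 !mxE /= expr0 mul1r expr1 mulN1r mulrN.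
Qed.

Lemma ext_pairing_coord a b x : ext_pairing (wedge [tuple a; b]) x =
  \sum_i \sum_j skew_coord x i j * (a (e i) * b (e j)).
Proof.
rewrite (skew_coord_sum x (fun i j => a (e i) * b (e j) : F^o)).
rewrite {1}(ext2_span x) linear_sum; apply: eq_bigr => f _.
by rewrite linearZ /= ext_pairing2.
Qed.

Definition dual_of (y : 'I_n -> F) : dual V :=
  linfun (fun v => \sum_i coord (vbasis {:V}) i v * y i : F^o).

Lemma dual_of_lin (y : 'I_n -> F) :
  linear (fun v : V => \sum_i coord (vbasis {:V}) i v * y i : F^o).
Proof.
move=> c u v; rewrite scaler_sumr -big_split; apply: eq_bigr => i _ /=.
by rewrite linearP mulrDl -mulrA.
Qed.

Lemma dual_ofE y i : dual_of y (e i) = y i.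
Proof.
pose f : {linear V -> F^o} := HB.pack (fun v : V => \sum_i coord (vbasis {:V}) i v * y i : F^o)
  (GRing.isLinear.Build F V F^o _ _ (dual_of_lin y)).
rewrite /dual_of (lfunE f) /= (bigD1 i) //= coord_vbasis_tnth eqxx mul1r big1 ?addr0 // => j ji.
by rewrite coord_vbasis_tnth (negbTE ji) mul0r.
Qed.

Lemma wedge_neq0 a b i j : a (e i) * b (e j) <> a (e j) * b (e i) ->
  wedge [tuple a; b] <> 0.
Proof.
move=> ab w0; apply: ab; apply/eqP; rewrite -subr_eq0 -ext_pairing2 w0.
by rewrite /ext_pairing linear0.
Qed.

Lemma dual_eq0 a : (forall i, a (e i) = 0) -> a = 0.
Proof.
move=> a0; apply/lfunP => v; rewrite lfunE (vbasis_sum v) linear_sum big1 // => i _.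
by rewrite linearZ /= a0 scaler0.
Qed.

Lemma wedge_proportional a b : a <> 0 ->
  (forall i j, a (e i) * b (e j) = a (e j) * b (e i)) -> wedge [tuple a; b] = 0.
Proof.
move=> a0 ab; have [i ai] : exists i, a (e i) != 0.
  apply: contrapT => H; apply: a0; apply: dual_eq0 => i.
  by apply: contrapT => /eqP ai; apply: H; exists i.
have -> : b = (b (e i) / a (e i)) *: a.
  apply/eqP; rewrite -subr_eq0; apply/eqP/dual_eq0 => j.
  rewrite add_lfunE opp_lfunE scale_lfunE; apply/eqP; rewrite subr_eq0; apply/eqP.
  apply: (mulfI ai); rewrite ab -[RHS]/(a (e i) * (b (e i) / a (e i) * a (e j))).
  by rewrite mulrA [a (e i) * _]mulrC divfK // mulrC.
have := @wedge_multilinear _ 2 (dual V) [tuple a; a] ord_max (b (e i) / a (e i)) a 0.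
have E z : set_tnth [tuple a; a] ord_max z = [tuple a; z].
  by apply: eq_from_tnth; apply: ord2P; rewrite set_tnthE.
have W0 : wedge [tuple a; 0 : dual V] = 0.
  have := @wedge_multilinear _ 2 (dual V) [tuple a; a] ord_max (-1) 0 0.
  by rewrite !E scaler0 addr0 scaleN1r addNr.
rewrite !E addr0 W0 addr0 => ->.
by rewrite (wedge_alternating (isT : (0 : 'I_2) != 1)) ?scaler0.
Qed.

(** The default 0 for monomials of the wrong degree provides the vanishing outside degree [q] that
    [cocycle] asks for. *)
Definition symX q k : sym q V := insubd (0 : sym_type q V) ('X_[k] : {mpoly F[n]}).

End Coordinates.
Arguments symX {F} V q k.

(** * The Koszul module *)

Section KoszulModule.
Variables (F : numClosedFieldType) (V : vectType F) (K : {vspace ext 2 V}).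
Local Notation n := (\dim {:V}).
Local Notation e := (tnth (vbasis {:V})).
Implicit Types (x : ext 2 V) (a b : dual V) (k : 'X_{1..n}).

Lemma val_symX q k :
  mpoly_of_dhomog (symX V q k) = if mdeg k == q then 'X_[k] else 0.
Proof. by rewrite [LHS](val_insubd (0 : dhomog n F q)) dhomogX. Qed.

Lemma symX_eq0 q k : mdeg k != q -> symX V q k = 0.
Proof. by move=> kq; apply: val_inj; rewrite /= val_symX (negbTE kq). Qed.

Lemma sym_span q (s : sym q V) :
  s = \sum_(k <- msupp (mpoly_of_dhomog s)) (mpoly_of_dhomog s)@_k *: symX V q k.
Proof.
apply: val_inj; rewrite /= [RHS](linear_sum (@mpoly_of_dhomog n F q)).
rewrite {1}(mpolyE (mpoly_of_dhomog s)); apply: eq_big_seq => k ks.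
transitivity ((mpoly_of_dhomog s)@_k *: mpoly_of_dhomog (symX V q k)).
  by rewrite val_symX; have /dhomogP/(_ k ks) /= -> := dhomog_is_dhomog s; rewrite eqxx.
by apply/esym; apply: linearZ.
Qed.

Lemma sym_inj_vbasis i : sym_inj (e i) = 'X_i.
Proof.
rewrite /sym_inj (bigD1 i) //= coord_vbasis_tnth eqxx scale1r big1 ?addr0 // => j ji.
by rewrite coord_vbasis_tnth (negbTE ji) scale0r.
Qed.

Lemma sym_mul_symX i q k : sym_mul (e i) (symX V q k) = symX V q.+1 (k + U_(i))%MM.
Proof.
apply: val_inj; rewrite /= sym_inj_vbasis !val_symX mdegD mdeg1 addn1 eqSS.
by case: ifP => _; rewrite ?mulr0 // -mpolyXD addmC.
Qed.

Definition kap_of (s : 'I_(\dim K)) : 'I_n -> 'I_n -> F := skew_coord (tnth (vbasis K) s).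

Lemma kap_of_skew s i j : kap_of s i j = - kap_of s j i.
Proof. exact: skew_coord_skew. Qed.

Lemma ord3P (P : 'I_3 -> Prop) (o1 o2 : 'I_3) : o1 = 1%N :> nat -> o2 = 2%N :> nat ->
  P ord0 -> P o1 -> P o2 -> forall i, P i.
Proof.
move=> E1 E2 P0 P1 P2 [[|[|[|//]]] H].
- by rewrite (_ : Ordinal H = ord0) //; apply: val_inj.
- by rewrite (_ : Ordinal H = o1) //; apply: val_inj.
- by rewrite (_ : Ordinal H = o2) //; apply: val_inj.
Qed.

Lemma koszul_d3_wedge3 q (u v w : V) (s : sym q V) :
  koszul_d3 V q (tens (wedge [tuple u; v; w]) s) =
  tens (wedge [tuple v; w]) (sym_mul u s) - tens (wedge [tuple u; w]) (sym_mul v s)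
    + tens (wedge [tuple u; v]) (sym_mul w s).
Proof.
have T (t : 3.-tuple V) (j : 'I_3) (x y : V) :
    tnth t (lift j (ord0 : 'I_2)) = x -> tnth t (lift j (ord_max : 'I_2)) = y ->
    [tuple tnth t (lift j i) | i < 2] = [tuple x; y].
  by move=> <- <-; apply: eq_from_tnth; apply: ord2P; rewrite tnth_mktuple.
rewrite koszul_d3E !big_ord_recl big_ord0 addr0 addrA.
rewrite /= expr0 scale1r expr1 scaleN1r expr2 mulN1r opprK scale1r.
by rewrite (T _ ord0 v w) // (T _ (lift ord0 ord0) u w) // (T _ (lift ord0 (lift ord0 ord0)) u v).
Qed.

Lemma koszul_image_wedge3 q u v w (s : sym q V) :
  tens (quot_pi K (wedge [tuple v; w])) (sym_mul u s)
    - tens (quot_pi K (wedge [tuple u; w])) (sym_mul v s)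
    + tens (quot_pi K (wedge [tuple u; v])) (sym_mul w s) \in koszul_image K q.+1.
Proof.
apply/memv_imgP; exists (tens (wedge [tuple u; v; w]) s); first exact: memvf.
rewrite comp_lfunE koszul_d3_wedge3 !(linearD, linearN) /= !tens_mapE.
by rewrite !id_lfunE.
Qed.

Lemma cocycle_of_functional q (L : {linear tensor (quotv K) (sym q V) -> F^o}) :
    (forall m, m \in koszul_image K q -> L m = 0) ->
  cocycle kap_of q (fun i j k => L (tens (quot_pi K (wedge [tuple e i; e j])) (symX V q k))).
Proof.
move=> L0; split=> [i j k kq|i j k|i j c k|s k].
- by rewrite symX_eq0 // tens0r linear0.
- by rewrite wedge_swap [X in tens X _]linearN tensNl linearN.
- case: q L L0 => [|q] L L0.
    (* In degree 0 each of the three monomials has the wrong degree, so the terms vanish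
       separately. *)
    by rewrite !symX_eq0 ?tens0r ?linear0 ?subr0 ?addr0 // mdegD mdeg1 addn1.
  rewrite -!sym_mul_symX -linearB -linearD /=.
  exact/L0/koszul_image_wedge3.
(* The factor 2 comes from [skew_coord_wedge], where each pair of indices is counted in both
   orders. *)
have K2 : quot_pi K (tnth (vbasis K) s *+ 2) = 0.
  apply/eqP; rewrite -memv_ker lker_quot_pi rpredMn // vbasis_mem //.
  exact: mem_tnth.
pose G w : F^o := L (tens (quot_pi K w) (symX V q k)).
have GL : linear G by move=> c u v; rewrite /G linearP tens_linearl linearP.
pose G' : {linear ext 2 V -> F^o} := HB.pack G (GRing.isLinear.Build F (ext 2 V) F^o _ G GL).
transitivity (G' (tnth (vbasis K) s *+ 2)); last by rewrite /= /G K2 tens0l linear0.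
rewrite -skew_coord_wedge linear_sum; apply: eq_bigr => i _.
by rewrite linear_sum; apply: eq_bigr => j _; rewrite linearZ.
Qed.

Lemma kap_of_nondegenerate : resonance K = [set 0]%classic ->
  forall y z : 'I_n -> F,
    (forall s, \sum_i \sum_j kap_of s i j * (y i * z j) = 0) ->
  forall i j, y i * z j = y j * z i.
Proof.
move=> R0 y z yz i j; apply: contrapT => yzij.
have w0 : wedge [tuple dual_of y; dual_of z] <> 0.
  by apply: (@wedge_neq0 _ _ _ _ i j); rewrite !dual_ofE.
have wK : annihilator K (wedge [tuple dual_of y; dual_of z]).
  move=> x xK; rewrite (coord_vbasis xK) linear_sum big1 // => s _.
  rewrite linearZ /= -tnth_nth ext_pairing_coord.
  under eq_bigr do under eq_bigr do rewrite !dual_ofE.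
  by rewrite yz scaler0.
have : resonance K (dual_of y) by left; exists (dual_of z); split.
rewrite R0 => y0; apply: yzij.
by rewrite -!(dual_ofE y) y0 !lfunE !mul0r.
Qed.

Lemma resonance0_koszul_module : (2 < n)%N -> resonance K = [set 0]%classic ->
  {: koszul_module K (n - 3)}%VS = 0%VS.
Proof.
move=> n2 R0; apply/quotv_eq0 => m; rewrite -(lker_quot_pi (koszul_image K _)) memv_ker.
have [T D0] := cocycle_eventually0 kap_of_skew (kap_of_nondegenerate R0).
have splits j : exists T sg, splitsS kap_of j T sg.
  by exists T; apply: cocycle0_splits D0 j; apply: kap_of_skew.
apply/eqP; rewrite (vbasis_sum (quot_pi _ _)) big1 // => i _.
(* A coordinate of the Koszul module, pulled back to the tensor product, is a cocycle and therefore
   vanishes. *)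
pose L : {linear tensor (quotv K) (sym (n - 3) V) -> F^o} :=
  coord (vbasis {: koszul_module K (n - 3)}) i \o quot_pi (koszul_image K (n - 3)).
have L0 m' : m' \in koszul_image K (n - 3) -> L m' = 0.
  by rewrite -{1}(lker_quot_pi (koszul_image K _)) memv_ker /= => /eqP ->; rewrite linear0.
have l0 := cocycle_eq0 kap_of_skew n2 splits (cocycle_of_functional L0).
suff L00 m' : L m' = 0 by rewrite -[coord _ _ _]/(L m) L00 scale0r.
apply: tensor_linear_eq0 => u s.
have /memv_imgP[w _ ->] : u \in limg (quot_pi K) by rewrite limg_quot_pi memvf.
have -> : quot_pi K w = \sum_f ((w : {ffun _ -> _}) f : F) *:
    quot_pi K (wedge [tuple e (first_of f); e (second_of f)]).
  by rewrite {1}(ext2_span w) linear_sum; apply: eq_bigr => f _; rewrite linearZ.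
have lin0 c m1 : L m1 = 0 -> L (c *: m1) = 0 by move=> E; rewrite linearZ_LR E; apply: mulr0.
rewrite tens_suml linear_sum big1 // => f _; apply: (lin0 _ _ _).
rewrite (sym_span s) tens_sumr linear_sum big1 // => k _; exact: (lin0 _ _ (l0 _ _ _)).
Qed.

(** * Points of the resonance variety as functionals on the Koszul module *)

Lemma quot_piK (u : quotv K) : quot_pi K (vsval u) = u.
Proof.
rewrite quot_piE daddv_pi_id ?vsvalK ?subvsP //.
by rewrite capvC capv_compl.
Qed.

(** The quotient is carried by a complement of K, and the representative there differs from [x] by
    an element of K. *)
Lemma ext_pairing_quot w x : annihilator K w ->
  ext_pairing w (vsval (quot_pi K x)) = ext_pairing w x.
Proof.
move=> wK; apply/eqP; rewrite -subr_eq0 -linearB; apply/eqP/wK.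
suff : vsval (quot_pi K x) - x \in lker (quot_pi K) by rewrite lker_quot_pi.
by rewrite memv_ker linearB /= quot_piK subrr.
Qed.

Lemma meval_sym_inj a v : (sym_inj v).@[fun i => a (e i)] = a v.
Proof.
rewrite /sym_inj raddf_sum [in RHS](vbasis_sum v) linear_sum; apply: eq_bigr => i _.
by rewrite /= mevalZ mevalXU linearZ.
Qed.

Section EasyDirection.
Variables (q : nat) (a b : dual V).
Hypothesis wK : annihilator K (wedge [tuple a; b]).

Definition point_pairing (u : quotv K) (s : sym q V) : F^o :=
  ext_pairing (wedge [tuple a; b]) (vsval u) * (mpoly_of_dhomog s).@[fun i => a (e i)].

Lemma point_pairing_tens u s : tens_lift point_pairing (tens u s) = point_pairing u s.
Proof.
apply: tens_lift_tens => [t c x y|t c x y]; rewrite /point_pairing.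
  by rewrite !linearP mulrDl -scalerAl.
have -> : mpoly_of_dhomog (c *: x + y) = c *: mpoly_of_dhomog x + mpoly_of_dhomog y.
  exact: (mpoly_of_dhomog_is_linear c x y).
by rewrite mevalD mevalZ mulrDr; congr (_ + _); apply: mulrCA.
Qed.

End EasyDirection.

(** On the image of [u /\ v /\ w] with coefficient [s], the value is a 3 by 3 determinant with rows
    [a], [a], [b], times the value of [s] at [a]. *)
Lemma point_pairing_koszul q a b : annihilator K (wedge [tuple a; b]) ->
  forall m, m \in koszul_image K q -> tens_lift (point_pairing (q := q) a b) m = 0.
Proof.
move=> wK m; case: q m => [|q] m.
  by rewrite memv0 => /eqP ->; rewrite linear0.
case/memv_imgP=> z _ ->.
pose D := (tens_map (quot_pi K) \1 \o koszul_d3 V q)%VF.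
pose Psi : {linear tensor (ext 3 V) (sym q V) -> F^o} := tens_lift (point_pairing a b) \o D.
rewrite -[LHS]/(Psi z); apply: tensor_linear_eq0 => x s.
pose G (x : ext 3 V) : F^o := Psi (tens x s).
have GL : linear G by move=> c u v; rewrite /G tens_linearl linearP.
pose G' : {linear ext 3 V -> F^o} := HB.pack G (GRing.isLinear.Build F (ext 3 V) F^o _ G GL).
rewrite -[LHS]/(G' x); apply: ext_linear_eq0 => v.
have -> : v = [tuple tnth v ord0; tnth v (lift ord0 ord0); tnth v (lift ord0 (lift ord0 ord0))].
  by apply: eq_from_tnth; apply: (@ord3P _ (lift ord0 ord0) (lift ord0 (lift ord0 ord0))).
move: (tnth v _) (tnth v _) (tnth v _) => {v} u v w.
rewrite /= /G /Psi /= /D comp_lfunE koszul_d3_wedge3 !(linearD, linearN) /= !tens_mapE !id_lfunE.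
rewrite !point_pairing_tens // /point_pairing !ext_pairing_quot // !ext_pairing2 /=.
by rewrite !mevalM !meval_sym_inj; ring.
Qed.

Lemma koszul_module_resonance0 q : {: koszul_module K q}%VS = 0%VS ->
  resonance K = [set 0]%classic.
Proof.
move/quotv_eq0 => W0; apply/seteqP; split=> a; last by right.
case=> [[b [wK w0]]|] //; apply: contrapT => a0; apply: w0.
apply: (wedge_proportional a0) => i j; apply: contrapT => ab.
have [l al] : exists l, a (e l) != 0.
  apply: contrapT => H; apply: a0; apply: dual_eq0 => l.
  by apply: contrapT => /eqP al; apply: H; exists l.
(* [x_l^q] is a polynomial of degree [q] that does not vanish at [a], whatever [q] is. *)
have /eqP := point_pairing_koszul wK
  (W0 (tens (quot_pi K (wedge [tuple e i; e j])) (symX V q (U_(l) *+ q)%MM))).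
rewrite point_pairing_tens /point_pairing (ext_pairing_quot _ wK) ext_pairing2.
rewrite val_symX mdegMn mdeg1 mul1n eqxx -mpolyXn rmorphXn /= mevalXU.
rewrite mulf_eq0 expf_eq0 (negbTE al) andbF orbF subr_eq0 => /eqP; exact: ab.
Qed.

End KoszulModule.

Theorem theorem3p1 (R : realType) (V : vectType R[i]) (n : nat)
    (K : {vspace ext 2 V}) :
  \dim {:V} = n -> (3 <= n)%N ->
  resonance K = [set 0]%classic <->
  {: koszul_module K (n - 3)}%VS = 0%VS.
Proof.
move=> <- n3; split; first exact: resonance0_koszul_module.
exact: koszul_module_resonance0.
Qed.
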